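(* Every Banach space with a spreading Schauder basis has property $(\mathfrak{su})$.
   Context: Two sequences $(x_n)$, $(y_n)$ in Banach spaces are $L$-equivalent, written $(x_n)\sim_L(y_n)$, if $\frac1L\|\sum a_ix_i\|\le\|\sum a_iy_i\|\le L\|\sum a_ix_i\|$ for all finitely supported scalar sequences $(a_i)$; they are equivalent if they are $L$-equivalent for some $L\geq 1$. A sequence is spreading if it is equivalent to all of its subsequences. A weak Cauchy sequence is non-trivial if it is not weakly convergent. A basic sequence is a sequence which is a Schauder basis of its closed linear span. A convex block sequence of $(x_n)$ is a sequence of the form $\big(\sum_{i\in F_n}\lambda_i^n x_i\big)_n$, where $(F_n)$ are nonempty finite subsets of $\mathbb{N}$ with $\max F_n<\min F_{n+1}$ for all $n$, $\lambda^n_i\in[0,1]$, and $\sum_{i\in F_n}\lambda_i^n=1$. A basic sequence $(x_n)$ is convex block shiftable if there exist $L>0$ and a subsequence $(y_n)$ of $(x_n)$ such that every convex block sequence $(w_n)$ of $(y_n)$ is uniformly $L$-shift equivalent, i.e. $(w_{n+p})_n\sim_L(w_n)_n$ for every $p\in\mathbb{N}$. A Banach space $X$ has property $(\mathfrak{su})$ if for every non-trivial weak Cauchy sequence $(x_n)$ in $X$ there exists a convex block shiftable sequence $(w_n)$ in $X$ such that $(x_n-w_n)$ is weakly null. *)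

(* Defs.v *)
From HB Require Import structures.
From mathcomp Require Import all_boot all_order all_algebra finmap.
From mathcomp Require Import all_classical all_reals all_analysis.

Set Implicit Arguments.
Unset Strict Implicit.
Unset Printing Implicit Defensive.

Import Order.TTheory GRing.Theory Num.Theory.
Import numFieldNormedType.Exports.

Local Open Scope classical_set_scope.
Local Open Scope ring_scope.

(* A finitely supported scalar family is encoded as a sequence [a : nat -> R]
   together with a bound [n], only the first [n] terms of [a] being used.
   Sequences are indexed from 0. *)

Definition L_equivalent (R : realType) (X Y : normedModType R) (L : R)
    (x : nat -> X) (y : nat -> Y) : Prop :=
  forall (n : nat) (a : nat -> R),
    L^-1 * `|\sum_(i < n) a i *: x i| <= `|\sum_(i < n) a i *: y i| /\
    `|\sum_(i < n) a i *: y i| <= L * `|\sum_(i < n) a i *: x i|.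

Definition equivalent (R : realType) (X Y : normedModType R)
    (x : nat -> X) (y : nat -> Y) : Prop :=
  exists L : R, 1 <= L /\ L_equivalent L x y.

Definition subsequence (T : Type) (x y : nat -> T) : Prop :=
  exists k : nat -> nat,
    {homo k : m n / (m < n)%N} /\ (forall n, y n = x (k n)).

Definition spreading (R : realType) (X : normedModType R)
    (x : nat -> X) : Prop :=
  forall y : nat -> X, subsequence x y -> equivalent x y.

Definition linear_span (R : realType) (X : normedModType R)
    (x : nat -> X) : set X :=
  [set v | exists (n : nat) (a : nat -> R), v = \sum_(i < n) a i *: x i].

Definition schauder_basis_of (R : realType) (X : normedModType R)
    (Y : set X) (x : nat -> X) : Prop :=
  (forall n, Y (x n)) /\
  forall v, Y v ->
    exists! a : nat -> R, series (fun i => a i *: x i) @ \oo --> v.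

Definition schauder_basis (R : realType) (X : normedModType R)
    (x : nat -> X) : Prop :=
  schauder_basis_of [set: X] x.

Definition basic_sequence (R : realType) (X : normedModType R)
    (x : nat -> X) : Prop :=
  schauder_basis_of (closure (linear_span x)) x.

Definition weakly_converges_to (R : realType) (X : normedModType R)
    (x : nat -> X) (v : X) : Prop :=
  forall f : {linear X -> R^o}, continuous f -> f (x n) @[n --> \oo] --> f v.

Definition weakly_convergent (R : realType) (X : normedModType R)
    (x : nat -> X) : Prop :=
  exists v, weakly_converges_to x v.

Definition weakly_null (R : realType) (X : normedModType R)
    (x : nat -> X) : Prop :=
  weakly_converges_to x 0.

Definition weak_cauchy (R : realType) (X : normedModType R)
    (x : nat -> X) : Prop :=
  forall f : {linear X -> R^o}, continuous f -> cauchy (f (x n) @[n --> \oo]).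

Definition nontrivial_weak_cauchy (R : realType) (X : normedModType R)
    (x : nat -> X) : Prop :=
  weak_cauchy x /\ ~ weakly_convergent x.

(* The third condition is max (F n) < min (F n.+1). *)
Definition convex_block_sequence (R : realType) (X : normedModType R)
    (x w : nat -> X) : Prop :=
  exists (F : nat -> {fset nat}) (lambda : nat -> nat -> R),
    [/\ (forall n, F n != fset0),
        (forall n i j, i \in F n -> j \in F n.+1 -> (i < j)%N),
        (forall n i, i \in F n -> 0 <= lambda n i <= 1),
        (forall n, \sum_(i <- F n) lambda n i = 1) &
        (forall n, w n = \sum_(i <- F n) lambda n i *: x i)].

Definition shift_equivalent (R : realType) (X : normedModType R) (L : R)
    (w : nat -> X) : Prop :=
  forall p : nat, L_equivalent L (fun n => w (n + p)%N) w.

Definition convex_block_shiftable (R : realType) (X : normedModType R)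
    (x : nat -> X) : Prop :=
  basic_sequence x /\
  exists (L : R) (y : nat -> X),
    [/\ 0 < L, subsequence x y &
        forall w, convex_block_sequence y w -> shift_equivalent L w].

Definition property_su (R : realType) (X : completeNormedModType R) : Prop :=
  forall x : nat -> X, nontrivial_weak_cauchy x ->
    exists w : nat -> X,
      convex_block_shiftable w /\ weakly_null (fun n => x n - w n).

(* Main.v *)
From HB Require Import structures.
Require Import Defs.
From mathcomp Require Import all_boot all_order all_algebra finmap.
From mathcomp Require Import all_classical all_reals all_analysis.
From mathcomp Require Import ring lra zify.

Set Implicit Arguments.
Unset Strict Implicit.
Unset Printing Implicit Defensive.

Import Order.TTheory GRing.Theory Num.Theory.
Import numFieldNormedType.Exports.

Local Open Scope classical_set_scope.
Local Open Scope ring_scope.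

(** Why the theorem holds. Averaging translates is the tool throughout. By a
    gluing argument a spreading basis [e] has a constant [K] such that any two
    increasing finite patterns carry [K]-equivalent finite sums
    ([spreading_pattern_bound]). A block of a finite sum may therefore be moved to
    the right, by many different amounts, while the norm stays bounded; the mean
    of these translates replaces the block by the sum of its coefficients times a
    long average of [e]. If the sum of the coefficients vanishes, the block is
    erased ([block_suppression]); if all blocks are treated in this way, only a
    combination of long averages remains ([full_smearing]).

    Two cases follow ([spreading_dichotomy]). If the averages of [e] can be made
    small, or if the averages of [e 1 - e 0, e 3 - e 2, ...] can not, then [e] is
    unconditional: every block can be erased. Otherwise the sum [s] of the
    coefficients is a bounded functional, and [e] is weakly Cauchy. In that
    case, averages [u j] of [e] over successive intervals, of lengths so large
    that the averages of differences are summable, satisfy a universal lower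
    estimate: for every finite sum cut into successive blocks with sums [s k],
    the norm of [\sum_k s k *: u (j k)] is bounded by that of the finite sum
    ([sparse_average_bound]). Indeed [u j] may be compared with longer averages
    interlaced with it. Setting [s = 0] in the first case, both are handled by
    the same argument.

    Let [x] be weakly Cauchy, [a] the limits of its coordinates, and [lam] the
    part of [lim s (x n)] which is not carried by the partial sums of [a]. A
    gliding hump writes a subsequence of [x], up to a norm null error, as partial
    sums of [\sum a i *: e i] followed by blocks with sums tending to [lam]. The
    increments of the partial sums along a suitable subsequence [M] have summable
    sums of coefficients, so they form a weakly unconditionally Cauchy series;
    weakly Cauchy blocks whose sums tend to [0] are weakly null
    ([weakly_null_blocks]), by suppression and separation of convex sets. Hence [x]
    differs by a weakly null sequence from
    [w k = \sum_(i < M k) a i *: e i + lam *: u k] ([weak_cauchy_block_form]).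

    If [v] is a convex block sequence of [w], the norm of [\sum_k b k *: v k] is
    equivalent, with constants that do not depend on [v], to [|lam|] times the norm
    of [\sum_k b k *: u k] plus the largest tail [|\sum_(k >= l) b k|]
    ([convex_upper], [convex_lower_bounds]). The upper estimate is summation by
    parts, after a convex combination has been replaced by its worst term; the
    lower one is the universal estimate of the averages if [lam] is not [0], and a
    projection onto one increment otherwise, the increments being then bounded
    below since [x] is not weakly convergent. As the shifts of [v] are again
    convex block sequences of [w], this gives uniform shift equivalence; the same
    estimates show that [w] is basic ([block_form_shiftable]). *)

(** * Functionals and weak convergence *)

Definition sublinear (R : realType) (V : lmodType R) (q : V -> R) : Prop :=
  (forall x y, q (x + y) <= q x + q y) /\
  (forall (t : R) x, 0 <= t -> q (t *: x) <= t * q x).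

Definition linear_fun (R : realType) (V : lmodType R) (f : V -> R) : Prop :=
  forall (a : R) x y, f (a *: x + y) = a * f x + f y.

Section Sublinear.
Variables (R : realType) (V : lmodType R).
Implicit Types (q : V -> R) (x y : V).

Lemma sublinear0 q : sublinear q -> q 0 = 0.
Proof.
move=> [qD qZ]; apply/eqP; rewrite eq_le; apply/andP; split.
  by have := qZ 0 0 (lexx _); rewrite scale0r mul0r.
by have := qD 0 0; rewrite addr0; lra.
Qed.

Lemma sublinear_opp q x : sublinear q -> - q (- x) <= q x.
Proof. by move=> sq; have := sq.1 x (- x); rewrite subrr sublinear0//; lra. Qed.

Lemma sublinearZ q (t : R) x : sublinear q -> 0 <= t -> q (t *: x) = t * q x.
Proof.
move=> sq; rewrite le_eqVlt => /predU1P[<-|t0].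
  by rewrite scale0r mul0r sublinear0.
apply/eqP; rewrite eq_le (sq.2 _ _ (ltW t0))/=.
have ti : 0 <= t^-1 by rewrite invr_ge0 ltW.
have := sq.2 t^-1 (t *: x) ti; rewrite scalerA mulVf ?gt_eqF// scale1r => h.
by move: h; rewrite ler_pdivlMl.
Qed.

(** A sublinear functional that is minimal for the pointwise order can not be
    lowered by averaging along any direction [y], which makes it additive. *)
Lemma minimal_sublinear_linear q :
  sublinear q ->
  (forall r, sublinear r -> (forall x, r x <= q x) -> r = q) ->
  linear_fun q.
Proof.
move=> sq qmin.
pose S y x : set R := [set q (x + t *: y) - t * q y | t in [set t | 0 <= t]].
have Slb y x : lbound (S y x) (- q (- x)).
  move=> _ [t /= t0 <-]; have := sq.1 (x + t *: y) (- x).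
  rewrite addrAC subrr add0r sublinearZ//; lra.
have Shas y x : has_inf (S y x).
  by split; [exists (q (x + 0 *: y) - 0 * q y), 0 => /= | exists (- q (- x))].
pose r y x := inf (S y x).
have rle y x (t : R) : 0 <= t -> r y x <= q (x + t *: y) - t * q y.
  by move=> t0; apply: ge_inf; [exact: (Shas y x).2 | exists t].
have sr y : sublinear (r y).
  split=> [x1 x2|t x].
    rewrite -lerBlDr; apply: lb_le_inf; first exact: (Shas y x1).1.
    move=> _ [t1 /= t10 <-]; rewrite lerBlDr -lerBlDl.
    apply: lb_le_inf; first exact: (Shas y x2).1.
    move=> _ [t2 /= t20 <-].
    have t12 : 0 <= t1 + t2 by lra.
    have := rle y (x1 + x2) _ t12.
    have := sq.1 (x1 + t1 *: y) (x2 + t2 *: y).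
    by rewrite addrACA -scalerDl mulrDl; lra.
  rewrite le_eqVlt => /predU1P[<-|t0].
    by have := rle y (0 *: x) 0 (lexx _); rewrite !scale0r addr0 (sublinear0 sq); lra.
  rewrite -ler_pdivrMl//; apply: lb_le_inf; first exact: (Shas y x).1.
  move=> _ [u /= u0 <-]; rewrite ler_pdivrMl//.
  have tu0 : 0 <= t * u by rewrite mulr_ge0// ltW.
  have := rle y (t *: x) _ tu0.
  by rewrite -scalerA -scalerDr (sublinearZ _ sq (ltW t0)) mulrBr mulrA.
have qadd x y : q (x + y) = q x + q y.
  apply/eqP; rewrite eq_le sq.1/=.
  have rq : r y = q.
    apply: qmin => // z; have := rle y z 0 (lexx _).
    by rewrite scale0r addr0 mul0r subr0.
  by have := rle y x 1 ler01; rewrite rq scale1r; lra.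
have qN x : q (- x) = - q x.
  by have := qadd x (- x); rewrite subrr sublinear0//; lra.
have qZ a x : q (a *: x) = a * q x.
  case: (leP 0 a) => a0; first exact: sublinearZ.
  have a0' : 0 <= - a by rewrite oppr_ge0 ltW.
  by rewrite -[a]opprK scaleNr qN (sublinearZ _ sq a0') !mulNr opprK.
by move=> a x y; rewrite qadd qZ.
Qed.

(** Zorn's lemma, for the reverse pointwise order: the infimum of a chain of
    sublinear functionals below [p] is finite, being at least [- p (- x)], and
    sublinear. *)
Lemma hahn_banach_dominated (p : V -> R) :
  sublinear p -> exists f, linear_fun f /\ forall x, f x <= p x.
Proof.
move=> sp.
pose T := {q : V -> R | sublinear q /\ forall x, q x <= p x}.
pose le (q r : T) := `[< forall x, sval r x <= sval q x >].
have [| | |A tot|[q [sq qp]] qmin] := @Zorn T le.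
- by move=> q; apply/asboolP.
- move=> q r s /asboolP qr /asboolP rs; apply/asboolP => x.
  exact: le_trans (rs x) (qr x).
- move=> [q Pq] [r Pr] /asboolP qr /asboolP rq; apply: eq_exist.
  by apply/funext => x; apply/le_anti; rewrite qr rq.
- have [[q0 Aq0]|A0] := pselect (exists q : T, A q); last first.
    by exists (exist _ p (conj sp (fun x => lexx _))) => s As; case: A0; exists s.
  pose S x : set R := [set sval q x | q in A].
  have Shas x : has_inf (S x).
    split; first by exists (sval q0 x), q0.
    exists (- p (- x)) => _ [[q [sq qp]] _ <-] /=.
    by apply: le_trans (sublinear_opp x sq); rewrite lerN2.
  pose r x := inf (S x).
  have rle (q : T) x : A q -> r x <= sval q x.
    by move=> Aq; apply: ge_inf; [exact: (Shas x).2 | exists q].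
  have sr : sublinear r.
    split=> [x1 x2|t x t0].
      rewrite -lerBlDr; apply: lb_le_inf; first exact: (Shas x1).1.
      move=> _ [q1 Aq1 <-]; rewrite lerBlDr -lerBlDl.
      apply: lb_le_inf; first exact: (Shas x2).1.
      move=> _ [q2 Aq2 <-]; rewrite lerBlDl.
      have [/asboolP q12|/asboolP q21] := tot _ _ Aq1 Aq2.
        apply: le_trans (rle _ _ Aq2) _.
        by apply: le_trans ((svalP q2).1.1 x1 x2) _; rewrite lerD2r.
      apply: le_trans (rle _ _ Aq1) _.
      by apply: le_trans ((svalP q1).1.1 x1 x2) _; rewrite lerD2l.
    move: t0; rewrite le_eqVlt => /predU1P[<-|t0].
      rewrite scale0r mul0r.
      by have := rle _ 0 Aq0; rewrite (sublinear0 (svalP q0).1).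
    rewrite -ler_pdivrMl//; apply: lb_le_inf; first exact: (Shas x).1.
    move=> _ [q Aq <-]; rewrite ler_pdivrMl//.
    by apply: le_trans (rle _ _ Aq) _; exact: ((svalP q).1.2 t x (ltW t0)).
  have rp x : r x <= p x by apply: le_trans (rle _ x Aq0) ((svalP q0).2 x).
  by exists (exist _ r (conj sr rp)) => q Aq; apply/asboolP => x; exact: rle.
- exists q; split=> //; apply: minimal_sublinear_linear => // r sr rq.
  have rp x : r x <= p x by exact: le_trans (rq x) (qp x).
  have := qmin (exist _ r (conj sr rp)).
  by move=> /(_ (introT (asboolP _) rq)) [].
Qed.
End Sublinear.

Lemma exists_nat_gt (R : realType) (K : R) : exists k : nat, K < k%:R.
Proof.
exists (Num.bound `|K|).
exact: le_lt_trans (ler_norm _) (archi_boundP (normr_ge0 _)).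
Qed.

Lemma cvg_seqP (R : realType) (V : normedModType R) (u : nat -> V) (l : V) :
  (u n @[n --> \oo] --> l) <->
  (forall eps : R, 0 < eps ->
     exists N, forall n, (N <= n)%N -> `|u n - l| <= eps).
Proof.
split=> [/cvgrPdist_le ul eps eps0|ul].
  have [N _ Nu] := ul eps eps0; exists N => n Nn.
  by rewrite distrC; exact: Nu.
apply/cvgrPdist_le => eps eps0; have [N Nu] := ul _ eps0.
by exists N => // n /= Nn; rewrite distrC; exact: Nu.
Qed.

Lemma cvg_seq_bounded_norm (R : realType) (V : normedModType R) (u : nat -> V)
    (l : V) :
  u n @[n --> \oo] --> l -> exists2 B : R, 0 < B & forall n, `|u n| <= B.
Proof.
move=> ul; have [N NP] := (cvg_seqP _ _).1 ul 1 ltr01.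
pose s := \sum_(i < N) `|u i|.
have s0 : 0 <= s by rewrite sumr_ge0.
exists (s + (`|l| + 1)) => [|i]; first by have := normr_ge0 l; lra.
case: (ltnP i N) => [iN|Ni].
  have : `|u i| <= s by rewrite /s (bigD1 (Ordinal iN))//= lerDl sumr_ge0.
  by have := normr_ge0 l; lra.
by have := NP _ Ni; have := lerB_dist (u i) l; lra.
Qed.

Lemma cvg_geometric_half (R : realType) :
  (fun k => (2^-1 : R) ^+ k) @ \oo --> (0 : R).
Proof. by apply: cvg_expr; rewrite ger0_norm// invf_lt1// ltr1n. Qed.

Lemma cauchy_seqP (R : realType) (V : completeNormedModType R) (u : nat -> V) :
  (exists l : V, u n @[n --> \oo] --> l) <->
  (forall eps : R, 0 < eps -> exists N, forall i j,
     (N <= i)%N -> (N <= j)%N -> `|u i - u j| <= eps).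
Proof.
split=> [[l ul] eps eps0|uc].
  have [N Nu] := (cvg_seqP _ _).1 ul (eps / 2) (divr_gt0 eps0 (ltr0n _ 2)).
  exists N => i j /Nu iN /Nu jN.
  by have := ler_distD l (u i) (u j); rewrite (distrC l); lra.
apply/cvg_ex/cauchy_cvgP/cauchy_exP => eps eps0.
have [N uN] := uc _ (divr_gt0 eps0 (ltr0n _ 2)).
exists (u N), N => // n /= Nn; rewrite -ball_normE /ball_ /=.
by have := uN N n (leqnn N) Nn; lra.
Qed.

Section Functionals.
Variables (R : realType) (X : normedModType R).
Implicit Types f : X -> R.

Definition bounded_functional f : Prop :=
  linear_fun f /\ exists2 C : R, 0 < C & forall u, `|f u| <= C * `|u|.

Lemma linear_fun0 f : linear_fun f -> f 0 = 0.
Proof. by move=> lf; have := lf 1 0 0; rewrite scaler0 addr0 mul1r; lra. Qed.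

Lemma linear_funZ f (a : R) u : linear_fun f -> f (a *: u) = a * f u.
Proof. by move=> lf; have := lf a u 0; rewrite addr0 linear_fun0// addr0. Qed.

Lemma linear_funD f u v : linear_fun f -> f (u + v) = f u + f v.
Proof. by move=> lf; have := lf 1 u v; rewrite scale1r mul1r. Qed.

Lemma linear_funN f u : linear_fun f -> f (- u) = - f u.
Proof. by move=> lf; rewrite -scaleN1r linear_funZ// mulN1r. Qed.

Lemma linear_funB f u v : linear_fun f -> f (u - v) = f u - f v.
Proof. by move=> lf; rewrite linear_funD// linear_funN. Qed.

Lemma linear_fun_sum f (I : Type) (r : seq I) (P : pred I) (F : I -> X) :
  linear_fun f -> f (\sum_(i <- r | P i) F i) = \sum_(i <- r | P i) f (F i).
Proof.
move=> lf; apply: (big_morph f) => [u v|]; first exact: linear_funD.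
exact: linear_fun0.
Qed.

Lemma bounded_functionalN f :
  bounded_functional f -> bounded_functional (fun u => - f u).
Proof.
move=> [lf [C C0 fC]]; split=> [a u v|]; first by rewrite lf; ring.
by exists C => // u; rewrite normrN.
Qed.

(** Dual form of the distance from the origin to a convex set: the gauge
    [x |-> inf (|x + t d| - t delta)] is sublinear as soon as every point of
    [D] has norm at least [delta], and a linear functional below it is at most
    [- delta] at [- d]. *)
Lemma separating_functional (D : set X) (delta : R) :
  D !=set0 ->
  (forall u v (t : R), D u -> D v -> 0 <= t <= 1 ->
     D (t *: u + (1 - t) *: v)) ->
  (forall u, D u -> delta <= `|u|) ->
  exists f, [/\ linear_fun f, (forall v, `|f v| <= `|v|) &
                forall u, D u -> delta <= f u].
Proof.
move=> [d0 Dd0] Dconv Ddelta.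
pose S (x : X) : set R := [set `|x + td.1 *: td.2| - td.1 * delta |
                      td in [set td : R * X | 0 <= td.1 /\ D td.2]].
have Slb x : lbound (S x) (- `|x|).
  move=> _ [[t d] /= [t0 Dd] <-].
  have := ler_normD (x + t *: d) (- x).
  rewrite addrAC subrr add0r normrN normrZ ger0_norm//.
  by have := ler_wpM2l t0 (Ddelta _ Dd); lra.
have Shas x : has_inf (S x).
  split; last by exists (- `|x|).
  by exists (`|x + 0 *: d0| - 0 * delta), (0, d0).
pose p x := inf (S x).
have ple x t d : 0 <= t -> D d -> p x <= `|x + t *: d| - t * delta.
  by move=> t0 Dd; apply: ge_inf; [exact: (Shas x).2 | exists (t, d)].
have sp : sublinear p.
  split=> [x1 x2|t x].
    rewrite -lerBlDr; apply: lb_le_inf; first exact: (Shas x1).1.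
    move=> _ [[t1 d1] /= [t10 Dd1] <-]; rewrite lerBlDr -lerBlDl.
    apply: lb_le_inf; first exact: (Shas x2).1.
    move=> _ [[t2 d2] /= [t20 Dd2] <-]; rewrite lerBlDl.
    have [t12|t12] := eqVneq (t1 + t2) 0.
      have t1E : t1 = 0 by lra.
      have t2E : t2 = 0 by lra.
      have := ple (x1 + x2) 0 d1 (lexx _) Dd1.
      have := ler_normD x1 x2.
      by rewrite t1E t2E !scale0r !addr0 !mul0r; lra.
    have t12p : 0 < t1 + t2 by rewrite lt_def t12 addr_ge0.
    pose s := t1 / (t1 + t2).
    have s01 : 0 <= s <= 1.
      by rewrite divr_ge0 ?(ltW t12p)//= ler_pdivrMr//; lra.
    have s1E : (t1 + t2) * s = t1 by rewrite /s; field.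
    have s2E : (t1 + t2) * (1 - s) = t2 by rewrite /s; field.
    have := ple (x1 + x2) (t1 + t2) _ (ltW t12p) (Dconv _ _ _ Dd1 Dd2 s01).
    rewrite scalerDr !scalerA s1E s2E.
    have := ler_normD (x1 + t1 *: d1) (x2 + t2 *: d2).
    by rewrite addrACA; lra.
  rewrite le_eqVlt => /predU1P[<-|t0].
    have := ple (0 *: x) 0 d0 (lexx _) Dd0.
    by rewrite !scale0r addr0 normr0 !mul0r; lra.
  rewrite -ler_pdivrMl//; apply: lb_le_inf; first exact: (Shas x).1.
  move=> _ [[u d] /= [u0 Dd] <-]; rewrite ler_pdivrMl//.
  have tu0 : 0 <= t * u by rewrite mulr_ge0// ltW.
  have := ple (t *: x) _ _ tu0 Dd.
  by rewrite -scalerA -scalerDr normrZ gtr0_norm//; lra.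
have [f [lf fp]] := hahn_banach_dominated sp.
have fle x : f x <= `|x|.
  apply: le_trans (fp x) _; have := ple x 0 d0 (lexx _) Dd0.
  by rewrite scale0r addr0 mul0r subr0.
exists f; split=> // [x|u Du].
  rewrite ler_norml fle andbT lerNl -linear_funN//.
  by have := fle (- x); rewrite normrN.
have := fp (- u); rewrite linear_funN//.
have := ple (- u) 1 u ler01 Du; rewrite scale1r addNr normr0; lra.
Qed.

Lemma norming_functional (u : X) :
  exists f, [/\ linear_fun f, (forall v, `|f v| <= `|v|) & f u = `|u|].
Proof.
have [||v|f [lf f1 fu]] := @separating_functional [set u] `|u|.
- by exists u.
- by move=> _ _ t -> -> _ /=; rewrite -scalerDl addrCA subrr addr0 scale1r.
- by move=> ->.
exists f; split=> //; apply/le_anti; rewrite fu// andbT.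
exact: le_trans (ler_norm _) (f1 u).
Qed.

Lemma bounded_functional_continuous f : bounded_functional f ->
  exists2 g : {linear X -> R^o}, g = f :> (X -> R) & continuous g.
Proof.
move=> [lf [C C0 fC]].
have lf' : GRing.linear_for *:%R (f : X -> R^o).
  by move=> a u v; rewrite lf.
pose g : {linear X -> R^o} := HB.pack (f : X -> R^o)
  (GRing.isLinear.Build R X R^o _ f lf').
exists g => //; apply: bounded_linear_continuous.
apply/linear_boundedP; exists C; split; first exact: num_real.
by move=> r Cr u; apply: le_trans (fC u) _; rewrite ler_wpM2r// ltW.
Qed.

Lemma continuous_bounded_functional (g : {linear X -> R^o}) :
  continuous g -> bounded_functional g.
Proof.
move=> cg; split; first by move=> a u v; rewrite linearP.
have /linear_bounded_continuous/linear_boundedP := cg.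
move=> [r [_ rg]]; pose C := Num.max 1 (r + 1).
exists C; first by rewrite lt_max ltr01.
by apply: rg; rewrite lt_max ltrDl ltr01 orbT.
Qed.

Lemma weakly_nullP (x : nat -> X) : weakly_null x <->
  forall f, bounded_functional f ->
    forall eps : R, 0 < eps ->
      exists N, forall n, (N <= n)%N -> `|f (x n)| <= eps.
Proof.
split=> [x0 f bf eps eps0|x0 g cg].
  have [g gf cg] := bounded_functional_continuous bf.
  have := x0 g cg; rewrite linear0 => /cvg_seqP /(_ _ eps0)[N Ng].
  by exists N => n /Ng; rewrite subr0 gf.
rewrite linear0; apply/cvg_seqP => eps eps0.
have [N Ng] := x0 _ (continuous_bounded_functional cg) _ eps0.
by exists N => n /Ng; rewrite subr0.
Qed.

Lemma weak_cauchyP (x : nat -> X) : weak_cauchy x <->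
  forall f, bounded_functional f -> exists l : R, f (x n) @[n --> \oo] --> l.
Proof.
split=> [xc f bf|xc g cg].
  have [g gf cg] := bounded_functional_continuous bf.
  have /cauchy_cvgP gx := xc g cg; exists (lim (g (x n) @[n --> \oo])).
  by rewrite -gf.
apply/cauchy_cvgP.
have [l fl] := xc _ (continuous_bounded_functional cg).
by apply/cvg_ex; exists l.
Qed.

End Functionals.


(** Gliding hump form of the uniform boundedness principle: if
    [3 ^- k * |x (n k)|] tends to infinity, a functional built as a signed sum of
    [3 ^- k] times functionals norming the [x (n k)] is unbounded along [x]; the signs are chosen one after the other so that no
    later term can undo the contribution of the [k]-th one. *)
Lemma weak_cauchy_bounded (R : realType) (X : completeNormedModType R)
    (x : nat -> X) :
  weak_cauchy x -> exists2 B : R, 0 < B & forall n, `|x n| <= B.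
Proof.
move=> /weak_cauchyP xc; apply: contrapT => nB.
have big k : exists n, k%:R <= (3^-1 : R) ^+ k * `|x n|.
  apply: contrapT => nx; apply: nB; exists (k%:R * 3 ^+ k + 1) => [|n].
    by rewrite ltr_wpDl// mulr_ge0// exprn_ge0.
  rewrite leNgt; apply/negP => xn; apply: nx; exists n.
  rewrite exprVn ler_pdivlMl ?exprn_gt0// mulrC; apply: ltW (le_lt_trans _ xn).
  by rewrite lerDl.
have [n nP] := choice big.
have [g gP] := choice (fun k => norming_functional (x (n k))).
pose step k (f : X -> R) : X -> R :=
  let h u := (3^-1) ^+ k * g k u in
  if `|h (x (n k))| <= `|f (x (n k)) + h (x (n k))|
  then fun u => f u + h u else fun u => f u - h u.
pose F := fix F k := if k is j.+1 then step j (F j) else fun=> 0.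
have c0 k : 0 <= (3^-1 : R) ^+ k by rewrite exprn_ge0.
have Flin k : linear_fun (F k).
  elim: k => [|k IH] a u v /=; first by rewrite mulr0 addr0.
  have [lg _ _] := gP k.
  by rewrite /step; case: ifP => _; rewrite IH lg; ring.
have Fstep k u : `|F k.+1 u - F k u| <= (3^-1) ^+ k * `|u|.
  have [_ gk _] := gP k.
  have -> : `|F k.+1 u - F k u| = (3^-1) ^+ k * `|g k u|.
    rewrite /= /step; case: ifP => _; rewrite addrAC subrr add0r ?normrN;
    by rewrite normrM ger0_norm.
  by rewrite ler_wpM2l.
have Fbig k : (3^-1) ^+ k * `|x (n k)| <= `|F k.+1 (x (n k))|.
  have [_ _ gx] := gP k.
  have h0 : 0 <= (3^-1) ^+ k * `|x (n k)| by rewrite mulr_ge0.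
  rewrite /= /step gx; case: ifP => [|/negbT]; rewrite gx ger0_norm//.
  by rewrite -ltNge ltr_norml => /andP[? ?]; rewrite ler_normr; lra.
have Fdiff k m u : `|F (k + m)%N u - F k u| <= (3^-1) ^+ k * `|u| * (3 / 2).
  suff : `|F (k + m)%N u - F k u| <=
         (3^-1) ^+ k * `|u| * (3 / 2) - (3^-1) ^+ (k + m) * `|u| * (3 / 2).
    by move=> /le_trans; apply; rewrite gerBl !mulr_ge0.
  elim: m => [|m IH]; first by rewrite addn0 !subrr normr0.
  have := Fstep (k + m)%N u.
  have := ler_normD (F (k + m).+1 u - F (k + m)%N u) (F (k + m)%N u - F k u).
  by rewrite addrA subrK addnS exprS; lra.
have p0 : (3^-1 : R) ^+ k @[k --> \oo] --> 0.
  by apply: cvg_expr; rewrite ger0_norm// invf_lt1// ltr1n.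
have Fcvg u : exists l : R, F k u @[k --> \oo] --> l.
  apply/cauchy_seqP => eps eps0.
  have d0 : 0 < eps / (4 * (`|u| + 1)) by rewrite divr_gt0// mulr_gt0// ltr_wpDl.
  have [N /(_ _ (leqnn N))] := (cvg_seqP _ _).1 p0 _ d0.
  rewrite subr0 ger0_norm// ler_pdivlMr ?mulr_gt0 ?ltr_wpDl// => pN.
  have pNu : (3^-1) ^+ N * `|u| * (3 / 2) <= eps / 2.
    have := mulr_ge0 (c0 N) (normr_ge0 u); have := c0 N.
    by move: pN; rewrite mulrA mulrDr; lra.
  exists N => i j Ni Nj.
  have := Fdiff N (i - N)%N u; have := Fdiff N (j - N)%N u.
  rewrite !subnKC// => dj di.
  by have := ler_distD (F N u) (F i u) (F j u); rewrite (distrC (F N u)); lra.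
have [G GP] := choice Fcvg.
have Glin : linear_fun G.
  move=> a u v; have := GP (a *: u + v).
  rewrite (_ : (fun k => F k _) = (fun k => a * F k u + F k v)); last first.
    by apply/funext => k; exact: Flin.
  move=> h; apply: (cvg_unique _ h) => //.
  by apply: cvgD => //; apply: cvgMr.
have Gdiff k u : `|G u - F k u| <= (3^-1) ^+ k * `|u| * (3 / 2).
  have h : `|F j u - F k u| @[j --> \oo] --> `|G u - F k u|.
    by apply: cvg_norm; apply: cvgB => //; exact: cvg_cst.
  rewrite -(cvg_lim _ h)//; apply: limr_le; first by apply/cvg_ex; exists `|G u - F k u|.
  by exists k => // j /= kj; rewrite -(subnKC kj); exact: Fdiff.
have Gb : bounded_functional G.
  split=> //; exists 2 => // u.
  by have := Gdiff 0%N u; rewrite /= subr0 expr0 mul1r; have := normr_ge0 u; lra.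
have [l Gl] := xc _ Gb.
have [B _ BP] := cvg_seq_bounded_norm Gl.
have [k kB] : exists k : nat, 2 * B < k%:R by exact: exists_nat_gt.
have kx := nP k.
have := Gdiff k.+1 (x (n k)); have := BP (n k); have := Fbig k.
have := lerB_dist (F k.+1 (x (n k))) (G (x (n k))).
by rewrite (distrC (F k.+1 _)) exprS; lra.
Qed.
(** * Schauder bases and basic sequences *)

Section Expansions.
Variables (R : realType) (X : completeNormedModType R).
Implicit Types (w : nat -> X) (a b : nat -> R) (v : X).

Lemma series_ordE w a :
  series (fun i => a i *: w i) = (fun m => \sum_(i < m) a i *: w i).
Proof. by apply/funext => m; rewrite /series /= big_mkord. Qed.

Lemma sum_coefB w a b m :
  \sum_(i < m) (a i - b i) *: w i =
  \sum_(i < m) a i *: w i - \sum_(i < m) b i *: w i.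
Proof. by rewrite -sumrB; apply: eq_bigr => i _; rewrite scalerBl. Qed.

Lemma cvg_sum_ord m (F : nat -> 'I_m -> X) (l : 'I_m -> X) :
  (forall i, F K i @[K --> \oo] --> l i) ->
  (\sum_(i < m) F K i) @[K --> \oo] --> \sum_(i < m) l i.
Proof.
elim: m F l => [|m IH] F l Fl.
  rewrite big_ord0 (_ : (fun K => _) = (fun=> 0)); first exact: cvg_cst.
  by apply/funext => K; rewrite big_ord0.
rewrite big_ord_recr (_ : (fun K => _) = (fun K =>
  \sum_(i < m) F K (widen_ord (leqnSn m) i) + F K ord_max)).
  by apply: cvgD => //; apply: IH.
by apply/funext => K; rewrite big_ord_recr.
Qed.

Lemma norm_coef_le w a i (M : R) :
  (forall m, `|\sum_(j < m) a j *: w j| <= M) -> `|a i| * `|w i| <= 2 * M.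
Proof.
move=> aM; rewrite -normrZ.
have -> : a i *: w i = \sum_(j < i.+1) a j *: w j - \sum_(j < i) a j *: w j.
  by rewrite big_ord_recr /= addrAC subrr add0r.
by apply: le_trans (ler_normB _ _) _; have := aM i.+1; have := aM i; lra.
Qed.

(** Expansions pass to limits that are uniform in the partial sums: the
    coefficients converge one by one because no [w i] vanishes. *)
Lemma limit_expansion w (A : nat -> nat -> R) (vK : nat -> X) v :
  (forall i, w i != 0) ->
  (forall K, (fun m => \sum_(i < m) A K i *: w i) @ \oo --> vK K) ->
  vK @ \oo --> v ->
  (forall eta : R, 0 < eta -> exists K0, forall K L m,
     (K0 <= K)%N -> (K0 <= L)%N ->
     `|\sum_(i < m) (A K i - A L i) *: w i| <= eta) ->
  exists a, (fun m => \sum_(i < m) a i *: w i) @ \oo --> v /\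
    forall eta : R, 0 < eta -> exists K0, forall K m, (K0 <= K)%N ->
     `|\sum_(i < m) (a i - A K i) *: w i| <= eta.
Proof.
move=> w0 AvK vKv Aunif.
have acvg i : exists l : R, A K i @[K --> \oo] --> l.
  apply/cauchy_seqP => eps eps0.
  have wi0 : 0 < `|w i| by rewrite normr_gt0.
  have eta0 : 0 < eps * `|w i| / 2 by rewrite divr_gt0// mulr_gt0.
  have [K0 K0P] := Aunif _ eta0; exists K0 => K L K0K K0L.
  have := @norm_coef_le w (fun i => A K i - A L i) i _ (fun m => K0P K L m K0K K0L).
  by move=> h; rewrite -(ler_pM2r wi0); lra.
have [a aP] := choice acvg.
have aunif (eta : R) : 0 < eta -> exists K0, forall K m, (K0 <= K)%N ->
     `|\sum_(i < m) (a i - A K i) *: w i| <= eta.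
  move=> eta0; have [K0 K0P] := Aunif _ eta0; exists K0 => K m K0K.
  have h : `|\sum_(i < m) (A L i - A K i) *: w i| @[L --> \oo] -->
           `|\sum_(i < m) (a i - A K i) *: w i|.
    apply: cvg_norm; apply: cvg_sum_ord => i.
    by apply: cvgZl; apply: cvgB; [exact: aP | exact: cvg_cst].
  rewrite -(cvg_lim _ h)//; apply: limr_le.
    by apply/cvg_ex; eexists; exact: h.
  by exists K0 => // L /= K0L; exact: K0P.
exists a; split => //; apply/cvg_seqP => eps eps0.
have e30 : 0 < eps / 3 by rewrite divr_gt0.
have [K1 K1P] := (cvg_seqP _ _).1 vKv _ e30.
have [K2 K2P] := aunif _ e30.
pose K := maxn K1 K2.
have [N NP] := (cvg_seqP _ _).1 (AvK K) _ e30.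
exists N => m Nm.
have := K1P K (leq_maxl _ _); have := K2P K m (leq_maxr _ _); have := NP m Nm.
rewrite sum_coefB.
set s := \sum_(i < m) a i *: _; set t := \sum_(i < m) A K i *: _ => h1 h2 h3.
have := ler_distD t s v; have := ler_distD (vK K) t v; lra.
Qed.

(** Bounded projections make the partial sums of a convergent sequence of finite
    sums converge uniformly, so its limit has an expansion; applied to the
    difference of two expansions of one vector, they give uniqueness. *)
Lemma basic_sequence_criterion w (C : R) :
  (forall i, w i != 0) ->
  (forall a m n, (m <= n)%N ->
     `|\sum_(i < m) a i *: w i| <= C * `|\sum_(i < n) a i *: w i|) ->
  basic_sequence w.
Proof.
move=> w0 wC.
have C0 : 0 <= C.
  have := wC (fun=> 1) 1%N 1%N (leqnn _); rewrite big_ord1 scale1r => h.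
  have wp : 0 < `|w 0%N| by rewrite normr_gt0.
  by rewrite -(pmulr_lge0 _ wp); exact: le_trans h.
split=> [n|v vw].
  apply: subset_closure; exists n.+1, (fun i => (i == n)%:R).
  rewrite big_ord_recr /= eqxx scale1r big1 ?add0r// => i _.
  by rewrite ltn_eqF ?scale0r.
have app K : exists p : nat * (nat -> R),
    `|v - \sum_(i < p.1) p.2 i *: w i| <= 2^-1 ^+ K.
  have K0 : 0 < 2^-1 ^+ K :> R by rewrite exprn_gt0.
  have [_ [[n [a ->]] /= vn]] := vw _ (nbhsx_ballx v _ K0).
  by exists (n, a); move: vn; rewrite -ball_normE /= => /ltW.
have [p pP] := choice app.
pose A K i := if (i < (p K).1)%N then (p K).2 i else 0.
pose vK K := \sum_(i < (p K).1) (p K).2 i *: w i.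
have AE K m : ((p K).1 <= m)%N -> \sum_(i < m) A K i *: w i = vK K.
  move=> pm; rewrite /vK (big_ord_widen _ (fun i => (p K).2 i *: w i) pm).
  rewrite [RHS]big_mkcond; apply: eq_bigr => i _.
  by rewrite /A; case: ifP; rewrite ?scale0r.
have p0 := @cvg_geometric_half R.
have [||||a [av _]] := @limit_expansion w A vK v.
- exact: w0.
- move=> K; apply/cvg_seqP => eps eps0; exists (p K).1 => m pm.
  by rewrite AE// subrr normr0 ltW.
- apply/cvg_seqP => eps eps0; have [N NP] := (cvg_seqP _ _).1 p0 _ eps0.
  exists N => n /NP; rewrite subr0 ger0_norm ?exprn_ge0// => h.
  by rewrite distrC; exact: le_trans (pP n) h.
- move=> eta eta0.
  have d0 : 0 < eta / (2 * (C + 1)) by rewrite divr_gt0// mulr_gt0// ltr_wpDl.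
  have [N NP] := (cvg_seqP _ _).1 p0 _ d0.
  exists N => K L m NK NL.
  pose n := maxn m (maxn (p K).1 (p L).1).
  apply: le_trans (wC (fun i => A K i - A L i) m n (leq_maxl _ _)) _.
  rewrite sum_coefB !AE; try by rewrite /n; lia.
  have := NP K NK; have := NP L NL; rewrite !subr0 !ger0_norm ?exprn_ge0//.
  move=> hL hK; have := pP K; have := pP L => pL pK.
  have : `|vK K - vK L| <= eta / (C + 1).
    have := ler_distD v (vK K) (vK L); rewrite (distrC (vK K) v).
    have : eta / (C + 1) = 2 * (eta / (2 * (C + 1))) by field; lra.
    by rewrite /vK; lra.
  rewrite ler_pdivlMr ?ltr_wpDl//.
  by have := normr_ge0 (vK K - vK L); lra.
exists a; split=> /= [|b]; first by rewrite series_ordE.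
rewrite series_ordE => bv.
suff z m : \sum_(i < m) (a i - b i) *: w i = 0.
  apply/funext => i; have := @norm_coef_le w (fun i => a i - b i) i 0.
  rewrite mulr0 => h; apply/eqP; rewrite -subr_eq0 -normr_le0.
  have wp : 0 < `|w i| by rewrite normr_gt0.
  by rewrite -(ler_pM2r wp) mul0r; apply: h => m; rewrite z normr0.
apply/eqP; rewrite -normr_le0; apply/ler_addgt0Pr => eps eps0; rewrite add0r.
have d0 : 0 < eps / (C + 1) by rewrite divr_gt0// ltr_wpDl.
have abv : (fun m => \sum_(i < m) (a i - b i) *: w i) @ \oo --> (0 : X).
  apply/cvg_seqP => d /(@divr_gt0 _ _ 2) /(_ (ltr0n _ 2)) d2.
  have [N1 N1P] := (cvg_seqP _ _).1 av _ d2.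
  have [N2 N2P] := (cvg_seqP _ _).1 bv _ d2.
  exists (maxn N1 N2) => k; rewrite geq_max => /andP[/N1P h1 /N2P h2].
  rewrite subr0 sum_coefB.
  set s := \sum_(i < k) a i *: _ in h1 *; set t := \sum_(i < k) b i *: _ in h2 *.
  by have := ler_distD v s t; rewrite (distrC v t); lra.
have [N NP] := (cvg_seqP _ _).1 abv _ d0.
apply: le_trans (wC (fun i => a i - b i) m (maxn m N) (leq_maxl _ _)) _.
have := NP (maxn m N) (leq_maxr _ _); rewrite subr0 ler_pdivlMr ?ltr_wpDl//.
by have := normr_ge0 (\sum_(i < maxn m N) (a i - b i) *: w i); lra.
Qed.

Section BasisConstant.
Variables (e : nat -> X) (e_basis : schauder_basis e).

Lemma schauder_basis_neq0 i : e i != 0.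
Proof.
apply/eqP => ei0; have [a [_ au]] := e_basis.2 0 I.
have za : (fun m => \sum_(j < m) (fun=> 0 : R) j *: e j) @ \oo --> (0 : X).
  rewrite (_ : (fun m => _) = (fun=> 0)); first exact: cvg_cst.
  by apply/funext => m; rewrite big1// => j _; rewrite scale0r.
have zb : (fun m => \sum_(j < m) (fun j => (j == i)%:R : R) j *: e j) @ \oo --> (0 : X).
  rewrite (_ : (fun m => _) = (fun=> 0)); first exact: cvg_cst.
  apply/funext => m; rewrite big1// => j _.
  by case: eqVneq => [->|]; rewrite ?ei0 ?scaler0 ?scale0r.
have := au (fun=> 0); rewrite series_ordE => /(_ za) a0.
have := au (fun j => (j == i)%:R); rewrite series_ordE => /(_ zb) a1.
have : (fun=> 0 : R) i = (i == i)%:R by rewrite -[X in _ = X]/((fun j => (j == i)%:R) i) -a1 a0.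
by rewrite eqxx => /eqP; rewrite eq_sym oner_eq0.
Qed.

(** Baire's theorem yields a constant [D] such that every vector is arbitrarily
    close to vectors whose partial sums are bounded by [D] times its norm; summing successive
    approximations upgrades this to the vector itself. *)
Lemma schauder_basis_projections :
  exists (c : nat -> X -> R) (C : R),
    [/\ 1 <= C, (forall i, linear_fun (c i)),
        (forall v m, `|\sum_(i < m) c i v *: e i| <= C * `|v|),
        (forall v, (fun m => \sum_(i < m) c i v *: e i) @ \oo --> v) &
        (forall v a, (fun m => \sum_(i < m) a i *: e i) @ \oo --> v ->
           forall i, a i = c i v)].
Proof.
have [c' c'P] := choice (fun v => e_basis.2 v I).
pose c i v := c' v i.
have cv v : (fun m => \sum_(i < m) c i v *: e i) @ \oo --> v.
  by have := (c'P v).1; rewrite series_ordE.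
have cu v a : (fun m => \sum_(i < m) a i *: e i) @ \oo --> v ->
    forall i, a i = c i v.
  by move=> av i; have := (c'P v).2 a; rewrite series_ordE => /(_ av) <-.
have clin i : linear_fun (c i).
  move=> t u v; symmetry; apply: (cu (t *: u + v) (fun i => t * c i u + c i v)).
  rewrite (_ : (fun m => _) = (fun m => t *: (\sum_(i < m) c i u *: e i) +
     \sum_(i < m) c i v *: e i)).
    by apply: cvgD => //; apply: cvgZr.
  apply/funext => m; rewrite scaler_sumr -big_split; apply: eq_bigr => j _.
  by rewrite /= scalerDl scalerA.
pose P m v := \sum_(i < m) c i v *: e i.
have Plin (m : nat) t u v : P m (t *: u + v) = t *: P m u + P m v.
  rewrite /P scaler_sumr -big_split; apply: eq_bigr => i _.
  by rewrite /= clin scalerDl scalerA.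
have PB m u v : P m (u - v) = P m u - P m v.
  by have := Plin m (-1) v u; rewrite !scaleN1r addrC => ->; rewrite addrC.
have PD m u v : P m (u + v) = P m u + P m v.
  by have := Plin m 1 u v; rewrite !scale1r.
have P0 m : P m 0 = 0 by have := PB m 0 0; rewrite !subrr.
have PZ m t u : P m (t *: u) = t *: P m u.
  by have := Plin m t u 0; rewrite P0 !addr0.
pose A (N : nat) := [set v | forall m, `|P m v| <= N%:R].
have Aall v : exists N, A N v.
  have [B _ BP] := cvg_seq_bounded_norm (cv v).
  have [N NB] := exists_nat_gt B.
  by exists N => m; apply: ltW (le_lt_trans (BP m) NB).
have [N [v0 [r r0 vr]]] : exists N v0, exists2 r : R, 0 < r & ball v0 r `<=` closure (A N).
  apply: contrapT => nA.
  have dA : dense (\bigcap_i ~` closure (A i)).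
    apply: Baire => i; split; first by apply: closed_openC; exact: closed_closure.
    move=> O [v Ov] oO; apply: contrapT => nO; apply: nA.
    have /nbhs_ballP[r /= r0 vr] : nbhs v O by apply: open_nbhs_nbhs.
    exists i, v, r => // u /vr Ou; apply: contrapT => Au; apply: nO.
    by exists u.
  have [|v [_ vA]] := dA setT _ openT; first by exists 0.
  by have [N AN] := Aall v; apply: (vA N I); exact: subset_closure.
pose D := 4 * N%:R / r.
have D0 : 0 <= D by rewrite divr_ge0 ?mulr_ge0// ltW.
have half (u : X) : exists w : X, `|u - w| <= `|u| / 2 /\ forall m, `|P m w| <= D * `|u|.
  have [->|u0] := eqVneq u 0.
    by exists 0; split=> [|m]; rewrite ?P0 ?subrr normr0 ?mul0r ?mulr0.
  have up : 0 < `|u| by rewrite normr_gt0.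
  pose t := r / (2 * `|u|).
  have t0 : 0 < t by rewrite divr_gt0// mulr_gt0.
  have eta0 : 0 < t * `|u| / 4 by rewrite divr_gt0// mulr_gt0.
  have near_v (v : X) : ball v0 r v -> exists2 w, A N w & `|v - w| <= t * `|u| / 4.
    move=> /vr /(_ _ (nbhsx_ballx v _ eta0)) [w [Aw vw]]; exists w => //.
    by move: vw; rewrite -ball_normE /= => /ltW.
  (* Both [v0] and [v0 + t *: u] are limits of points of [A N], so [t *: u] is
     close to a difference of two such points. *)
  have [w1 Aw1 w1P] := near_v v0 (ballxx _ r0).
  have [|w2 Aw2 w2P] := near_v (v0 + t *: u).
    rewrite -ball_normE /= opprD addrA subrr add0r normrN normrZ gtr0_norm//.
    have -> : t * `|u| = r / 2 by rewrite /t; field; rewrite gt_eqF.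
    by lra.
  exists (t^-1 *: (w2 - w1)); split=> [|m].
    have -> : u - t^-1 *: (w2 - w1) = t^-1 *: ((v0 + t *: u - w2) - (v0 - w1)).
      have -> : v0 + t *: u - w2 - (v0 - w1) = t *: u - (w2 - w1).
        rewrite [v0 + _]addrC !opprB -[_ + v0 - w2]addrA -addrA.
        by rewrite [v0 - w2 + _]addrC [_ + (v0 - w2)]addrA subrK.
      by rewrite [RHS]scalerBr scalerK// lt0r_neq0.
    rewrite normrZ gtr0_norm ?invr_gt0// ler_pdivrMl//.
    by have := ler_normB (v0 + t *: u - w2) (v0 - w1); lra.
  rewrite PZ PB normrZ gtr0_norm ?invr_gt0// ler_pdivrMl//.
  have -> : t * (D * `|u|) = 2 * N%:R.
    by rewrite /t /D; field; rewrite !gt_eqF.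
  by have := ler_normB (P m w2) (P m w1); have := Aw1 m; have := Aw2 m; lra.
have [h hP] := choice half.
have PC v m : `|P m v| <= 2 * D * `|v|.
  pose U k := iter k (fun u => u - h u) v.
  have UP k : `|U k| <= (2^-1) ^+ k * `|v|.
    elim: k => [|k IH]; first by rewrite expr0 mul1r.
    by rewrite /U iterS -/(U k) exprS; have := (hP (U k)).1; lra.
  pose V k := v - U k.
  have PV k j n : `|P n (V (k + j)%N - V k)| <= 2 * D * (2^-1) ^+ k * `|v|.
    suff : `|P n (V (k + j)%N - V k)| <=
           2 * D * (2^-1) ^+ k * `|v| - 2 * D * (2^-1) ^+ (k + j) * `|v|.
      have q0 : 0 <= (2^-1 : R) ^+ (k + j) by rewrite exprn_ge0.
      have Dq : 0 <= 2 * D * 2^-1 ^+ (k + j) * `|v|.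
        by do 2 (apply: mulr_ge0 => //); exact: mulr_ge0.
      by move=> /le_trans; apply; rewrite gerBl.
    elim: j => [|j IH]; first by rewrite addn0 subrr P0 normr0 subrr.
    have -> : V (k + j.+1)%N - V k = h (U (k + j)%N) + (V (k + j)%N - V k).
      rewrite addnS /V /U iterS -!/(U _).
      by rewrite [RHS]addrA; congr (_ - _); rewrite opprB addrCA.
    rewrite PD; apply: le_trans (ler_normD _ _) _.
    have := (hP (U (k + j)%N)).2 n; have := ler_wpM2l D0 (UP (k + j)%N).
    by rewrite addnS exprS; lra.
  have [||||a [av aunif]] := @limit_expansion e (fun K i => c i (V K)) V v.
  - exact: schauder_basis_neq0.
  - by move=> K; exact: cv.
  - apply/cvg_seqP => eps eps0.
    have d0 : 0 < eps / (`|v| + 1) by rewrite divr_gt0// ltr_wpDl.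
    have [K0 KP] := (cvg_seqP _ _).1 (@cvg_geometric_half R) _ d0.
    exists K0 => n /KP; rewrite subr0 ger0_norm ?exprn_ge0//.
    rewrite ler_pdivlMr ?ltr_wpDl// /V addrAC subrr add0r normrN.
    have := UP n; have : 0 <= (2^-1) ^+ n :> R by rewrite exprn_ge0.
    lra.
  - move=> eta eta0.
    have Dv : 0 < 4 * (D * `|v|) + 1 by rewrite ltr_wpDl// mulr_ge0// mulr_ge0.
    have d0 : 0 < eta / (4 * (D * `|v|) + 1) by rewrite divr_gt0.
    have [K0 KP] := (cvg_seqP _ _).1 (@cvg_geometric_half R) _ d0.
    exists K0 => K L n KK KL.
    have := KP K0 (leqnn _); rewrite subr0 ger0_norm ?exprn_ge0//.
    rewrite ler_pdivlMr//.
    have := PV K0 (K - K0)%N n; have := PV K0 (L - K0)%N n; rewrite !subnKC//.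
    rewrite (PB n (V K)) (PB n (V L)) sum_coefB -!/(P n _).
    have := ler_distD (P n (V K0)) (P n (V K)) (P n (V L)).
    rewrite (distrC (P n (V K0))).
    have : 0 <= (2^-1) ^+ K0 :> R by rewrite exprn_ge0.
    lra.
  have {av} ac := cu _ _ av.
  apply/ler_addgt0Pr => eta eta0; have [K KP] := aunif _ eta0.
  have := KP K m (leqnn _); rewrite sum_coefB.
  under eq_bigr do rewrite ac.
  rewrite -!/(P m _); have := PV 0%N K m.
  have -> : V 0%N = 0 by rewrite /V subrr.
  rewrite add0n expr0 mulr1 subr0.
  by have := lerB_dist (P m v) (P m (V K)); lra.
exists c, (2 * D + 1); split=> // [|v m]; first by lra.
by apply: le_trans (PC v m) _; rewrite ler_wpM2r// lerDl.
Qed.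
End BasisConstant.
End Expansions.
(** * Uniform constants for spreading sequences *)

Definition same_pattern (I : Type) (f g : I -> nat) : Prop :=
  forall i j, i <> j ->
    (f i < f j)%N /\ (g i < g j)%N \/ (f j < f i)%N /\ (g j < g i)%N.

(** The index type is an arbitrary finite type so that iterated sums are covered
    without enumerating their indices. *)
Definition pattern_bound (R : realType) (X : normedModType R) (e : nat -> X)
    (K : R) : Prop :=
  forall (I : finType) (f g : I -> nat) (a : I -> R), same_pattern f g ->
    `|\sum_i a i *: e (f i)| <= K * `|\sum_i a i *: e (g i)|.

Definition projection_bound (R : realType) (X : normedModType R) (e : nat -> X)
    (C : R) : Prop :=
  forall (I : finType) (f : I -> nat) (a : I -> R) m,
    `|\sum_(i | (f i < m)%N) a i *: e (f i)| <= C * `|\sum_i a i *: e (f i)|.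

Definition increasing_below (n : nat) (f : nat -> nat) : Prop :=
  forall i j, (i < j)%N -> (j < n)%N -> (f i < f j)%N.

Section UniformSpreading.
Variables (R : realType) (X : normedModType R) (e : nat -> X).

(** Finite patterns lying far away on which the ratio of the norms is larger and
    larger can be concatenated into two subsequences of [e]. Both are equivalent
    to [e], hence to each other, which bounds these ratios. *)
Lemma spreading_uniform_far : spreading e ->
  exists N (K : R), 0 < K /\ forall n (f g : nat -> nat) (a : nat -> R),
    increasing_below n f -> increasing_below n g ->
    (forall i, (i < n)%N -> (N <= f i)%N /\ (N <= g i)%N) ->
    `|\sum_(i < n) a i *: e (f i)| <= K * `|\sum_(i < n) a i *: e (g i)|.
Proof.
move=> e_spr; apply: contrapT => H.
have bad (NK : nat * nat) : exists p : nat * (nat -> nat) * (nat -> nat) * (nat -> R),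
    let n := p.1.1.1 in let f := p.1.1.2 in let g := p.1.2 in let a := p.2 in
    [/\ increasing_below n f, increasing_below n g,
      (forall i, (i < n)%N -> (NK.1 <= f i)%N /\ (NK.1 <= g i)%N) &
      NK.2.+1%:R * `|\sum_(i < n) a i *: e (g i)| < `|\sum_(i < n) a i *: e (f i)|].
  apply: contrapT => nex; apply: H; exists NK.1, NK.2.+1%:R; split=> // n f g a fi gi fgN.
  rewrite leNgt; apply/negP => lt; apply: nex.
  by exists (n, f, g, a).
have [F FP] := choice bad.
(* A bound on the entries of both lists. *)
pose bnd (s : seq nat * seq nat) := (sumn s.1 + sumn s.2).+1.
pose step k (s : seq nat * seq nat) :=
  let p := F (bnd s, k) in
  (s.1 ++ map p.1.1.2 (iota 0 p.1.1.1), s.2 ++ map p.1.2 (iota 0 p.1.1.1)).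
pose L := fix L k := if k is j.+1 then step j (L j) else ([::], [::]).
pose len k := (F (bnd (L k), k)).1.1.1.
have len_gt0 k : (0 < len k)%N.
  have [_ _ _] := FP (bnd (L k), k); rewrite -/(len k).
  by case: (len k) => //; rewrite !big_ord0 normr0 mulr0 ltxx.
have sizeL k : size (L k).1 = size (L k).2.
  by elim: k => // k IH; rewrite /= !size_cat IH !size_map.
have sizeS k : size (L k.+1).1 = (size (L k).1 + len k)%N.
  by rewrite /= size_cat size_map size_iota.
have sizege k : (k <= size (L k).1)%N.
  by elim: k => // k IH; rewrite sizeS; have := len_gt0 k; lia.
have nthL (k m i : nat) : (i < size (L k).1)%N -> (k <= m)%N ->
    nth 0%N (L m).1 i = nth 0%N (L k).1 i /\ nth 0%N (L m).2 i = nth 0%N (L k).2 i.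
  move=> ik; elim: m => [|m IH]; first by rewrite leqn0 => /eqP->.
  rewrite leq_eqVlt => /predU1P[->//|km].
  have [<- <-] := IH km.
  have im : (i < size (L m).1)%N.
    apply: leq_trans ik _; rewrite ltnS in km; elim: (m) km => [|j IHj].
      by rewrite leqn0 => /eqP->.
    by rewrite leq_eqVlt => /predU1P[->//|/IHj]; rewrite sizeS; lia.
  by rewrite /= !nth_cat im -sizeL im.
have le_sumn (s : seq nat) x : x \in s -> (x <= sumn s)%N.
  by elim: s => //= y s IH; rewrite inE => /predU1P[->|/IH]; lia.
have cat_pairwise (s : seq nat) (h : nat -> nat) n : pairwise ltn s ->
    increasing_below n h -> (forall i, (i < n)%N -> (sumn s < h i)%N) ->
    pairwise ltn (s ++ map h (iota 0 n)).
  move=> ss hinc sh; rewrite pairwise_cat ss /=; apply/andP; split.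
    apply/allrelP => x y /le_sumn xs /mapP[i]; rewrite mem_iota => /andP[_ iN] ->.
    exact: leq_ltn_trans xs (sh i iN).
  apply/(pairwiseP 0%N) => i j; rewrite !inE size_map size_iota => iN jN ij.
  by rewrite !(nth_map 0%N) ?size_iota// !nth_iota// !add0n; apply: hinc.
have Lpw k : pairwise ltn (L k).1 /\ pairwise ltn (L k).2.
  elim: k => //= k [IH1 IH2]; have [fi gi fgN _] := FP (bnd (L k), k).
  split; apply: cat_pairwise => // i ik; have [] := fgN i ik; rewrite /bnd /=; lia.
pose rho i := nth 0%N (L i.+1).1 i.
pose rho' i := nth 0%N (L i.+1).2 i.
have sz i : (i < size (L i.+1).1)%N by exact: sizege.
have rhoE k i : (i < size (L k).1)%N ->
    rho i = nth 0%N (L k).1 i /\ rho' i = nth 0%N (L k).2 i.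
  move=> ik; rewrite /rho /rho'; case: (leqP k i.+1) => h.
    by have [-> ->] := nthL _ _ _ ik h.
  by have [-> ->] := nthL _ _ _ (sz i) (ltnW h).
have [rho_inc rho'_inc] : {homo rho : i j / (i < j)%N} /\ {homo rho' : i j / (i < j)%N}.
  have hsz i j : (i < j)%N -> (i < size (L j.+1).1)%N.
    by move=> ij; apply: leq_trans (sizege j.+1); lia.
  split=> i j ij; have := hsz _ _ ij; have := sz j => js isz.
    have [-> _] := rhoE _ _ isz; have [-> _] := rhoE _ _ js.
    by move/(pairwiseP 0%N): (Lpw j.+1).1; apply; rewrite ?inE.
  have [_ ->] := rhoE _ _ isz; have [_ ->] := rhoE _ _ js.
  by move/(pairwiseP 0%N): (Lpw j.+1).2; apply; rewrite ?inE -?sizeL.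
have [L1 [L1ge1 eq1]] : equivalent e (e \o rho) by apply: e_spr; exists rho; split.
have [L2 [L2ge1 eq2]] : equivalent e (e \o rho') by apply: e_spr; exists rho'; split.
have L2gt0 : 0 < L2 by apply: lt_le_trans L2ge1.
have [k kL] := exists_nat_gt (L1 * L2).
have [_ _ _] := FP (bnd (L k), k).
set o := size (L k).1; set p := F (bnd (L k), k) => /=.
set n := p.1.1.1; set f := p.1.1.2; set g := p.1.2; set a := p.2 => lt.
pose b i : R := if (i < o)%N then 0 else a (i - o)%N.
have seg i : (i < n)%N -> rho (o + i) = f i /\ rho' (o + i) = g i.
  move=> iN; have oik : (o + i < size (L k.+1).1)%N by rewrite sizeS ltn_add2l.
  have [-> ->] := rhoE _ _ oik.
  rewrite /= !nth_cat -sizeL -/o ltnNge leq_addr /= addKn.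
  by rewrite !(nth_map 0%N) ?size_iota// !nth_iota.
have bsum (h h' : nat -> nat) : (forall i, (i < n)%N -> h (o + i)%N = h' i) ->
    \sum_(i < o + n) b i *: e (h i) = \sum_(i < n) a i *: e (h' i).
  move=> hh; rewrite big_split_ord /= big1 ?add0r => [|i _].
    by apply: eq_bigr => i _; rewrite /b ltnNge leq_addr /= addKn hh.
  by rewrite /b ltn_ord scale0r.
have [_ le1] := eq1 (o + n)%N b; have [le2 _] := eq2 (o + n)%N b.
rewrite /= (bsum rho f) in le1; last by move=> i /seg[].
rewrite /= (bsum rho' g) in le2; last by move=> i /seg[].
move: lt; apply/negP; rewrite -leNgt; apply: le_trans le1 _.
rewrite ler_pdivrMl// in le2.
apply: le_trans (ler_wpM2l (le_trans ler01 L1ge1) le2) _.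
by rewrite mulrA ler_wpM2r// ltW// (lt_trans kL)// ltr_nat ltnSn.
Qed.

Lemma projection_bound_tail (C : R) : projection_bound e C ->
  forall (I : finType) (f : I -> nat) (a : I -> R) m,
    `|\sum_(i | (m <= f i)%N) a i *: e (f i)| <=
    (1 + C) * `|\sum_i a i *: e (f i)|.
Proof.
move=> eC I f a m; have := eC I f a m; rewrite [\sum_i _](bigID (fun i => f i < m)%N) /=.
under [X in _ + X]eq_bigl do rewrite -leqNgt.
set u := \sum_(i | (f i < m)%N) _; set v := \sum_(i | (m <= f i)%N) _.
by move=> h; have := ler_normB (u + v) u; rewrite addrAC subrr add0r mulrDl mul1r; lra.
Qed.

Lemma projection_bound_coef (C : R) : projection_bound e C ->
  forall (I : finType) (f : I -> nat) (a : I -> R) i, injective f ->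
    `|a i| * `|e (f i)| <= 2 * C * `|\sum_i a i *: e (f i)|.
Proof.
move=> eC I f a i finj; rewrite -normrZ.
have h1 := eC I f a (f i).+1; have h0 := eC I f a (f i).
have -> : a i *: e (f i) = \sum_(j | (f j < (f i).+1)%N) a j *: e (f j) -
                           \sum_(j | (f j < f i)%N) a j *: e (f j).
  rewrite (bigD1 i)//= addrC; apply/esym/eqP; rewrite subr_eq addrC; apply/eqP.
  congr (_ + _); apply: eq_bigl => j; rewrite ltnS [RHS]ltn_neqAle andbC.
  by rewrite (inj_eq finj).
by apply: le_trans (ler_normB _ _) _; lra.
Qed.

Lemma increasing_below_inj n f : increasing_below n f ->
  injective (fun i : 'I_n => f i).
Proof.
move=> fi i j fij; apply: val_inj => /=; case: (ltngtP i j) => // h.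
  by have := fi _ _ h (ltn_ord j); rewrite fij ltnn.
by have := fi _ _ h (ltn_ord i); rewrite fij ltnn.
Qed.

Lemma spreading_norm_bounds N (K : R) : (forall i, e i != 0) -> 0 < K ->
  (forall i j, (N <= i)%N -> (N <= j)%N -> `|e i| <= K * `|e j|) ->
  exists B S : R, [/\ 0 < B, 0 < S, forall i, `|e i| <= B & forall i, 1 <= S * `|e i|].
Proof.
move=> e0 K0 eK; have ep i : 0 < `|e i| by rewrite normr_gt0.
pose s := \sum_(k < N) `|e k|; pose t := \sum_(k < N) `|e k|^-1.
have s0 : 0 <= s by rewrite sumr_ge0.
have t0 : 0 <= t by rewrite sumr_ge0// => k _; rewrite invr_ge0.
have KN : 0 < K * `|e N| by rewrite mulr_gt0.
have KN' : 0 < K * `|e N|^-1 by rewrite mulr_gt0// invr_gt0.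
exists (s + K * `|e N|), (t + K * `|e N|^-1); split; try by lra.
  move=> i; case: (ltnP i N) => iN.
    have : `|e i| <= s by rewrite /s (bigD1 (Ordinal iN))//= lerDl sumr_ge0.
    by lra.
  by have := eK i N iN (leqnn _); lra.
move=> i; case: (ltnP i N) => iN; rewrite mulrDl.
  have ti : `|e i|^-1 <= t.
    rewrite /t (bigD1 (Ordinal iN))//= lerDl; apply: sumr_ge0 => k _.
    by rewrite invr_ge0.
  have := ler_wpM2r (ltW (ep i)) ti; rewrite mulVf ?gt_eqF//.
  by have := mulr_gt0 KN' (ep i); lra.
have := eK N i (leqnn _) iN; have := mulr_ge0 t0 (ltW (ep i)).
move=> h0 h; have : 1 <= `|e N|^-1 * (K * `|e i|) by rewrite ler_pdivlMl// mulr1.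
by rewrite mulrA (mulrC _ K); lra.
Qed.

(** The first [N] coordinates are controlled one by one by the projections, and
    the other ones lie in the range of the far estimate. *)
Lemma spreading_increasing_bound (C : R) : (forall i, e i != 0) -> 0 <= C ->
  projection_bound e C -> spreading e ->
  exists2 K : R, 1 <= K & forall n (f g : nat -> nat) (a : nat -> R),
    increasing_below n f -> increasing_below n g ->
    `|\sum_(i < n) a i *: e (f i)| <= K * `|\sum_(i < n) a i *: e (g i)|.
Proof.
move=> e0 C0 eC /spreading_uniform_far[N [K0 [K0gt0 far]]].
have [||B [S [B0 S0 eB eS]]] := @spreading_norm_bounds N K0 e0 => //.
  have inc1 k : increasing_below 1 (fun=> k) by move=> [|?] [|?].
  move=> i j Ni Nj; have := far 1%N _ _ (fun=> 1) (inc1 i) (inc1 j) (fun _ _ => conj Ni Nj).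
  by rewrite !big_ord1 !scale1r.
have ge_id n f i : increasing_below n f -> (i < n)%N -> (i <= f i)%N.
  move=> fi; elim: i => // i IH iN.
  by apply: leq_ltn_trans (IH (ltnW iN)) _; apply: fi.
pose D := 2 * C * S * B.
have D0 : 0 <= D by rewrite /D !mulr_ge0 ?(ltW S0) ?(ltW B0).
have E0 : 0 <= K0 * (1 + C) by apply: mulr_ge0; lra.
exists (N%:R * D + K0 * (1 + C) + 1) => [|n f g a fi gi].
  by have : 0 <= N%:R * D by [apply: mulr_ge0]; lra.
set v := \sum_(i < n) a i *: e (g i).
have ae i : (i < n)%N -> `|a i *: e (f i)| <= D * `|v|.
  move=> iN; rewrite normrZ.
  have := projection_bound_coef eC (fun i => a (val i)) (Ordinal iN) (increasing_below_inj gi).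
  rewrite /= -/v => h.
  have ai0 := normr_ge0 (a i).
  have h1 := ler_wpM2l ai0 (eB (f i)); apply: le_trans h1 _.
  have h2 := ler_wpM2l (mulr_ge0 ai0 (ltW B0)) (eS (g i)).
  have h3 := ler_wpM2l (mulr_ge0 (ltW B0) (ltW S0)) h.
  rewrite /D; lra.
have head m : (m <= n)%N -> (m <= N)%N ->
    `|\sum_(i < m) a i *: e (f i)| <= N%:R * D * `|v|.
  move=> mn mN; apply: le_trans (ler_norm_sum _ _ _) _.
  apply: le_trans (ler_sum _ (fun (i : 'I_m) _ => ae i (leq_trans (ltn_ord i) mn))) _.
  rewrite sumr_const card_ord -[leLHS]mulr_natl mulrA ler_wpM2r//.
  by rewrite ler_wpM2r// ler_nat.
have [nN|Nn] := leqP n N.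
  apply: le_trans (head n (leqnn _) nN) _; rewrite ler_wpM2r//; lra.
have nE : n = (N + (n - N))%N by lia.
have -> : \sum_(i < n) a i *: e (f i) = \sum_(i < N) a i *: e (f i) +
    \sum_(i < n - N) a (N + i)%N *: e (f (N + i)%N).
  by rewrite [in LHS]nE big_split_ord.
apply: le_trans (ler_normD _ _) _.
have h1 := head N (ltnW Nn) (leqnn _).
have shift_inc h : increasing_below n h -> increasing_below (n - N) (fun i => h (N + i)%N).
  by move=> hi i j ij jN; apply: hi; lia.
have h2 := far _ _ _ (fun i => a (N + i)%N) (shift_inc _ fi) (shift_inc _ gi).
have h3 : `|\sum_(i < n - N) a (N + i)%N *: e (g (N + i)%N)| <= (1 + C) * `|v|.
  have := @projection_bound_tail C eC 'I_n (fun i => g i) (fun i => a i) (g N).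
  rewrite -/v; congr (`| _ | <= _).
  rewrite [in LHS]nE big_mkcond big_split_ord /= big1 ?add0r => [|i _].
    apply: eq_bigr => i _; case: ifP => //; case: (posnP i) => [->|i0].
      by rewrite addn0 leqnn.
    have Ni : (N < N + i)%N by rewrite -{1}[N]addn0 ltn_add2l.
    by rewrite ltnW// gi// -ltn_subRL.
  by rewrite leqNgt gi.
have {}h2 : `|\sum_(i < n - N) a (N + i)%N *: e (f (N + i)%N)| <= K0 * ((1 + C) * `|v|).
  apply: le_trans (h2 _) _; last by rewrite ler_pM2l.
  move=> i iN; have iN' : (N + i < n)%N by rewrite nE ltn_add2l.
  by split; apply: leq_trans (leq_addr i N) (ge_id n _ _ _ iN').
have := normr_ge0 v; lra.
Qed.

(** Sorting the index type along [f] reduces a pattern to increasing sequences. *)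
Lemma spreading_pattern_bound (C : R) : (forall i, e i != 0) -> 0 <= C ->
  projection_bound e C -> spreading e ->
  exists2 K : R, 1 <= K & pattern_bound e K.
Proof.
move=> e0 C0 eC e_spr; have [K K1 KP] := spreading_increasing_bound e0 C0 eC e_spr.
exists K => // I f g a fg.
pose s := sort (fun i j => f i <= f j)%N (enum I).
have sI : perm_eq s (index_enum I) by rewrite perm_sort enumT.
have us : uniq s by rewrite sort_uniq enum_uniq.
have ss : sorted (fun i j => f i <= f j)%N s.
  by apply: sort_sorted => i j; exact: leq_total.
have sumE (F : I -> X) x0 : \sum_i F i = \sum_(k < size s) F (nth x0 s k).
  by rewrite -(perm_big _ sI) (big_nth x0) big_mkord.
case: (pickP (@predT I)) => [x0 _|I0]; last first.
  by rewrite !big_pred0// normr0 mulr0.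
rewrite !(sumE _ x0).
have inc k l : (k < l)%N -> (l < size s)%N ->
    (f (nth x0 s k) < f (nth x0 s l))%N /\ (g (nth x0 s k) < g (nth x0 s l))%N.
  move=> kl ls; have ks := ltn_trans kl ls.
  have fle : (f (nth x0 s k) <= f (nth x0 s l))%N.
    by apply: (sorted_leq_nth _ _ _ ss) => //; [move=> ? ? ? /leq_trans; apply|exact: ltnW].
  have ne : nth x0 s k <> nth x0 s l by move/eqP; rewrite nth_uniq// ltn_eqF.
  by have [] := fg _ _ ne; lia.
apply: (KP _ (fun k => f (nth x0 s k)) (fun k => g (nth x0 s k)) (fun k => a (nth x0 s k))).
  by move=> k l kl ls; have [] := inc k l kl ls.
by move=> k l kl ls; have [] := inc k l kl ls.
Qed.
End UniformSpreading.

Section SchauderCoordinates.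
Variables (R : realType) (X : normedModType R) (e : nat -> X).
Variables (c : nat -> X -> R) (C : R).
Hypothesis clin : forall i, linear_fun (c i).
Hypothesis cuniq : forall v (a : nat -> R),
  (fun m => \sum_(i < m) a i *: e i) @ \oo --> v -> forall i, a i = c i v.

Lemma coordinate_basis i j : c i (e j) = (i == j)%:R.
Proof.
symmetry; apply: (cuniq (v := e j) (a := fun i => (i == j)%:R)).
apply/cvg_seqP => eps eps0; exists j.+1 => m jm.
rewrite (bigD1 (Ordinal jm))//= eqxx scale1r big1 ?addr0 ?subrr ?normr0 ?ltW//.
by move=> k /negbTE; rewrite -val_eqE /= => ->; rewrite scale0r.
Qed.

Lemma coordinate_sum (I : finType) (P : pred I) (f : I -> nat) (a : I -> R) i :
  c i (\sum_(k | P k) a k *: e (f k)) = \sum_(k | P k) a k * (i == f k)%:R.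
Proof.
rewrite linear_fun_sum//; apply: eq_bigr => k _.
by rewrite linear_funZ// coordinate_basis.
Qed.

Lemma projection_sum (I : finType) (f : I -> nat) (a : I -> R) m :
  \sum_(i < m) c i (\sum_k a k *: e (f k)) *: e i =
  \sum_(k | (f k < m)%N) a k *: e (f k).
Proof.
under eq_bigr do rewrite coordinate_sum scaler_suml.
rewrite exchange_big /= [RHS]big_mkcond /=; apply: eq_bigr => k _.
case: ltnP => km; last first.
  rewrite big1// => i _; have /negbTE-> : (i : nat) != f k.
    by rewrite neq_ltn (leq_trans (ltn_ord i) km).
  by rewrite mulr0 scale0r.
rewrite (bigD1 (Ordinal km))//= eqxx mulr1 big1 ?addr0// => i /negbTE.
by rewrite -val_eqE /= => ->; rewrite mulr0 scale0r.
Qed.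

Lemma schauder_projection_bound :
  (forall v m, `|\sum_(i < m) c i v *: e i| <= C * `|v|) ->
  projection_bound e C.
Proof. by move=> cC I f a m; rewrite -projection_sum. Qed.

End SchauderCoordinates.
(** * Averages of translates *)

Lemma le_of_nat_scaled (R : realType) (x y D : R) :
  (forall M : nat, (0 < M)%N -> M%:R * x <= M%:R * y + D) -> x <= y.
Proof.
move=> h; rewrite leNgt; apply/negP => yx.
have xy : 0 < x - y by lra.
have [M MD] := exists_nat_gt (D / (x - y)).
have := h M.+1 isT; move: MD; rewrite ltr_pdivrMr// -natr1; nra.
Qed.

(** Translating a long sum changes it only near its two ends. *)
Lemma translated_sum (R : realType) (X : normedModType R) (h : nat -> X) (B : R)
    i M : (forall j, `|h j| <= B) ->
  `|\sum_(t < M) h (i + t)%N - \sum_(t < M) h t| <= 2 * i%:R * B.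
Proof.
move=> hB; elim: i => [|i IH].
  by under eq_bigr do rewrite add0n; rewrite subrr normr0 mulr0 mul0r.
have E : \sum_(t < M) h (i.+1 + t)%N =
    \sum_(t < M) h (i + t)%N + (h (i + M)%N - h i).
  have e1 : \sum_(t < M.+1) h (i + t)%N = \sum_(t < M) h (i + t)%N + h (i + M)%N.
    by rewrite big_ord_recr.
  have e2 : \sum_(t < M.+1) h (i + t)%N = h i + \sum_(t < M) h (i.+1 + t)%N.
    rewrite big_ord_recl addn0; congr (_ + _); apply: eq_bigr => t _.
    by rewrite /= /bump /= add1n addnS addSn.
  by rewrite addrA -e1 e2 addrC addKr.
rewrite E addrAC; apply: le_trans (ler_normD _ _) _.
have := ler_normB (h (i + M)%N) (h i); have := hB (i + M)%N; have := hB i.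
by rewrite -natr1; lra.
Qed.

(** Averaging the translates of a finite sum gives almost the sum of its
    coefficients times a long average. *)
Lemma coef_sum_bound (R : realType) (X : normedModType R) (h : nat -> X)
    (B K delta : R) :
  (forall j, `|h j| <= B) ->
  (forall n (a : nat -> R) t,
     `|\sum_(i < n) a i *: h (i + t)%N| <= K * `|\sum_(i < n) a i *: h i|) ->
  (forall M, (0 < M)%N -> M%:R * delta <= `|\sum_(t < M) h t|) ->
  forall n (a : nat -> R),
    `|\sum_(i < n) a i| * delta <= K * `|\sum_(i < n) a i *: h i|.
Proof.
move=> hB hK hd n a.
pose D := \sum_(i < n) `|a i| * (2 * i%:R * B).
apply: (@le_of_nat_scaled R _ _ D) => M M0.
set s := \sum_(i < n) a i; set v := \sum_(i < n) a i *: h i.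
have h1 : `|\sum_(t < M) \sum_(i < n) a i *: h (i + t)%N| <= M%:R * (K * `|v|).
  apply: le_trans (ler_norm_sum _ _ _) _.
  apply: le_trans (ler_sum _ (fun (t : 'I_M) _ => hK n a t)) _.
  by rewrite sumr_const card_ord mulr_natl.
have h2 : `|\sum_(t < M) \sum_(i < n) a i *: h (i + t)%N - s *: \sum_(t < M) h t| <= D.
  rewrite exchange_big scaler_suml -sumrB.
  apply: le_trans (ler_norm_sum _ _ _) _; apply: ler_sum => i _.
  by rewrite -scaler_sumr -scalerBr normrZ ler_wpM2l//; exact: translated_sum.
have h3 : M%:R * (`|s| * delta) <= `|s *: \sum_(t < M) h t|.
  by rewrite normrZ mulrCA ler_wpM2l//; exact: hd.
move: h1 h2 h3; set u := \sum_(t < M) \sum_(i < n) _; set w := s *: _ => h1 h2 h3.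
by have := lerB_dist w u; rewrite distrC; lra.
Qed.

Lemma sum_ord_double (V : zmodType) (F : nat -> V) n :
  \sum_(i < n.*2) F i = \sum_(l < n) (F l.*2 + F l.*2.+1).
Proof.
elim: n => [|n IH]; first by rewrite !big_ord0.
by rewrite doubleS !big_ord_recr /= IH addrA.
Qed.

Section Smearing.
Variables (R : realType) (X : normedModType R) (e : nat -> X) (K B : R).
Hypotheses (K1 : 1 <= K) (eK : pattern_bound e K) (eB : forall i, `|e i| <= B).

Lemma pattern_bound_ord n (f g : nat -> nat) (a : nat -> R) :
  increasing_below n f -> increasing_below n g ->
  `|\sum_(i < n) a i *: e (f i)| <= K * `|\sum_(i < n) a i *: e (g i)|.
Proof.
move=> fi gi; apply: (eK (fun i : 'I_n => a i)) => i j ij.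
have := ltn_ord i; have := ltn_ord j; case: (ltngtP i j) => h jn iN.
- by left; split; [exact: fi|exact: gi].
- by right; split; [exact: fi|exact: gi].
- by case: ij; exact: val_inj.
Qed.

Lemma pair_bound n (p q p' q' : nat -> nat) (a : nat -> R) :
  (forall l, (l < n)%N -> (q l < p l)%N /\ (q' l < p' l)%N) ->
  (forall l m, (l < m)%N -> (m < n)%N -> (p l < q m)%N /\ (p' l < q' m)%N) ->
  `|\sum_(l < n) a l *: (e (p l) - e (q l))| <=
  K * `|\sum_(l < n) a l *: (e (p' l) - e (q' l))|.
Proof.
move=> qp pq.
pose f (x : 'I_n * bool) := if x.2 then p x.1 else q x.1.
pose g (x : 'I_n * bool) := if x.2 then p' x.1 else q' x.1.
pose b (x : 'I_n * bool) := if x.2 then a x.1 else - a x.1.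
have sumE (u v : nat -> nat) : \sum_(l < n) a l *: (e (u l) - e (v l)) =
    \sum_x b x *: e (if x.2 then u x.1 else v x.1).
  rewrite -(pair_bigA _ (fun l y => b (l, y) *: e (if y then u l else v l))) /=.
  by apply: eq_bigr => l _; rewrite big_bool /b /= scalerBr scaleNr.
rewrite !sumE; apply: (eK b (f := f) (g := g)) => -[l x] [m y] /= ne.
rewrite /f /g /=; have ln := ltn_ord l; have mn := ltn_ord m.
have := qp _ ln; have := qp _ mn.
case: (ltngtP l m) => lm.
- have := pq _ _ lm mn; case: (x); case: (y); lia.
- have := pq _ _ lm ln; case: (x); case: (y); lia.
- move: ne; have -> : l = m by exact: val_inj.
  by case: (x); case: (y) => // ne; lia.
Qed.

Section Blocks.
Variables (n m : nat) (a : nat -> R) (kappa : nat -> nat).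
Hypothesis kappa_mono : forall i j, (i <= j)%N -> (kappa i <= kappa j)%N.
Hypothesis kappa_lt : forall i, (i < n)%N -> (kappa i < m)%N.

Let s k := \sum_(i < n | kappa i == k) a i.
Let v := \sum_(i < n) a i *: e i.
Let D := \sum_(i < n) `|a i| * (2 * i%:R * B).

Lemma spread_increasing M t (A : pred nat) : (t < M)%N ->
  increasing_below n (fun i => i + kappa i * M + (if A (kappa i) then t else 0))%N.
Proof.
move=> tM i j ij _; have := kappa_mono (ltnW ij); rewrite leq_eqVlt => /predU1P[->|kij].
  by rewrite !ltn_add2r.
have : (kappa i * M + M <= kappa j * M)%N by rewrite addnC -mulSn leq_mul2r kij orbT.
by case: ifP; lia.
Qed.

Lemma smeared_block_sum M (A : pred nat) :
  `|\sum_(i < n | A (kappa i)) a i *: (\sum_(t < M) e (i + kappa i * M + t)%N) -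
    \sum_(k < m | A k) s k *: (\sum_(t < M) e (k * M + t)%N)| <= D.
Proof.
have -> : \sum_(k < m | A k) s k *: (\sum_(t < M) e (k * M + t)%N) =
    \sum_(i < n | A (kappa i)) a i *: (\sum_(t < M) e (kappa i * M + t)%N).
  rewrite (partition_big (fun i : 'I_n => Ordinal (kappa_lt (ltn_ord i)))
    (fun k : 'I_m => A k))//=.
  apply: eq_bigr => k Ak; rewrite /s scaler_suml.
  apply: eq_big => [i|i /eqP->//]; rewrite -val_eqE /=.
  by case: eqVneq => [->|]; rewrite ?Ak ?andbF.
rewrite -sumrB; apply: le_trans (ler_norm_sum _ _ _) _.
have B0 : 0 <= B by exact: le_trans (normr_ge0 _) (eB 0%N).
rewrite /D [leRHS](bigID (fun i : 'I_n => A (kappa i))) /=.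
apply: (@le_trans _ _ (\sum_(i < n | A (kappa i)) `|a i| * (2 * i%:R * B))).
  apply: ler_sum => i _; rewrite -scalerBr normrZ ler_wpM2l//.
  have := @translated_sum R X (fun t => e (kappa i * M + t)%N) B i M (fun j => eB _).
  by under [X in `|X - _|]eq_bigr do rewrite addnA [(_ + i)%N]addnC.
by rewrite lerDl; apply: sumr_ge0 => i _; rewrite mulr_ge0// mulr_ge0// mulr_ge0.
Qed.

(** The blocks in [A] are replaced by averages of translates, the other ones
    being kept fixed. *)
Lemma partial_smearing M (A : pred nat) :
  `|M%:R *: \sum_(i < n | ~~ A (kappa i)) a i *: e (i + kappa i * M)%N +
    \sum_(i < n | A (kappa i)) a i *: (\sum_(t < M) e (i + kappa i * M + t)%N)|
  <= M%:R * (K * `|v|).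
Proof.
pose sg t i := (i + kappa i * M + (if A (kappa i) then t else 0))%N.
have -> : M%:R *: \sum_(i < n | ~~ A (kappa i)) a i *: e (i + kappa i * M)%N +
    \sum_(i < n | A (kappa i)) a i *: (\sum_(t < M) e (i + kappa i * M + t)%N) =
    \sum_(t < M) \sum_(i < n) a i *: e (sg t i).
  rewrite exchange_big /= [RHS](bigID (fun i : 'I_n => A (kappa i))) /= [LHS]addrC.
  congr (_ + _).
    by apply: eq_bigr => i Ai; rewrite scaler_sumr; apply: eq_bigr => t _; rewrite /sg Ai.
  rewrite scaler_sumr; apply: eq_bigr => i /negbTE Ai.
  rewrite /sg Ai addn0 sumr_const card_ord scaler_nat.
  by rewrite -scaler_nat.
apply: le_trans (ler_norm_sum _ _ _) _.
rewrite mulr_natl -[X in _ *+ X]card_ord -sumr_const; apply: ler_sum => t _.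
by apply: (@pattern_bound_ord n (sg t) id a) => //; exact: spread_increasing.
Qed.

Lemma full_smearing M :
  `|\sum_(k < m) (\sum_(i < n | kappa i == k) a i) *:
      (\sum_(t < M) e (k * M + t)%N)| <=
  M%:R * (K * `|\sum_(i < n) a i *: e i|) + \sum_(i < n) `|a i| * (2 * i%:R * B).
Proof.
rewrite -/v -/D.
have := partial_smearing M xpredT; rewrite big_pred0_eq scaler0 add0r.
have := smeared_block_sum M xpredT.
set x := \sum_(i < n) _; set y := \sum_(k < m) _ => h1 h2.
by have := lerB_dist y x; rewrite distrC; lra.
Qed.

(** Smearing a block over a long interval only leaves the sum of its coefficients
    times a long average; the blocks that were kept are then moved back. *)
Lemma block_suppression (A : pred nat) :
  `|\sum_(i < n | ~~ A (kappa i)) a i *: e i| <=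
  K * (K * `|\sum_(i < n) a i *: e i| +
       B * \sum_(k < m | A k) `|\sum_(i < n | kappa i == k) a i|).
Proof.
rewrite -/v.
have K0 : 0 <= K := le_trans ler01 K1.
apply: (@le_of_nat_scaled R _ _ (K * D)) => M M0.
have back : `|\sum_(i < n | ~~ A (kappa i)) a i *: e i| <=
    K * `|\sum_(i < n | ~~ A (kappa i)) a i *: e (i + kappa i * M)%N|.
  have M0' : (0 < M)%N by [].
  have := @pattern_bound_ord n id (fun i => i + kappa i * M)%N
    (fun i => if A (kappa i) then 0 else a i).
  rewrite [X in _ -> _ -> `|X| <= _](_ : _ = \sum_(i < n | ~~ A (kappa i)) a i *: e i);
    last by rewrite [RHS]big_mkcond; apply: eq_bigr => i _; case: ifP; rewrite ?scale0r.
  rewrite [X in _ -> _ -> _ <= K * `|X|](_ : _ =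
    \sum_(i < n | ~~ A (kappa i)) a i *: e (i + kappa i * M)%N);
    last by rewrite [RHS]big_mkcond; apply: eq_bigr => i _; case: ifP; rewrite ?scale0r.
  apply=> //; move=> i j ij jn; have := @spread_increasing M 0%N xpred0 M0' i j ij jn.
  by rewrite /= !addn0.
have := partial_smearing M A; have := smeared_block_sum M A.
set x := \sum_(i < n | A (kappa i)) _; set y := \sum_(k < m | A k) _.
set z := \sum_(i < n | ~~ A (kappa i)) a i *: e (i + kappa i * M)%N in back * => h1 h2.
have hy : `|y| <= M%:R * (B * \sum_(k < m | A k) `|s k|).
  apply: le_trans (ler_norm_sum _ _ _) _; rewrite !mulr_sumr; apply: ler_sum => k _.
  rewrite normrZ [B * _]mulrC mulrCA ler_wpM2l//.
  apply: le_trans (ler_norm_sum _ _ _) _.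
  apply: le_trans (ler_sum _ (fun t _ => eB _)) _.
  by rewrite sumr_const card_ord mulr_natl.
have hx : `|x| <= D + `|y| by have := lerB_dist x y; lra.
have hz : M%:R * `|z| <= M%:R * (K * `|v|) + `|x|.
  have := lerB_dist (M%:R *: z) (- x); rewrite opprK normrN normrZ ger0_norm//; lra.
have := ler_wpM2l (ler0n R M) back; have := ler_wpM2l K0 hz; have := ler_wpM2l K0 hx.
by have := ler_wpM2l K0 hy; lra.
Qed.

End Blocks.

(** Each coordinate is a block, smeared over an interval of length [M] on which
    the average is small; [M] need not be large compared with [n]. *)
Lemma unconditional_of_small_averages :
  (forall eps : R, 0 < eps -> exists2 M, (0 < M)%N &
     `|\sum_(t < M) e t| <= M%:R * eps) ->
  forall n (a : nat -> R) (A : pred nat),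
    `|\sum_(i < n | A i) a i *: e i| <= K * K * `|\sum_(i < n) a i *: e i|.
Proof.
move=> small n a A; have K0 : 0 <= K := le_trans ler01 K1.
apply/ler_addgt0Pr => eps eps0.
pose sa := \sum_(i < n) `|a i|.
have sa0 : 0 <= sa by rewrite sumr_ge0.
have q0 : 0 < K * sa * K + 1 by rewrite ltr_wpDl// mulr_ge0// mulr_ge0.
have [M M0 MP] := small (eps / (K * sa * K + 1)) (divr_gt0 eps0 q0).
have M0' : 0 < M%:R :> R by rewrite ltr0n.
have back : `|\sum_(i < n | A i) a i *: e i| <=
    K * `|\sum_(i < n | ~~ ~~ A i) a i *: e (i + i * M)%N|.
  have := @pattern_bound_ord n id (fun i => i + i * M)%N
    (fun i => if A i then a i else 0).
  rewrite [X in _ -> _ -> `|X| <= _](_ : _ = \sum_(i < n | A i) a i *: e i);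
    last by rewrite [RHS]big_mkcond; apply: eq_bigr => i _; case: ifP; rewrite ?scale0r.
  rewrite [X in _ -> _ -> _ <= K * `|X|](_ : _ =
    \sum_(i < n | ~~ ~~ A i) a i *: e (i + i * M)%N);
    last by rewrite [RHS]big_mkcond; apply: eq_bigr => i _; rewrite negbK; case: ifP; rewrite ?scale0r.
  by apply=> // i j ij jn; have := leq_mul (ltnW ij) (leqnn M); lia.
have := @partial_smearing n a id (fun i j => id) M (predC A).
rewrite /=; set z := \sum_(i < n | ~~ ~~ _) _ in back *; set x := \sum_(i < n | ~~ A i) _ => h.
have hx : `|x| <= sa * (K * (M%:R * (eps / (K * sa * K + 1)))).
  apply: le_trans (ler_norm_sum _ _ _) _.
  rewrite /sa mulr_suml [leRHS](bigID (fun i : 'I_n => ~~ A i)) /=.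
  apply: (@le_trans _ _ (\sum_(i < n | ~~ A i) `|a i| * (K * (M%:R * (eps / (K * sa * K + 1)))))).
    apply: ler_sum => i _; rewrite normrZ ler_wpM2l//.
    have := @pattern_bound_ord M (fun t => i + i * M + t)%N id (fun=> 1).
    rewrite -!scaler_sumr !scale1r => h'; apply: le_trans (h' _ _) _ => //.
      by move=> k l kl _; rewrite ltn_add2l.
    by rewrite ler_wpM2l.
  rewrite lerDl; apply: sumr_ge0 => i _; rewrite mulr_ge0// mulr_ge0// mulr_ge0//.
  by rewrite divr_ge0// ltW.
have hz : M%:R * `|z| <= M%:R * (K * `|\sum_(i < n) a i *: e i|) + `|x|.
  by have := lerB_dist (M%:R *: z) (- x); rewrite opprK normrN normrZ ger0_norm//; lra.
have hK : K * (sa * (K * (eps / (K * sa * K + 1)))) <= eps.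
  have -> : K * (sa * (K * (eps / (K * sa * K + 1)))) =
     eps * ((K * sa * K) / (K * sa * K + 1)) by ring.
  by rewrite ler_piMr ?(ltW eps0)// ler_pdivrMr// mul1r lerDl.
rewrite -(ler_pM2l M0').
have := ler_wpM2l (ltW M0') back; have := ler_wpM2l K0 hz; have := ler_wpM2l K0 hx.
by have := ler_wpM2l (ltW M0') hK; lra.
Qed.

Let d l : X := e l.*2.+1 - e l.*2.

Lemma norm_diff_le (n : nat) (a : nat -> R) :
  `|\sum_(l < n) a l *: d l| <= 2 * K * `|\sum_(l < n) a l *: e l|.
Proof.
under eq_bigr do rewrite scalerBr; rewrite sumrB.
apply: le_trans (ler_normB _ _) _.
have := @pattern_bound_ord n (fun l => l.*2.+1) id a; have := @pattern_bound_ord n double id a.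
move=> /(_ _ _) h1 /(_ _ _) h2.
have : increasing_below n double by move=> i j ij _; rewrite ltn_double.
have : increasing_below n (fun l => l.*2.+1) by move=> i j ij _; rewrite ltnS ltn_double.
have : increasing_below n id by [].
by move=> h h' h''; have := h1 h'' h; have := h2 h' h; lra.
Qed.

(** The sum of the coefficients of a combination of the [d l] is bounded, and it
    may be restricted to the coefficients of a given sign, because the pairs
    [- e l.*2 + e l.*2.+1] have zero sum and can be erased. *)
Lemma l1_of_large_difference_averages (delta : R) : 0 < delta ->
  (forall M, (0 < M)%N -> M%:R * delta <= `|\sum_(l < M) d l|) ->
  exists2 D : R, 0 < D & forall n (a : nat -> R),
    \sum_(i < n) `|a i| <= D * `|\sum_(i < n) a i *: e i|.
Proof.
move=> d0 dbig; have K0 : 0 < K := lt_le_trans ltr01 K1.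
have dB l : `|d l| <= 2 * B.
  by apply: le_trans (ler_normB _ _) _; have := eB l.*2.+1; have := eB l.*2; lra.
have dshift n (a : nat -> R) t : `|\sum_(i < n) a i *: d (i + t)%N| <= K * `|\sum_(i < n) a i *: d i|.
  apply: (@pair_bound n (fun i => (i + t).*2.+1) (fun i => (i + t).*2)
      (fun i => i.*2.+1) double a) => [l _|l m lm _]; lia.
have sumle := @coef_sum_bound R X d (2 * B) K delta dB dshift dbig.
have half1 l : l.*2.+1./2 = l by rewrite -[LHS]/(uphalf l.*2) uphalf_double.
pose b (a : nat -> R) i := if odd i then a i./2 else - a i./2.
have bE n a (A : pred nat) : \sum_(i < n.*2 | A i./2) b a i *: e i =
    \sum_(l < n | A l) a l *: d l.
  rewrite big_mkcond (@sum_ord_double X (fun i => if A i./2 then b a i *: e i else 0)).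
  rewrite [RHS]big_mkcond; apply: eq_bigr => l _.
  rewrite /b oddS odd_double !half1 !doubleK /=.
  by case: ifP; rewrite ?addr0// scaleNr scalerBr addrC.
have supp n (a : nat -> R) (A : pred nat) :
    `|\sum_(l < n | A l) a l *: d l| <= K * K * `|\sum_(l < n) a l *: d l|.
  have := @block_suppression n.*2 n (b a) half (fun i j => @half_leq i j) _ (predC A).
  rewrite [X in _ + B * X]big1 => [|l _]; last first.
    rewrite big_mkcond (@sum_ord_double R (fun i => if i./2 == l then b a i else 0)).
    rewrite big1 ?normr0// => k _; rewrite /b oddS odd_double !half1 !doubleK /=.
    by case: ifP; rewrite ?addr0 ?addNr.
  rewrite mulr0 addr0 mulrA => h.
  have := bE n a A; have := bE n a xpredT => /= <- <-.
  under eq_bigl do rewrite -[A _]negbK; apply: h => i.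
  by rewrite -divn2 ltn_divLR// muln2.
exists (4 * K * (K * K * K) / delta) => [|n a].
  by rewrite divr_gt0// !mulr_gt0.
have part (A : pred nat) (sg : bool) :
    (forall i, A i -> 0 <= (-1) ^+ sg * a i) ->
    (\sum_(i < n | A i) `|a i|) * delta <= K * K * K * `|\sum_(l < n) a l *: d l|.
  move=> Asg; have := sumle n (fun i => if A i then a i else 0).
  rewrite (_ : `|_| = \sum_(i < n | A i) `|a i|).
    move=> /le_trans; apply.
    have -> : \sum_(i < n) (if A i then a i else 0) *: d i = \sum_(i < n | A i) a i *: d i.
      by rewrite [RHS]big_mkcond; apply: eq_bigr => i _; case: ifP; rewrite ?scale0r.
    by rewrite -!mulrA ler_pM2l// !mulrA.
  rewrite -big_mkcond /=.
  have -> : \sum_(i < n | A i) a i = (-1) ^+ sg * \sum_(i < n | A i) `|a i|.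
    rewrite mulr_sumr; apply: eq_bigr => i /Asg h.
    have -> : `|a i| = (-1) ^+ sg * a i by rewrite -(ger0_norm h) normrMsign.
    by rewrite signrMK.
  by rewrite normrMsign ger0_norm// sumr_ge0.
have := norm_diff_le n a.
have := part (fun i => 0 <= a i) false; have := part (fun i => ~~ (0 <= a i)) true.
rewrite expr0 expr1 [\sum_(i < n) `|a i|](bigID (fun i : 'I_n => 0 <= a i)) /=.
set s1 := \sum_(i < n | 0 <= a i) _; set s2 := \sum_(i < n | ~~ _) _.
move=> /(_ _)h2 /(_ _)h1 h.
have {}h1 : s1 * delta <= K * K * K * `|\sum_(l < n) a l *: d l|.
  by apply: h1 => i; rewrite mul1r.
have {}h2 : s2 * delta <= K * K * K * `|\sum_(l < n) a l *: d l|.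
  by apply: h2 => i; rewrite mulN1r oppr_ge0 -ltNge => /ltW.
rewrite mulrAC ler_pdivlMr//.
have K3 : 0 <= K * K * K by rewrite !mulr_ge0// ltW.
by have := ler_wpM2l K3 h; lra.
Qed.

(** Small averages make every block negligible once it is smeared, and large
    averages of differences give an l1 estimate; both imply unconditionality.
    Otherwise, averages bounded below control the sum of the coefficients. *)
Lemma spreading_dichotomy :
  (exists2 K' : R, 0 < K' & forall n (a : nat -> R) (A : pred nat),
     `|\sum_(i < n | A i) a i *: e i| <= K' * `|\sum_(i < n) a i *: e i|) \/
  (exists2 S : R, 0 < S & forall n (a : nat -> R),
     `|\sum_(i < n) a i| <= S * `|\sum_(i < n) a i *: e i|) /\
  (forall eps : R, 0 < eps -> exists2 M, (0 < M)%N &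
     `|\sum_(l < M) (e l.*2.+1 - e l.*2)| <= M%:R * eps).
Proof.
have K0 : 0 < K := lt_le_trans ltr01 K1.
have not_small (h : nat -> X) : ~ (forall eps : R, 0 < eps -> exists2 M, (0 < M)%N &
     `|\sum_(l < M) h l| <= M%:R * eps) ->
     exists2 delta : R, 0 < delta & forall M, (0 < M)%N -> M%:R * delta <= `|\sum_(l < M) h l|.
  move=> nh; apply: contrapT => nd; apply: nh => eps eps0.
  apply: contrapT => nM; apply: nd; exists eps => // M M0.
  by rewrite leNgt; apply/negP => /ltW lt; apply: nM; exists M.
have [sm|/not_small[delta d0 dP]] := pselect (forall eps : R, 0 < eps ->
   exists2 M, (0 < M)%N & `|\sum_(t < M) e t| <= M%:R * eps).
  left; exists (K * K) => [|n a A]; first by rewrite mulr_gt0.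
  exact: unconditional_of_small_averages.
have [sd|/(not_small (fun l => e l.*2.+1 - e l.*2))[delta' d0' dP']] := pselect (forall eps : R, 0 < eps ->
   exists2 M, (0 < M)%N & `|\sum_(l < M) (e l.*2.+1 - e l.*2)| <= M%:R * eps).
  right; split=> //; exists (K / delta) => [|n a]; first by rewrite divr_gt0.
  rewrite mulrAC ler_pdivlMr//; apply: coef_sum_bound eB _ dP n a => n a t.
  apply: (@pattern_bound_ord n (fun i => i + t)%N id a) => // i j ij _.
  by rewrite ltn_add2r.
have [D D0 DP] := l1_of_large_difference_averages d0' dP'.
have B0 : 0 <= B by exact: le_trans (normr_ge0 _) (eB 0%N).
left; exists (D * B + 1) => [|n a A]; first by rewrite ltr_wpDl// mulr_ge0// ltW.
apply: (@le_trans _ _ ((\sum_(i < n) `|a i|) * B)); last first.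
  have := ler_wpM2r B0 (DP n a); have := normr_ge0 (\sum_(i < n) a i *: e i); lra.
apply: le_trans (ler_norm_sum _ _ _) _.
rewrite mulr_suml [leRHS](bigID (fun i : 'I_n => A i)) /=.
apply: (@le_trans _ _ (\sum_(i < n | A i) `|a i| * B)).
  by apply: ler_sum => i _; rewrite normrZ ler_wpM2l.
by rewrite lerDl; apply: sumr_ge0 => i _; rewrite mulr_ge0.
Qed.

End Smearing.
(** * Averages over sparse intervals *)

Lemma sum_ord_mul (V : zmodType) (F : nat -> V) n h :
  \sum_(t < n * h) F t = \sum_(l < n) \sum_(r < h) F (l * h + r)%N.
Proof.
elim: n => [|n IH]; first by rewrite !big_ord0.
by rewrite mulSnr big_split_ord big_ord_recr /= IH.
Qed.

Section Averages.
Variables (R : realType) (X : normedModType R) (e : nat -> X) (K B C S : R).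
Hypotheses (K1 : 1 <= K) (eK : pattern_bound e K) (eB : forall i, `|e i| <= B).
Hypotheses (C0 : 0 <= C) (eC : projection_bound e C).
Hypotheses (S0 : 0 <= S) (eS : forall n (a : nat -> R),
  `|\sum_(i < n) a i| <= S * `|\sum_(i < n) a i *: e i|).
Hypothesis small_differences : forall eps : R, 0 < eps -> exists2 M, (0 < M)%N &
  `|\sum_(l < M) (e l.*2.+1 - e l.*2)| <= M%:R * eps.

Lemma iterated_pattern_bound m (N : nat -> nat) (f g : nat -> nat -> nat)
    (b : nat -> R) :
  (forall k l l', (k < m)%N -> (l < l')%N -> (l' < N k)%N ->
     (f k l < f k l')%N /\ (g k l < g k l')%N) ->
  (forall k k' l l', (k < k')%N -> (k' < m)%N -> (l < N k)%N -> (l' < N k')%N ->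
     (f k l < f k' l')%N /\ (g k l < g k' l')%N) ->
  `|\sum_(k < m) b k *: \sum_(l < N k) e (f k l)| <=
  K * `|\sum_(k < m) b k *: \sum_(l < N k) e (g k l)|.
Proof.
move=> fg1 fg2.
pose I := {k : 'I_m & 'I_(N k)}.
have sumE (h : nat -> nat -> nat) : \sum_(k < m) b k *: \sum_(l < N k) e (h k l) =
    \sum_(p : I) b (tag p) *: e (h (tag p) (tagged p)).
  under eq_bigr do rewrite scaler_sumr.
  by rewrite (sig_big_dep xpredT (fun _ => xpredT) (fun (k : 'I_m) (l : 'I_(N k)) => b k *: e (h k l))).
rewrite !sumE.
apply: (eK (fun p : I => b (tag p)) (f := fun p : I => f (tag p) (tagged p))
  (g := fun p : I => g (tag p) (tagged p))) => -[k l] [k' l'] /= ne.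
have [kk'|kk'|kk'] := ltngtP k k'.
- by left; apply: fg2.
- by right; apply: fg2.
- have ek : k = k' by exact: val_inj.
  case: _ / ek l' ne {kk'} => l' ne.
  have [ll'|ll'|ll'] := ltngtP l l'.
  + by left; apply: fg1.
  + by right; apply: fg1.
  + by case: ne; congr existT; exact: val_inj.
Qed.

Lemma block_sum_bound n (a : nat -> R) (kappa : nat -> nat) k :
  (forall i j, (i <= j)%N -> (kappa i <= kappa j)%N) ->
  `|\sum_(i < n | kappa i == k) a i| <= 2 * S * C * `|\sum_(i < n) a i *: e i|.
Proof.
move=> kmono.
have init k' : `|\sum_(i < n | (kappa i < k')%N) a i| <= S * (C * `|\sum_(i < n) a i *: e i|).
  have [p pP] : exists p, forall i, (i < n)%N -> (i < p)%N = (kappa i < k')%N.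
    have [ex|nex] := pselect (exists i, (k' <= kappa i)%N).
      case: (ex_minnP ex) => p kp pmin; exists p => i _.
      case: (ltnP (kappa i) k') => ik.
        by rewrite ltnNge; apply/negP => /kmono; rewrite leqNgt (leq_trans ik kp).
      by apply/negbTE; rewrite -leqNgt pmin.
    exists n => i iN; rewrite iN; symmetry; rewrite ltnNge; apply/negP => h.
    by apply: nex; exists i.
  have := eS n (fun i => if (kappa i < k')%N then a i else 0).
  rewrite -big_mkcond /= => h; apply: le_trans h _; rewrite ler_wpM2l//.
  have := eC (fun i : 'I_n => val i) (fun i : 'I_n => a i) p.
  congr (`| _ | <= _); rewrite big_mkcond; apply: eq_bigr => i _.
  by rewrite /= pP//; case: ifP; rewrite ?scale0r.
have -> : \sum_(i < n | kappa i == k) a i =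
    \sum_(i < n | (kappa i < k.+1)%N) a i - \sum_(i < n | (kappa i < k)%N) a i.
  rewrite [X in _ = X - _](_ : _ = \sum_(i < n | kappa i == k) a i +
    \sum_(i < n | (kappa i < k)%N) a i) ?addrK//.
  rewrite (bigID (fun i : 'I_n => kappa i == k)) /=.
  congr (_ + _); apply: eq_bigl => i; rewrite ltnS.
    by case: eqVneq => [->|]; rewrite ?andbF// leqnn.
  by rewrite [RHS]ltn_neqAle andbC.
apply: le_trans (ler_normB _ _) _; have := init k; have := init k.+1; lra.
Qed.

Section SparseAverages.
Variables (pos N : nat -> nat).
Hypothesis N_gt0 : forall j, (0 < N j)%N.
Hypothesis N_small : forall j,
  `|\sum_(l < N j) (e l.*2.+1 - e l.*2)| <= (N j)%:R * (2^-1) ^+ j.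
Hypothesis pos_gap : forall j, (pos j + N j <= pos j.+1)%N.

Definition sparse_average j : X := (N j)%:R^-1 *: \sum_(l < N j) e (pos j + l)%N.

Lemma pos_lt i j : (i < j)%N -> (pos i + N i <= pos j)%N.
Proof.
elim: j => // j IH; rewrite ltnS leq_eqVlt => /predU1P[->|ij]; first exact: pos_gap.
by have := IH ij; have := pos_gap j; lia.
Qed.

(** A short average may be compared with a longer one interlaced with it: their
    difference is an average of sums of differences of close basis vectors. *)
Lemma interlaced_average j h q : (0 < h)%N ->
  `|h%:R *: \sum_(l < N j) e (q + l * h).*2 -
    \sum_(l < N j) \sum_(r < h) e (q + l * h + r).*2.+1| <=
  h%:R * (K * ((N j)%:R * (2^-1) ^+ j)).
Proof.
move=> h0; have K0 : 0 <= K := le_trans ler01 K1.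
rewrite exchange_big /= scaler_nat -[X in _ *+ X]card_ord -sumr_const -sumrB.
apply: le_trans (ler_norm_sum _ _ _) _.
rewrite [leRHS]mulr_natl -[X in _ *+ X]card_ord -sumr_const; apply: ler_sum => r _.
rewrite -sumrB -normrN -sumrN.
have := @pair_bound R X e K K1 eK (N j) (fun l => (q + l * h + r).*2.+1)
  (fun l => (q + l * h).*2) (fun l => l.*2.+1) double (fun=> 1).
rewrite -!scaler_sumr !scale1r => hp.
under eq_bigr do rewrite opprB.
apply: le_trans (hp _ _) _; last by rewrite ler_wpM2l//; exact: N_small.
  by move=> l _; rewrite !ltnS leqnn; split=> //; lia.
move=> l l' ll' _; have : (l * h + h <= l' * h)%N by rewrite addnC -mulSn leq_mul2r ll' orbT.
by have := ltn_ord r; lia.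
Qed.

Lemma sum_half_powers m (j : nat -> nat) : (forall k l, (k < l)%N -> (j k < j l)%N) ->
  \sum_(k < m) (2^-1 : R) ^+ (j k) <= 2.
Proof.
move=> jinc; have jge k : (k <= j k)%N.
  by elim: k => // k IH; apply: leq_ltn_trans IH _; exact: jinc.
apply: (@le_trans _ _ (\sum_(k < m) (2^-1 : R) ^+ k)).
  by apply: ler_sum => k _; apply: ler_wiXn2l => //; rewrite invf_le1// ler1n.
suff : \sum_(k < m) (2^-1 : R) ^+ k <= 2 - 2 * (2^-1) ^+ m.
  by move=> /le_trans; apply; rewrite gerBl mulr_ge0// exprn_ge0.
elim: m => [|m IH]; first by rewrite big_ord0 expr0; lra.
by rewrite big_ord_recr exprS /=; lra.
Qed.

(** Smearing replaces the blocks by averages over intervals of a common length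
    [M], a multiple of all the lengths [N (j k)]. Spreading the terms of the
    average of length [N (j k)] evenly inside the longer one costs
    [2^-1 ^+ j k] times the sum of the block, and these errors are summable. *)
Lemma sparse_average_bound n m (a : nat -> R) (kappa j : nat -> nat) :
  (forall i i', (i <= i')%N -> (kappa i <= kappa i')%N) ->
  (forall i, (i < n)%N -> (kappa i < m)%N) ->
  (forall k l, (k < l)%N -> (j k < j l)%N) ->
  `|\sum_(k < m) (\sum_(i < n | kappa i == k) a i) *: sparse_average (j k)| <=
  (K * K * K + 4 * K * K * S * C) * `|\sum_(i < n) a i *: e i|.
Proof.
move=> kmono klt jinc; have K0 : 0 <= K := le_trans ler01 K1.
have B0 : 0 <= B by exact: le_trans (normr_ge0 _) (eB 0%N).
pose s k := \sum_(i < n | kappa i == k) a i.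
pose v := \sum_(i < n) a i *: e i.
pose D := \sum_(i < n) `|a i| * (2 * i%:R * B).
pose Q := (\prod_(k < m) N (j k))%N.
have Q0 : (0 < Q)%N by rewrite prodn_gt0.
rewrite -/v -(ler_pM2l (_ : 0 < Q%:R)) ?ltr0n//.
apply: (@le_of_nat_scaled R _ _ (K * (K * D))) => T T0.
pose M := (T * Q)%N.
pose h k := (M %/ N (j k))%N.
have hN k : (k < m)%N -> (N (j k) * h k)%N = M.
  move=> km; rewrite mulnC divnK//; apply: dvdn_mull.
  by rewrite /Q (bigD1 (Ordinal km))//= dvdn_mulr.
have M0 : (0 < M)%N by rewrite muln_gt0 T0.
have h0 k : (k < m)%N -> (0 < h k)%N.
  by move=> km; have := hN k km; case: (h k) => //; rewrite muln0 => M0'; move: M0; rewrite -M0'.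
pose A k := \sum_(t < M) e (k * M + t).*2.+1.
pose U k := \sum_(l < N (j k)) e (k * M + l * h k).*2.
have AE k : (k < m)%N -> A k = \sum_(l < N (j k)) \sum_(r < h k) e (k * M + l * h k + r).*2.+1.
  move=> km; have := sum_ord_mul (fun t => e (k * M + t).*2.+1) (N (j k)) (h k).
  by rewrite hN// => E; rewrite /A E; under eq_bigr do under eq_bigr do rewrite addnA.
have hA : `|\sum_(k < m) s k *: A k| <= K * (M%:R * (K * `|v|) + D).
  have := @iterated_pattern_bound m (fun=> M) (fun k t => (k * M + t).*2.+1)
    (fun k t => k * M + t)%N s.
  move=> hp; apply: le_trans (hp _ _) _.
  - by move=> k l l' _ ll' _; rewrite ltnS ltn_double ltn_add2l.
  - move=> k k' l l' kk' _ lM _.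
    have : (k * M + M <= k' * M)%N by rewrite addnC -mulSn leq_mul2r kk' orbT.
    by lia.
  - by rewrite ler_wpM2l//; exact: full_smearing.
have hU : `|\sum_(k < m) s k *: ((h k)%:R *: U k)| <=
    K * (M%:R * (K * `|v|) + D) + 4 * K * S * C * M%:R * `|v|.
  have diff : `|\sum_(k < m) s k *: ((h k)%:R *: U k) - \sum_(k < m) s k *: A k| <=
      4 * K * S * C * M%:R * `|v|.
    rewrite -sumrB; apply: le_trans (ler_norm_sum _ _ _) _.
    apply: (@le_trans _ _ (\sum_(k < m) 2 * S * C * `|v| * (K * M%:R * (2^-1) ^+ (j k)))).
      apply: ler_sum => k _; rewrite -scalerBr normrZ.
      apply: ler_pM => //; first exact: block_sum_bound.
      rewrite AE//; apply: le_trans (interlaced_average _ _ (h0 k (ltn_ord k))) _.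
      by rewrite -(hN k)// natrM; lra.
    rewrite -!mulr_sumr; have := @sum_half_powers m j jinc.
    set p := \sum_(k < m) _ => p2.
    have P0 : 0 <= 2 * S * C * `|v| * K * M%:R.
      by rewrite mulr_ge0// mulr_ge0// mulr_ge0// mulr_ge0// mulr_ge0.
    by have := ler_wpM2l P0 p2; lra.
  by move: hA diff; set x := \sum_(k < m) _; set y := \sum_(k < m) _ => hA diff;
    have := lerB_dist y x; lra.
have E : (T%:R * Q%:R) *: (\sum_(k < m) s k *: sparse_average (j k)) =
    \sum_(k < m) (s k * (h k)%:R) *: \sum_(l < N (j k)) e (pos (j k) + l)%N.
  rewrite scaler_sumr; apply: eq_bigr => k _.
  rewrite /sparse_average !scalerA -natrM -/M -(hN k)// natrM; congr (_ *: _).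
  by field; rewrite pnatr_eq0 -lt0n.
have hV : `|\sum_(k < m) (s k * (h k)%:R) *: \sum_(l < N (j k)) e (pos (j k) + l)%N| <=
    K * `|\sum_(k < m) s k *: ((h k)%:R *: U k)|.
  under [X in _ <= K * `|X|]eq_bigr do rewrite scalerA.
  apply: (@iterated_pattern_bound m (N \o j) (fun k l => pos (j k) + l)%N
    (fun k l => (k * M + l * h k).*2) (fun k => s k * (h k)%:R)) => /=.
  - move=> k l l' km ll' _; rewrite ltn_add2l ltn_double ltn_add2l ltn_mul2r.
    by rewrite h0.
  - move=> k k' l l' kk' k'm lN l'N.
    have := pos_lt (jinc _ _ kk').
    have : (k * M + M <= k' * M)%N by rewrite addnC -mulSn leq_mul2r kk' orbT.
    have : (l * h k < N (j k) * h k)%N by rewrite ltn_mul2r h0// (ltn_trans kk').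
    by rewrite hN ?(ltn_trans kk')//; lia.
have : T%:R * Q%:R * `|\sum_(k < m) s k *: sparse_average (j k)| <=
    K * `|\sum_(k < m) s k *: ((h k)%:R *: U k)|.
  by rewrite -[T%:R * Q%:R]ger0_norm ?mulr_ge0// -normrZ E.
have := ler_wpM2l K0 hU; rewrite /M natrM; lra.
Qed.

End SparseAverages.

(** If [f] oscillated along [e], it would oscillate by [eps] along successive
    pairs, hence be at least [eps] on averages of differences, which are small. *)
Lemma spreading_weak_cauchy (f : X -> R) : bounded_functional f ->
  exists l : R, f (e i) @[i --> \oo] --> l.
Proof.
move=> [lf [D D0 fD]]; have K0 : 0 < K := lt_le_trans ltr01 K1.
apply/cauchy_seqP => eps eps0; apply: contrapT => nc.
have [sg Hsg] : exists sg : bool, forall n, exists p : nat * nat,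
    [/\ (n <= p.1)%N, (p.1 < p.2)%N & eps < (-1) ^+ sg * (f (e p.2) - f (e p.1))].
  apply: contrapT => nsg; apply: nc.
  have H (sg : bool) : exists n, forall i j, (n <= i)%N -> (i < j)%N ->
      (-1) ^+ sg * (f (e j) - f (e i)) <= eps.
    apply: contrapT => nn; apply: nsg; exists sg => n; apply: contrapT => np.
    apply: nn; exists n => i j ni ij; rewrite leNgt; apply/negP => lt; apply: np.
    by exists (i, j).
  have [n0 h0] := H false; have [n1 h1] := H true; exists (maxn n0 n1).
  have main i j : (maxn n0 n1 <= i)%N -> (i < j)%N -> `|f (e j) - f (e i)| <= eps.
    rewrite geq_max => /andP[i0 i1] ij; have := h0 _ _ i0 ij; have := h1 _ _ i1 ij.
    by rewrite expr0 expr1 mul1r mulN1r ler_norml => *; apply/andP; split; lra.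
  move=> i j iN jN; case: (ltngtP i j) => ij; last by rewrite ij subrr normr0 ltW.
    by rewrite distrC; exact: main.
  exact: main.
have [pk pkP] := choice Hsg.
pose b := fix b l := if l is l'.+1 then (pk (b l')).2.+1 else 0%N.
pose p l := (pk (b l)).2; pose q l := (pk (b l)).1.
have qp l : (q l < p l)%N by have [] := pkP (b l).
have pq l m : (l < m)%N -> (p l < q m)%N.
  elim: m => // m IH lm; have [h _ _] := pkP (b m.+1).
  apply: leq_trans h; rewrite /= ltnS; move: lm; rewrite ltnS leq_eqVlt.
  by case/predU1P => [->//|/IH h]; apply: ltnW (ltn_trans h (qp m)).
have d0 : 0 < eps / (D * K) by rewrite divr_gt0// mulr_gt0.
have [M M0 MP] := small_differences d0.
have h1 : M%:R * eps < (-1) ^+ sg * f (\sum_(l < M) (e (p l) - e (q l))).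
  rewrite linear_fun_sum// mulr_sumr mulr_natl -[X in _ *+ X]card_ord -sumr_const.
  apply: ltr_sum; first by apply/hasP; exists (Ordinal M0); rewrite ?mem_index_enum.
  by move=> l _; rewrite linear_funB//; have [] := pkP (b l).
have h2 : `|\sum_(l < M) (e (p l) - e (q l))| <= K * (M%:R * (eps / (D * K))).
  have := @pair_bound R X e K K1 eK M p q (fun l => l.*2.+1) double (fun=> 1).
  rewrite -!scaler_sumr !scale1r => hp; apply: le_trans (hp _ _) _.
  - by move=> l _.
  - by move=> l l' ll' _; split; [exact: pq|rewrite -doubleS leq_double].
  - by rewrite ler_wpM2l// ltW.
have h3 : (-1) ^+ sg * f (\sum_(l < M) (e (p l) - e (q l))) <=
    D * `|\sum_(l < M) (e (p l) - e (q l))|.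
  by apply: le_trans (fD _); apply: le_trans (ler_norm _) _; rewrite normrMsign.
have h4 := ler_wpM2l (ltW D0) h2.
have h5 : D * (K * (M%:R * (eps / (D * K)))) = M%:R * eps.
  by field; rewrite !gt_eqF.
lra.
Qed.

Lemma sparse_average_weak_limit (pos N : nat -> nat) (f : X -> R) :
  (forall j, (0 < N j)%N) -> (forall j, (j <= pos j)%N) -> bounded_functional f ->
  forall eps : R, 0 < eps -> exists n, forall j, (n <= j)%N ->
    `|f (sparse_average pos N j) - f (e (pos j))| <= eps.
Proof.
move=> N0 posge bf eps eps0; have [l fl] := spreading_weak_cauchy bf.
have [n nP] := (cauchy_seqP _).1 (ex_intro _ l fl) _ eps0; exists n => j nj.
have [lf _] := bf; have Np : 0 < (N j)%:R :> R by rewrite ltr0n.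
have -> : f (sparse_average pos N j) - f (e (pos j)) =
    (N j)%:R^-1 * \sum_(i < N j) (f (e (pos j + i)%N) - f (e (pos j))).
  rewrite linear_funZ// linear_fun_sum// sumrB sumr_const card_ord.
  rewrite -[f (e (pos j)) *+ N j]mulr_natl [RHS]mulrBr; congr (_ - _).
  by rewrite mulrA mulVf ?mul1r// gt_eqF.
rewrite normrM gtr0_norm ?invr_gt0// ler_pdivrMl//.
apply: le_trans (ler_norm_sum _ _ _) _.
rewrite mulr_natl -[X in _ *+ X]card_ord -sumr_const; apply: ler_sum => i _.
have pj := leq_trans nj (posge j).
by apply: nP => //; exact: leq_trans pj (leq_addr _ _).
Qed.

End Averages.
(** * Norms of combinations *)

Lemma abel_bound (R : realType) (c phi : nat -> R) (D : R) n :
  (forall k, (k <= n)%N -> `|\sum_(k <= l < n) c l| <= D) ->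
  `|\sum_(k < n) c k * phi k| <=
  D * (`|phi 0%N| + \sum_(k < n) `|phi k.+1 - phi k|).
Proof.
move=> cD.
have E : \sum_(k < n) c k * phi k = (\sum_(0 <= l < n) c l) * phi 0%N +
    \sum_(k < n) (\sum_(k.+1 <= l < n) c l) * (phi k.+1 - phi k).
  elim: n c phi {cD} => [|n IH] c phi.
    by rewrite !big_ord0 big_geq// mul0r addr0.
  have tS k : \sum_(k.+1 <= l < n.+1) c l = \sum_(k <= l < n) c l.+1.
    by rewrite big_add1.
  rewrite big_ord_recl [in RHS]big_ord_recl /= (IH (fun k => c k.+1) (fun k => phi k.+1)).
  rewrite big_nat_recl// tS.
  rewrite [X in _ = _ + (_ + X)](eq_bigr (fun i : 'I_n => (\sum_(i.+1 <= l < n) c l.+1) *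
    (phi i.+2 - phi i.+1))) => [|i _]; last by rewrite /bump /= add1n tS.
  by ring.
rewrite E mulrDr; apply: le_trans (ler_normD _ _) _; apply: lerD.
  by rewrite normrM ler_wpM2r// cD.
apply: le_trans (ler_norm_sum _ _ _) _; rewrite mulr_sumr; apply: ler_sum => k _.
by rewrite normrM ler_wpM2r// cD.
Qed.

Lemma seq_argmax (R : realType) (T : eqType) (r : seq T) (g : T -> R) x : x \in r ->
  exists2 y, y \in r & forall z, z \in r -> g z <= g y.
Proof.
elim: r x => // a r IH x _; case: r IH => [_|b r IH].
  by exists a; rewrite ?mem_head// => z; rewrite inE => /eqP->.
have [y yr ymax] := IH b (mem_head _ _).
case: (leP (g a) (g y)) => ay.
  exists y; first by rewrite inE yr orbT.
  by move=> z; rewrite inE => /predU1P[->|/ymax].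
exists a; first exact: mem_head.
by move=> z; rewrite inE => /predU1P[->|/ymax /le_trans]//; apply; exact: ltW.
Qed.

(** A functional norming the combination is maximal at one term of each of the
    convex combinations. *)
Lemma convex_choice_bound (R : realType) (X : normedModType R)
    (F : nat -> {fset nat}) (t : nat -> nat -> R) (h : nat -> nat -> X) n (L : R) :
  (forall k, F k != fset0) -> (forall k i, i \in F k -> 0 <= t k i) ->
  (forall k, \sum_(i <- F k) t k i = 1) ->
  (forall j, (forall k, j k \in F k) -> `|\sum_(k < n) h k (j k)| <= L) ->
  `|\sum_(k < n) \sum_(i <- F k) t k i *: h k i| <= L.
Proof.
move=> F0 t0 t1 hL; set x := \sum_(k < n) _.
have [f [lf f1 fx]] := norming_functional x.
have max k : exists i, i \in F k /\ \sum_(l <- F k) t k l * f (h k l) <= f (h k i).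
  have /fset0Pn[i0 i0F] := F0 k.
  have [i iF imax] := seq_argmax (fun l => f (h k l)) i0F.
  exists i; split=> //; rewrite -[f (h k i)]mul1r -(t1 k) mulr_suml.
  by rewrite big_seq [leRHS]big_seq; apply: ler_sum => l lF; rewrite ler_wpM2l ?t0// imax.
have [j jP] := choice max.
rewrite -fx; apply: le_trans (hL j (fun k => (jP k).1)).
apply: le_trans (f1 _); apply: le_trans (ler_norm _).
rewrite !linear_fun_sum//; apply: ler_sum => k _; apply: le_trans (jP k).2.
by rewrite linear_fun_sum//; apply: ler_sum => l _; rewrite linear_funZ.
Qed.
(** * Blocks of coordinates *)

Section BlockIndex.
Variables (p : nat -> nat) (p_inc : forall k l, (k < l)%N -> (p k < p l)%N).

Lemma increasing_leq k l : (k <= l)%N -> (p k <= p l)%N.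
Proof. by rewrite leq_eqVlt => /predU1P[->|/p_inc/ltnW]. Qed.

Lemma increasing_ge_id k : (k <= p k)%N.
Proof. by elim: k => // k IH; apply: leq_ltn_trans IH _; exact: p_inc. Qed.

Lemma block_index_ex i : exists k, (i < p k.+1)%N.
Proof. by exists i; exact: increasing_ge_id. Qed.

(** The index of the block [p k <= i < p k.+1] containing [i], and [0] if [i] lies
    before the first block. *)
Definition block_index i : nat := ex_minn (block_index_ex i).

Lemma block_index_mono i j : (i <= j)%N -> (block_index i <= block_index j)%N.
Proof.
rewrite /block_index => ij; case: ex_minnP => k _ kmin; case: ex_minnP => l jl _.
by apply: kmin; exact: leq_ltn_trans ij jl.
Qed.

Lemma block_indexE i k : (p k <= i < p k.+1)%N -> block_index i = k.
Proof.
move=> /andP[ki ik]; rewrite /block_index; case: ex_minnP => l il lmin.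
apply/eqP; rewrite eqn_leq lmin//= leqNgt; apply/negP => lk.
by move: il; rewrite ltnNge (leq_trans (increasing_leq lk) ki).
Qed.

Lemma block_index_lt i m : (0 < m)%N -> (i < p m)%N -> (block_index i < m)%N.
Proof.
case: m => // m _ im; rewrite /block_index; case: ex_minnP => l _ lmin.
by rewrite ltnS; exact: lmin.
Qed.

Lemma sum_blocks (V : zmodType) (F : nat -> V) (Q : pred nat) m :
  \sum_(i < p m | Q (block_index i)) (if (i < p 0)%N then 0 else F i) =
  \sum_(k < m | Q k) \sum_(p k <= i < p k.+1) F i.
Proof.
rewrite -(big_mkord (fun i => Q (block_index i)) (fun i => if (i < p 0)%N then 0 else F i)).
elim: m => [|m IH].
  rewrite [RHS]big_ord0 big_nat_cond big1// => i /andP[/andP[_ ip] _].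
  by rewrite ip.
rewrite (@big_cat_nat _ _ _ (p m))//=; last by apply: increasing_leq.
rewrite IH [RHS]big_mkcond big_ord_recr -big_mkcond /=; congr (_ + _).
rewrite big_nat_cond (eq_bigl (fun i => (p m <= i < p m.+1)%N && Q m)); last first.
  by move=> i; case: (boolP (p m <= i < p m.+1)%N) => //= /block_indexE->.
case: ifP => Qm.
  rewrite [RHS]big_nat_cond; apply: eq_big => [i|i]; first by rewrite !andbT.
  case/andP=> /andP[mi _] _; case: ifP => // i0.
  by move: i0; rewrite ltnNge (leq_trans (increasing_leq (leq0n m)) mi).
by rewrite big_pred0// => i; rewrite andbF.
Qed.

End BlockIndex.

(** The common setting of the two cases: [th] is [false] if [e] is unconditional,
    and then [s = 0] and [suppression] has no error term; otherwise [s] is the sum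
    of the coefficients and the averages of lengths [N j] are at hand. *)
Section Conclusion.
Variables (R : realType) (X : completeNormedModType R) (e : nat -> X).
Variables (c : nat -> X -> R) (C : R).
Hypotheses (C1 : 1 <= C) (clin : forall i, linear_fun (c i)).
Hypothesis cC : forall v m, `|\sum_(i < m) c i v *: e i| <= C * `|v|.
Hypothesis ccvg : forall v, (fun m => \sum_(i < m) c i v *: e i) @ \oo --> v.
Hypothesis cuniq : forall v (a : nat -> R),
  (fun m => \sum_(i < m) a i *: e i) @ \oo --> v -> forall i, a i = c i v.
Variables (B : R) (eB : forall i, `|e i| <= B).
Variables (th : bool) (s : X -> R) (S : R).
Hypotheses (S0 : 0 < S) (slin : linear_fun s) (sS : forall v, `|s v| <= S * `|v|).
Hypothesis se : forall i, s (e i) = th%:R.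
Variable (Ks : R).
Hypothesis Ks0 : 0 < Ks.
Hypothesis suppression : forall n m (a : nat -> R) (kappa : nat -> nat) (A : pred nat),
  (forall i j, (i <= j)%N -> (kappa i <= kappa j)%N) ->
  (forall i, (i < n)%N -> (kappa i < m)%N) ->
  `|\sum_(i < n | ~~ A (kappa i)) a i *: e i| <=
  Ks * (`|\sum_(i < n) a i *: e i| +
        \sum_(k < m | A k) `|th%:R * \sum_(i < n | kappa i == k) a i|).
Variables (N : nat -> nat) (Cu : R).
Hypotheses (N_gt0 : forall j, (0 < N j)%N) (Cu0 : 0 < Cu).
Hypothesis average_bound : th -> forall pos : nat -> nat,
  (forall j, (pos j + N j <= pos j.+1)%N) ->
  forall n m (a : nat -> R) (kappa j : nat -> nat),
  (forall i i', (i <= i')%N -> (kappa i <= kappa i')%N) ->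
  (forall i, (i < n)%N -> (kappa i < m)%N) ->
  (forall k l, (k < l)%N -> (j k < j l)%N) ->
  `|\sum_(k < m) (\sum_(i < n | kappa i == k) a i) *: sparse_average e pos N (j k)| <=
  Cu * `|\sum_(i < n) a i *: e i|.
Hypothesis average_weak_limit : th -> forall (pos : nat -> nat) (f : X -> R),
  (forall j, (j <= pos j)%N) -> bounded_functional f ->
  forall eps : R, 0 < eps -> exists n, forall j, (n <= j)%N ->
    `|f (sparse_average e pos N j) - f (e (pos j))| <= eps.
Hypothesis basis_weak_cauchy : th -> forall f : X -> R, bounded_functional f ->
  exists l : R, f (e i) @[i --> \oo] --> l.

Definition proj m (v : X) : X := \sum_(i < m) c i v *: e i.

Lemma proj_lin m (t : R) u v : proj m (t *: u + v) = t *: proj m u + proj m v.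
Proof.
rewrite /proj scaler_sumr -big_split; apply: eq_bigr => i _.
by rewrite /= clin scalerDl scalerA.
Qed.

Lemma projD m u v : proj m (u + v) = proj m u + proj m v.
Proof. by have := proj_lin m 1 u v; rewrite !scale1r. Qed.

Lemma proj0 m : proj m 0 = 0.
Proof. by rewrite /proj big1// => i _; rewrite linear_fun0// scale0r. Qed.

Lemma projZ m (t : R) u : proj m (t *: u) = t *: proj m u.
Proof. by have := proj_lin m t u 0; rewrite proj0 !addr0. Qed.

Lemma projN m u : proj m (- u) = - proj m u.
Proof. by rewrite -scaleN1r projZ scaleN1r. Qed.

Lemma projB m u v : proj m (u - v) = proj m u - proj m v.
Proof. by rewrite projD projN. Qed.

Lemma proj_sum m (I : Type) (r : seq I) (Q : pred I) (F : I -> X) :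
  proj m (\sum_(i <- r | Q i) F i) = \sum_(i <- r | Q i) proj m (F i).
Proof. by apply: (big_morph (proj m)); [exact: projD|exact: proj0]. Qed.

Lemma proj_basis m j : proj m (e j) = if (j < m)%N then e j else 0.
Proof.
rewrite /proj; under eq_bigr do rewrite (coordinate_basis cuniq).
case: ltnP => jm.
  rewrite (bigD1 (Ordinal jm))//= eqxx scale1r big1 ?addr0// => i /negbTE.
  by rewrite -val_eqE /= => ->; rewrite scale0r.
rewrite big1// => i _; have /negbTE-> : (i : nat) != j.
  by rewrite neq_ltn (leq_trans (ltn_ord i) jm).
by rewrite scale0r.
Qed.

Lemma proj_partial_sum m n (a : nat -> R) :
  proj m (\sum_(i < n) a i *: e i) = \sum_(i < minn m n) a i *: e i.
Proof.
rewrite proj_sum; under eq_bigr do rewrite projZ proj_basis.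
rewrite -(big_mkord xpredT (fun i => a i *: (if (i < m)%N then e i else 0))).
rewrite -(big_mkord xpredT (fun i => a i *: e i)).
rewrite (@big_cat_nat _ _ _ (minn m n))//= ?geq_minr// [X in _ + X]big1_seq ?addr0.
  by apply: eq_big_nat => i /andP[_]; rewrite leq_min => /andP[-> _].
move=> i /andP[_]; rewrite mem_index_iota geq_min => /andP[h1 h2].
rewrite ifF ?scaler0// ltnNge; apply/negbTE; rewrite negbK.
by case/orP: h1 => // h1; move: h2; rewrite ltnNge h1.
Qed.

Lemma proj_proj m n v : proj m (proj n v) = proj (minn m n) v.
Proof. exact: (proj_partial_sum m n (fun i => c i v)). Qed.

Lemma proj_block m n v : (m <= n)%N ->
  proj n v - proj m v = \sum_(m <= i < n) c i v *: e i.
Proof.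
move=> mn; rewrite /proj -!(big_mkord xpredT (fun i => c i v *: e i)).
by rewrite (@big_cat_nat _ _ _ m)//= addrAC subrr add0r.
Qed.

Lemma s_proj_block m n v : (m <= n)%N ->
  s (proj n v) - s (proj m v) = th%:R * \sum_(m <= i < n) c i v.
Proof.
move=> mn; rewrite -linear_funB// proj_block// linear_fun_sum// mulr_sumr.
by apply: eq_bigr => i _; rewrite linear_funZ// se mulrC.
Qed.

(** By linearity of [s], the sum of the coefficients of [v] over the [k]-th block,
    or [0] if [th] is [false]. *)
Definition block_sum (p : nat -> nat) k v : R :=
  s (proj (p k.+1) v) - s (proj (p k) v).

Section VectorBlocks.
Variables (p : nat -> nat) (p_inc : forall k l, (k < l)%N -> (p k < p l)%N).

Let cut v i : R := if (i < p 0)%N then 0 else c i v.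

Lemma sum_cut v m (Q : pred nat) :
  \sum_(i < p m | Q (block_index p_inc i)) cut v i *: e i =
  \sum_(k < m | Q k) (proj (p k.+1) v - proj (p k) v).
Proof.
under [RHS]eq_bigr do rewrite proj_block ?increasing_leq//.
rewrite -(sum_blocks p_inc (fun i => c i v *: e i)); apply: eq_bigr => i _.
by rewrite /cut; case: ifP => //; rewrite scale0r.
Qed.

Lemma sum_cut_full v m :
  \sum_(i < p m) cut v i *: e i = proj (p m) v - proj (p 0) v.
Proof.
rewrite (sum_cut v m xpredT) -(big_mkord xpredT (fun k => proj (p k.+1) v - proj (p k) v)).
by rewrite telescope_sumr.
Qed.

Lemma sum_cut_block v m k : (k < m)%N ->
  th%:R * \sum_(i < p m | block_index p_inc i == k) cut v i = block_sum p k v.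
Proof.
move=> km; rewrite /block_sum s_proj_block ?increasing_leq//; congr (_ * _).
rewrite (sum_blocks p_inc (fun i => c i v) (fun l => l == k)).
by rewrite (big_pred1 (Ordinal km))// => i; rewrite -val_eqE.
Qed.

Lemma vector_suppression v m (A : pred nat) :
  `|\sum_(k < m | ~~ A k) (proj (p k.+1) v - proj (p k) v)| <=
  Ks * (`|proj (p m) v - proj (p 0) v| + \sum_(k < m | A k) `|block_sum p k v|).
Proof.
case: m => [|m].
  by rewrite big_ord0 normr0 mulr_ge0 ?(ltW Ks0)// addr_ge0// sumr_ge0.
rewrite -(sum_cut v m.+1 (predC A)) -sum_cut_full.
have h := @suppression (p m.+1) m.+1 (cut v) (block_index p_inc) A
  (@block_index_mono p p_inc) (fun i => @block_index_lt p p_inc i m.+1 (ltn0Sn m)).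
apply: le_trans h _; rewrite ler_wpM2l ?(ltW Ks0)// lerD2l.
by apply: ler_sum => k _; rewrite sum_cut_block.
Qed.

Lemma vector_average_bound (pos j : nat -> nat) v m : th ->
  (forall i, (pos i + N i <= pos i.+1)%N) ->
  (forall k l, (k < l)%N -> (j k < j l)%N) ->
  `|\sum_(k < m) block_sum p k v *: sparse_average e pos N (j k)| <=
  Cu * `|proj (p m) v - proj (p 0) v|.
Proof.
move=> thT gap jinc; case: m => [|m].
  by rewrite big_ord0 normr0 mulr_ge0// ltW.
rewrite -sum_cut_full.
have h := @average_bound thT pos gap (p m.+1) m.+1 (cut v) (block_index p_inc) j
  (@block_index_mono p p_inc) (fun i => @block_index_lt p p_inc i m.+1 (ltn0Sn m)) jinc.
apply: le_trans h; rewrite le_eqVlt; apply/orP; left; apply/eqP; congr `| _ |.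
apply: eq_bigr => k _; rewrite -(sum_cut_block v (ltn_ord k)).
by case: th thT => // _; rewrite mul1r.
Qed.

Definition successive_blocks (y : nat -> X) : Prop :=
  forall k, proj (p k.+1) (y k) = y k /\ proj (p k) (y k) = 0.

Lemma proj_successive_block y l k : successive_blocks y ->
  proj (p l) (y k) = if (k < l)%N then y k else 0.
Proof.
move=> yP; have [y1 y0] := yP k; case: ltnP => kl.
  by rewrite -{1}y1 proj_proj (minn_idPr _) ?increasing_leq.
have := congr1 (proj (p l)) y0.
by rewrite proj_proj proj0 (minn_idPl _)// increasing_leq.
Qed.

End VectorBlocks.

Lemma successive_blocks_sumP (p : nat -> nat) y (t : nat -> R) M l :
  (forall k l, (k < l)%N -> (p k < p l)%N) -> successive_blocks p y ->
  proj (p l) (\sum_(k < M) t k *: y k) = \sum_(k < M | (k < l)%N) t k *: y k.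
Proof.
move=> p_inc yP; rewrite proj_sum [RHS]big_mkcond; apply: eq_bigr => k _.
by rewrite projZ proj_successive_block//; case: ifP; rewrite ?scaler0.
Qed.

Lemma successive_blocks_suppression (p : nat -> nat) y (t : nat -> R) m (A : pred nat) :
  (forall k l, (k < l)%N -> (p k < p l)%N) -> successive_blocks p y ->
  `|\sum_(k < m | ~~ A k) t k *: y k| <=
  Ks * (`|\sum_(k < m) t k *: y k| + \sum_(k < m | A k) `|t k * s (y k)|).
Proof.
move=> p_inc yP; pose v := \sum_(k < m) t k *: y k.
have blk k : (k < m)%N -> proj (p k.+1) v - proj (p k) v = t k *: y k.
  move=> km; rewrite !successive_blocks_sumP//.
  rewrite (bigD1 (Ordinal km))//= addrC; apply/eqP; rewrite subr_eq addrC; apply/eqP.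
  congr (_ + _); apply: eq_bigl => i; rewrite ltnS [RHS]ltn_neqAle andbC.
  by rewrite -val_eqE.
have := vector_suppression p_inc v m A.
have -> : proj (p m) v - proj (p 0) v = v.
  rewrite !successive_blocks_sumP// [X in _ - X]big_pred0 ?subr0//.
  by apply: eq_bigl => k; rewrite ltn_ord.
rewrite (eq_bigr (fun k : 'I_m => t k *: y k)) => [|k _]; last exact: blk.
move=> /le_trans; apply; rewrite ler_wpM2l ?(ltW Ks0)// lerD2l; apply: ler_sum => k _.
by rewrite /block_sum -linear_funB// blk// linear_funZ.
Qed.

(** If [y] is not weakly null, some functional is at least [eta] on all the blocks
    far enough; by suppression, the convex hull of the differences of blocks of
    even and of odd rank stays away from the origin, and a functional separating
    this hull from the origin contradicts the weak Cauchy property. *)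
Lemma weakly_null_blocks (p : nat -> nat) (y : nat -> X) :
  (forall k l, (k < l)%N -> (p k < p l)%N) -> successive_blocks p y ->
  (forall eps : R, 0 < eps -> exists n, forall k, (n <= k)%N -> `|s (y k)| <= eps) ->
  (forall f, bounded_functional f -> exists l : R, f (y k) @[k --> \oo] --> l) ->
  forall f, bounded_functional f -> f (y k) @[k --> \oo] --> (0 : R).
Proof.
move=> p_inc yP ysm ycvg f bf; have [l fl] := ycvg f bf.
have [<-//|l0] := eqVneq l 0; exfalso.
have [g [bg [eta eta0 [n0 gn0]]]] : exists g, bounded_functional g /\
    exists2 eta : R, 0 < eta & exists n0, forall k, (n0 <= k)%N -> eta <= g (y k).
  have l20 : 0 < `|l| / 2 by rewrite divr_gt0// normr_gt0.
  have [n0 nP] := (cvg_seqP _ _).1 fl _ l20.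
  case: (ltrP 0 l) => lpos.
    exists f; split=> //; exists (`|l| / 2) => //; exists n0 => k /nP.
    by rewrite (gtr0_norm lpos) ler_norml => /andP[]; lra.
  exists (fun v => - f v); split; first exact: bounded_functionalN.
  exists (`|l| / 2) => //; exists n0 => k /nP.
  by rewrite (ler0_norm lpos) ler_norml => /andP[]; lra.
have [lg [D D0 gD]] := bg.
pose delta := eta / (2 * D * Ks).
have DK : 0 < 2 * D * Ks by rewrite !mulr_gt0.
have delta0 : 0 < delta by rewrite divr_gt0.
have [n1 n1P] := ysm _ delta0.
pose q := maxn n0 n1.
pose dif k := y (q + k.*2)%N - y (q + k.*2.+1)%N.
pose H := [set u : X | exists m (t : nat -> R), [/\ forall k, 0 <= t k,
  forall k, (m <= k)%N -> t k = 0, \sum_(k < m) t k = 1 &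
  u = \sum_(k < m) t k *: dif k]].
have ext (V : zmodType) (F : nat -> V) m m' : (forall k, (m <= k)%N -> F k = 0) ->
    (m <= m')%N -> \sum_(k < m) F k = \sum_(k < m') F k.
  move=> F0 mm'; rewrite (big_ord_widen _ F mm') big_mkcond; apply: eq_bigr => k _.
  by case: ltnP => // /F0.
have Hdif k : H (dif k).
  exists k.+1, (fun i => (i == k)%:R); split=> [i|i ki||]; first exact: ler0n.
  - by rewrite gtn_eqF.
  - by rewrite big_ord_recr /= eqxx big1 ?add0r// => i _; rewrite ltn_eqF.
  - rewrite big_ord_recr /= eqxx scale1r big1 ?add0r// => i _.
    by rewrite ltn_eqF// scale0r.
have [||u [m [t [t0 tm t1 ->]]]|h [lh h1 hH]] := @separating_functional R X H delta.
- by exists (dif 0%N).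
- move=> _ _ r [m [t [t0 tm t1 ->]]] [m' [t' [t0' tm' t1' ->]]] /andP[r0 r1].
  have r1' : 0 <= 1 - r by lra.
  exists (maxn m m'), (fun k => r * t k + (1 - r) * t' k); split=> [k|k||].
  + by rewrite addr_ge0// mulr_ge0.
  + by rewrite geq_max => /andP[/tm-> /tm'->]; rewrite !mulr0 addr0.
  + rewrite big_split /= -!mulr_sumr.
    rewrite -(ext R t m) ?leq_maxl// -(ext R t' m') ?leq_maxr// t1 t1'.
    by rewrite !mulr1 addrC subrK.
  + rewrite (ext X (fun k => t k *: dif k) m (maxn m m')) ?leq_maxl//; last first.
      by move=> k /tm->; rewrite scale0r.
    rewrite (ext X (fun k => t' k *: dif k) m' (maxn m m')) ?leq_maxr//; last first.
      by move=> k /tm'->; rewrite scale0r.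
    rewrite !scaler_sumr -big_split; apply: eq_bigr => k _.
    by rewrite /= [RHS]scalerDl !scalerA.
- pose tau k := if odd k then - t k./2 else t k./2.
  have half1 k : k.*2.+1./2 = k by rewrite -[LHS]/(uphalf k.*2) uphalf_double.
  have q_inc k i : (k < i)%N -> (p (q + k) < p (q + i))%N.
    by move=> ki; apply: p_inc; rewrite ltn_add2l.
  have yqP : successive_blocks (fun k => p (q + k)%N) (fun k => y (q + k)%N).
    by move=> k; rewrite addnS; exact: yP.
  have := @successive_blocks_suppression _ _ tau m.*2 odd q_inc yqP.
  rewrite (@sum_ord_double X (fun k => tau k *: y (q + k)%N)).
  rewrite (eq_bigr (fun k : 'I_m => t k *: dif k)) => [|k _]; last first.
    by rewrite /tau oddS odd_double half1 doubleK scaleNr scalerBr.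
  rewrite [X in `|X| <= _](_ : _ = \sum_(k < m) t k *: y (q + k.*2)%N); last first.
    rewrite big_mkcond (@sum_ord_double X (fun k => if ~~ odd k then tau k *: y (q + k)%N else 0)).
    by apply: eq_bigr => k _; rewrite oddS odd_double /= /tau odd_double doubleK addr0.
  have err : \sum_(k < m.*2 | odd k) `|tau k * s (y (q + k)%N)| <= delta.
    rewrite big_mkcond (@sum_ord_double R (fun k => if odd k then `|tau k * s (y (q + k)%N)| else 0)).
    rewrite -[delta]mul1r -t1 mulr_suml; apply: ler_sum => k _.
    rewrite oddS odd_double /= add0r /tau oddS odd_double half1 normrM normrN.
    rewrite (ger0_norm (t0 k)) ler_wpM2l//; apply: n1P.
    by rewrite (leq_trans (leq_maxr n0 n1))// leq_addr.
  set x := \sum_(k < m) t k *: y _; set z := \sum_(k < m) t k *: dif k => hx.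
  have gx : eta <= D * `|x|.
    apply: le_trans (gD x); apply: le_trans (ler_norm _).
    rewrite linear_fun_sum// -[eta]mul1r -t1 mulr_suml; apply: ler_sum => k _.
    rewrite linear_funZ// ler_wpM2l//; apply: gn0.
    by rewrite (leq_trans (leq_maxl n0 n1))// leq_addr.
  have : eta <= D * (Ks * (`|z| + delta)).
    apply: le_trans gx _; rewrite ler_pM2l//; apply: le_trans hx _.
    by rewrite ler_pM2l// lerD2l.
  have eE : eta = 2 * D * Ks * delta by rewrite /delta; field; rewrite !gt_eqF.
  rewrite {1}eE => h'.
  have : D * Ks * delta <= D * Ks * `|z| by lra.
  by rewrite ler_pM2l// mulr_gt0.
have bh : bounded_functional h by split=> //; exists 1 => // v; rewrite mul1r.
have := (cauchy_seqP (fun k => h (y k) : R^o)).1 (ycvg h bh) (delta / 2) (divr_gt0 delta0 (ltr0n _ 2)).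
move=> [n nP]; have := hH _ (Hdif n); rewrite linear_funB//.
have := nP (q + n.*2)%N (q + n.*2.+1)%N.
have nn : (n <= n.*2)%N by rewrite -addnn leq_addr.
have -> : (n <= q + n.*2)%N by apply: leq_trans nn (leq_addl _ _).
have -> : (n <= q + n.*2.+1)%N by apply: leq_trans (leqW nn) (leq_addl _ _).
by move=> /(_ isT isT); have := ler_norm (h (y (q + n.*2)%N) - h (y (q + n.*2.+1)%N)); lra.
Qed.

(** * Weakly Cauchy sequences in block form *)

Lemma proj_near v (eps : R) : 0 < eps ->
  exists m0, forall m, (m0 <= m)%N -> `|v - proj m v| <= eps.
Proof.
move=> eps0; have [m0 mP] := (cvg_seqP _ _).1 (@ccvg v) _ eps0.
by exists m0 => m /mP; rewrite distrC.
Qed.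

Lemma basis_norm_gt0 i : 0 < `|e i|.
Proof.
rewrite normr_gt0; apply/eqP => ei0.
have := coordinate_basis cuniq i i; rewrite ei0 eqxx linear_fun0// => /eqP.
by rewrite eq_sym oner_eq0.
Qed.

Lemma bound_gt0 : 0 < B.
Proof. exact: lt_le_trans (basis_norm_gt0 0) (eB 0). Qed.

Lemma coordinate_bounded_functional i : bounded_functional (c i).
Proof.
split=> //; have ei := basis_norm_gt0 i.
exists (2 * C / `|e i|); first by rewrite divr_gt0// mulr_gt0// (lt_le_trans ltr01 C1).
move=> v; rewrite mulrAC ler_pdivlMr// -normrZ.
have -> : c i v *: e i = proj i.+1 v - proj i v.
  by rewrite proj_block// big_nat1.
apply: le_trans (ler_normB _ _) _; have := cC v i; have := cC v i.+1.
by rewrite -/(proj i v) -/(proj i.+1 v); lra.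
Qed.

Lemma sum_functional_bounded : bounded_functional s.
Proof. by split=> //; exists S. Qed.

Lemma sum_functional_eq0 v : ~~ th -> s v = 0.
Proof.
move=> nth; apply/eqP; rewrite -normr_le0; apply/ler_addgt0Pr => eps eps0.
have [m mP] := proj_near v (divr_gt0 eps0 S0).
have s0 : s (proj m v) = 0.
  rewrite /proj linear_fun_sum// big1// => i _.
  by rewrite linear_funZ// se (negbTE nth) mulr0.
rewrite add0r -[s v]subr0 -s0 -linear_funB//; apply: le_trans (sS _) _.
by rewrite mulrC -ler_pdivlMr//; exact: mP.
Qed.

(** Evaluating at a functional the sum of the terms on which it is positive, and
    that of the terms on which it is negative, bounds its total variation. *)
Lemma functional_variation (y : nat -> X) (W : R) :
  (forall m (A : pred nat), `|\sum_(k < m | A k) y k| <= W) ->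
  forall f (D : R), linear_fun f -> (forall v, `|f v| <= D * `|v|) -> 0 <= D ->
  forall m, \sum_(k < m) `|f (y k)| <= 2 * D * W.
Proof.
move=> yW f D lf fD D0 m; rewrite (bigID (fun k : 'I_m => 0 <= f (y k))) /=.
have h1 : \sum_(k < m | 0 <= f (y k)) `|f (y k)| <= D * W.
  rewrite (eq_bigr (fun k : 'I_m => f (y k))) => [|k fk]; last by rewrite ger0_norm.
  rewrite -linear_fun_sum//; apply: le_trans (ler_norm _) _; apply: le_trans (fD _) _.
  by rewrite ler_wpM2l//; exact: (yW m (fun k => 0 <= f (y k))).
have h2 : \sum_(k < m | ~~ (0 <= f (y k))) `|f (y k)| <= D * W.
  rewrite (eq_bigr (fun k : 'I_m => - f (y k))) => [|k fk]; last first.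
    by rewrite ltr0_norm// ltNge.
  rewrite sumrN -linear_fun_sum//; apply: le_trans (ler_norm _) _.
  rewrite normrN; apply: le_trans (fD _) _.
  by rewrite ler_wpM2l//; exact: (yW m (fun k => ~~ (0 <= f (y k)))).
lra.
Qed.

Lemma bounded_variation_cvg (r : nat -> R) (W : R) :
  (forall m, \sum_(k < m) `|r k.+1 - r k| <= W) -> exists l : R, r k @[k --> \oo] --> l.
Proof.
move=> rW; have : cvgn (series (fun k => r k.+1 - r k)).
  apply: normed_cvg; apply: nondecreasing_is_cvgn.
    by apply: nondecreasing_series => k _ _; exact: normr_ge0.
  exists W => _ [m _ <-]; have := rW m.
  by rewrite -(big_mkord xpredT (fun k => `|r k.+1 - r k|)).
move=> /cvg_ex[l hl]; exists (r 0%N + l).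
rewrite (_ : (fun k => r k) = (fun k => r 0%N + series (fun k => r k.+1 - r k) k)).
  by apply: cvgD => //; exact: cvg_cst.
by apply/funext => k; rewrite /series /= telescope_sumr// addrC subrK.
Qed.

Lemma sum_half_powers_le m : \sum_(k < m) (2^-1 : R) ^+ k <= 2.
Proof. exact: (@sum_half_powers R m id). Qed.

(** The supremum of the reals that are infinitely often exceeded. *)
Lemma real_cluster_point (u : nat -> R) (A : R) : (forall n, `|u n| <= A) ->
  exists mu : R, forall eps : R, 0 < eps -> forall m, exists2 n, (m <= n)%N & `|u n - mu| <= eps.
Proof.
move=> uA; pose T := [set y : R | forall m, exists2 n, (m <= n)%N & y <= u n].
have TA : ubound T A.
  move=> y /(_ 0%N)[n _ /le_trans]; apply.
  exact: le_trans (ler_norm _) (uA n).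
have T0 : has_sup T.
  split; last by exists A.
  exists (- A) => m; exists m => //.
  by have := uA m; rewrite ler_norml => /andP[].
exists (sup T) => eps eps0 m.
have [y Ty yT] := sup_adherent eps0 T0.
have : ~ T (sup T + eps).
  by move=> /(ub_le_sup T0.2); rewrite gerDl leNgt eps0.
move=> /existsNP[m' m'P].
have [n mn yn] := Ty (maxn m m'); exists n; first exact: leq_trans (leq_maxl _ _) mn.
have lt : u n < sup T + eps.
  rewrite ltNge; apply/negP => h; apply: m'P; exists n => //.
  exact: leq_trans (leq_maxr _ _) mn.
by rewrite ler_norml; apply/andP; split; lra.
Qed.

Lemma cvg_subseq_ge (V : normedModType R) (u : nat -> V) (l : V) (n : nat -> nat) :
  u k @[k --> \oo] --> l -> (forall k, (k <= n k)%N) -> u (n k) @[k --> \oo] --> l.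
Proof.
move=> ul nge; apply/cvg_seqP => eps eps0; have [m mP] := (cvg_seqP _ _).1 ul _ eps0.
by exists m => k mk; apply: mP; exact: leq_trans mk (nge k).
Qed.

Section BlockForm.
Variables (a : nat -> R) (A : R).

Definition partial m : X := \sum_(i < m) a i *: e i.

Hypothesis partial_bound : forall m, `|partial m| <= A.

Lemma proj_partial m n : proj m (partial n) = partial (minn m n).
Proof. exact: proj_partial_sum. Qed.

(** The increments of the partial sums along [M] are almost blocks with zero
    sum, hence form a weakly unconditionally Cauchy series. *)
Lemma increment_bound (M : nat -> nat) (mu eps0 : R) :
  (forall k l, (k < l)%N -> (M k < M l)%N) -> 0 < eps0 ->
  (forall k, `|s (partial (M k)) - mu| <= eps0 * (2^-1) ^+ k) ->
  forall m (Q : pred nat),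
    `|\sum_(k < m | Q k) (partial (M k.+1) - partial (M k))| <= Ks * (2 * A + 4 * eps0).
Proof.
move=> M_inc eps00 sM m Q.
have blk k : (k <= m)%N -> proj (M k) (partial (M m)) = partial (M k).
  by move=> km; rewrite proj_partial (minn_idPl _)// increasing_leq.
have := vector_suppression M_inc (partial (M m)) m (predC Q).
rewrite (eq_bigl (fun k : 'I_m => Q k)) => [|k]; last by rewrite /= negbK.
rewrite (eq_bigr (fun k : 'I_m => partial (M k.+1) - partial (M k))) => [|k _]; last first.
  by rewrite !blk// ltnW.
move=> /le_trans; apply; rewrite ler_wpM2l ?(ltW Ks0)// !blk//; apply: lerD.
  by apply: le_trans (ler_normB _ _) _; have := partial_bound (M m); have := partial_bound (M 0); lra.
apply: (@le_trans _ _ (\sum_(k < m) 2 * eps0 * (2^-1) ^+ k)); last first.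
  rewrite -mulr_sumr; have := ler_wpM2l (ltW eps00) (sum_half_powers_le m); lra.
rewrite [leLHS]big_mkcond; apply: ler_sum => k _.
have hk : 0 <= (2^-1) ^+ k :> R by rewrite exprn_ge0.
have hk' : 0 <= eps0 * (2^-1) ^+ k by rewrite mulr_ge0// ltW.
case: ifP => _; last by lra.
rewrite /block_sum !blk//; last exact: ltnW.
have := sM k; have := sM k.+1; rewrite exprS => h1 h2.
have := ler_distD mu (s (partial (M k.+1))) (s (partial (M k))).
by rewrite (distrC mu); lra.
Qed.

Lemma sum_limit_eq0 (x : nat -> X) (Ls mu : R) : ~~ th ->
  s (x n) @[n --> \oo] --> Ls ->
  (forall eps : R, 0 < eps -> exists m, `|s (partial m) - mu| <= eps) -> Ls - mu = 0.
Proof.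
move=> nth sL smu; have Ls0 : Ls = 0.
  apply: (cvg_unique _ sL) => //; rewrite (_ : (fun n => s (x n)) = (fun=> 0)).
    exact: cvg_cst.
  by apply/funext => n; exact: sum_functional_eq0.
apply/eqP; rewrite Ls0 sub0r oppr_eq0 -normr_le0; apply/ler_addgt0Pr => eps e0.
have [m] := smu eps e0; rewrite sum_functional_eq0// sub0r normrN.
by rewrite add0r.
Qed.

(** Gliding hump: a weakly Cauchy sequence [x] agrees, along a subsequence and up
    to a norm null error, with a partial sum of the expansion of its weak-star
    limit plus a block [y k] located after it; the sums of these blocks tend to
    [Ls - mu], so that [y k] may be replaced by a multiple of an average. *)
Lemma weak_cauchy_block_form (x : nat -> X) (Ls mu delta eps0 : R) :
  (forall f, bounded_functional f -> exists l : R, f (x n) @[n --> \oo] --> l) ->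
  (forall i, c i (x n) @[n --> \oo] --> a i) ->
  s (x n) @[n --> \oo] --> Ls -> 0 < eps0 ->
  (forall v m0 (eps : R), 0 < eps -> exists m, [/\ (m0 <= m)%N,
     `|s (partial m) - mu| <= eps & delta <= `|partial m - v|]) ->
  exists M : nat -> nat,
    [/\ forall k, (M k + N k <= M k.+1)%N,
        forall k, `|s (partial (M k)) - mu| <= eps0 * (2^-1) ^+ k,
        delta <= `|partial (M 0)|,
        forall k, delta <= `|partial (M k.+1) - partial (M k)| &
        forall f, bounded_functional f ->
          f (x k - (partial (M k) + (Ls - mu) *: sparse_average e M N k)) @[k --> \oo]
            --> (0 : R)].
Proof.
move=> xc ca sL eps00 Hd; pose lam := Ls - mu.
have lam0 : ~~ th -> lam = 0.
  move=> nth; apply: (sum_limit_eq0 nth sL) => eps e0.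
  by have [m [_ + _]] := Hd 0 0%N eps e0; exists m.
have projx m : proj m (x n) @[n --> \oo] --> partial m.
  by apply: cvg_sum_ord => i; apply: cvgZl; exact: ca.
have near m n0 (eps : R) : 0 < eps -> exists n, (n0 < n)%N /\ `|proj m (x n) - partial m| <= eps.
  move=> e0; have [n1 nP] := (cvg_seqP _ _).1 (projx m) _ e0.
  exists (maxn n1 n0.+1); split; first exact: leq_maxr.
  by apply: nP; exact: leq_maxl.
have h2 k : 0 < (2^-1) ^+ k :> R by rewrite exprn_gt0.
have stepex (q : nat * (nat * nat)) : exists q' : nat * nat, let k := q.1 in
    let M := q.2.1 in let n := q.2.2 in
    [/\ (M + N k <= q'.1)%N /\ (n < q'.2)%N, `|x n - proj q'.1 (x n)| <= (2^-1) ^+ k,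
     `|s (partial q'.1) - mu| <= eps0 * (2^-1) ^+ k.+1,
     delta <= `|partial q'.1 - partial M| &
     `|proj q'.1 (x q'.2) - partial q'.1| <= (2^-1) ^+ k.+1].
  case: q => k [M n] /=.
  have [m0 m0P] := proj_near (x n) (h2 k).
  have [M' [M'ge sM' dM']] := Hd (partial M) (maxn m0 (M + N k)) _ (mulr_gt0 eps00 (h2 k.+1)).
  have [n' [nn' n'P]] := near M' n _ (h2 k.+1).
  move: M'ge; rewrite geq_max => /andP[M'1 M'2].
  by exists (M', n'); split=> //; exact: m0P.
have [step stepP] := choice stepex.
have [M0 [_ sM0 dM0]] := Hd 0 0%N _ eps00.
have [n0 [_ n0P]] := near M0 0%N 1 ltr01.
pose st := fix st k := if k is j.+1 then step (j, st j) else (M0, n0).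
pose M k := (st k).1; pose n k := (st k).2.
have MN k : (M k + N k <= M k.+1)%N by have [[]] := stepP (k, st k).
have nS k : (n k < n k.+1)%N by have [[]] := stepP (k, st k).
have xM k : `|x (n k) - proj (M k.+1) (x (n k))| <= (2^-1) ^+ k.
  by have [] := stepP (k, st k).
have sM k : `|s (partial (M k)) - mu| <= eps0 * (2^-1) ^+ k.
  by case: k => [|k]; [rewrite expr0 mulr1|have [] := stepP (k, st k)].
have dM k : delta <= `|partial (M k.+1) - partial (M k)|.
  by have [] := stepP (k, st k).
have pM k : `|proj (M k) (x (n k)) - partial (M k)| <= (2^-1) ^+ k.
  by case: k => [|k]; [rewrite expr0|have [] := stepP (k, st k)].
have M_inc k l : (k < l)%N -> (M k < M l)%N.
  elim: l => // l IH; rewrite ltnS leq_eqVlt => /predU1P[->|/IH kl].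
    by apply: leq_trans (MN l); rewrite -[X in (X < _)%N]addn0 ltn_add2l.
  by apply: leq_trans kl (leq_trans (leq_addr _ _) (MN l)).
have nge k : (k <= n k)%N by elim: k => // k IH; exact: leq_ltn_trans IH (nS k).
exists M; split=> //; first by move: dM0; rewrite subr0.
pose z k := proj (M k.+1) (x (n k)) - proj (M k) (x (n k)).
pose y k := z k - lam *: e (M k).
pose r k := x (n k) - partial (M k) - z k.
have rP k : `|r k| <= 2 * (2^-1) ^+ k.
  have -> : r k = (x (n k) - proj (M k.+1) (x (n k))) + (proj (M k) (x (n k)) - partial (M k)).
    by rewrite /r /z opprB addrACA [RHS]addrACA (addrC (- partial _)).
  by apply: le_trans (ler_normD _ _) _; have := xM k; have := pM k; lra.
have yP : successive_blocks M y.
  move=> k; have MM := M_inc _ _ (ltnSn k).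
  rewrite /y /z !projB !projZ !proj_basis !proj_proj MM ltnn scaler0 subr0 !minnn.
  by rewrite (minn_idPr (ltnW MM)) (minn_idPl (ltnW MM)) subrr.
have Mge k : (k <= M k)%N by exact: increasing_ge_id.
have rf f : bounded_functional f -> f (r k) @[k --> \oo] --> (0 : R).
  move=> [lf [D D0 fD]]; apply/cvg_seqP => eps eps00'.
  have d0 : 0 < eps / (2 * D) by rewrite divr_gt0// mulr_gt0.
  have [m mP] := (cvg_seqP _ _).1 (@cvg_geometric_half R) _ d0.
  exists m => k /mP; rewrite !subr0 (ger0_norm (ltW (h2 k))) ler_pdivlMr ?mulr_gt0// => hk.
  by apply: le_trans (fD _) _; have := ler_wpM2l (ltW D0) (rP k); lra.
have xf f : bounded_functional f -> exists l : R, f (x (n k)) @[k --> \oo] --> l.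
  move=> bf; have [l fl] := xc f bf; exists l.
  exact: (@cvg_subseq_ge R^o (fun k => f (x k)) l n fl nge).
have pf f : bounded_functional f -> exists l : R, f (partial (M k)) @[k --> \oo] --> l.
  move=> [lf [D D0 fD]].
  have W := functional_variation (y := fun k => partial (M k.+1) - partial (M k))
    (increment_bound M_inc eps00 sM) lf fD (ltW D0).
  apply: bounded_variation_cvg => m; apply: le_trans (W m).
  by apply: ler_sum => k _; rewrite (linear_funB _ _ lf).
have ef f : bounded_functional f -> exists l : R, lam * f (e (M k)) @[k --> \oo] --> l.
  move=> bf; have [thT|nth] := boolP th; last first.
    by exists 0; rewrite lam0//; under eq_fun do rewrite mul0r; exact: cvg_cst.
  have [l fl] := basis_weak_cauchy thT bf; exists (lam * l); apply: cvgMr.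
  exact: (@cvg_subseq_ge R^o (fun k => f (e k)) l M fl Mge).
have yE f k : linear_fun f ->
    f (y k) = f (x (n k)) - f (partial (M k)) - f (r k) - lam * f (e (M k)).
  move=> lf; rewrite /y (linear_funB _ _ lf) (linear_funZ _ _ lf); congr (_ - _).
  by rewrite /r; move: (z k) => zk; rewrite !(linear_funB _ _ lf); ring.
have yf f : bounded_functional f -> f (y k) @[k --> \oo] --> (0 : R).
  apply: (weakly_null_blocks M_inc yP) => [|g bg].
    have ps : s (partial (M k)) @[k --> \oo] --> mu.
      apply/cvg_seqP => eps eps1.
      have [m mP] := (cvg_seqP _ _).1 (@cvg_geometric_half R) _ (divr_gt0 eps1 eps00).
      exists m => k /mP; rewrite subr0 (ger0_norm (ltW (h2 k))) ler_pdivlMr// mulrC.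
      exact: le_trans (sM k).
    have sy : s (y k) @[k --> \oo] --> Ls - mu - 0 - lam * th%:R.
      rewrite (_ : (fun k => s (y k)) = (fun k => s (x (n k)) - s (partial (M k)) - s (r k) -
        lam * th%:R)); last by apply/funext => k; rewrite (yE s k slin) se.
      apply: cvgB; last exact: cvg_cst.
      apply: cvgB; last exact: rf sum_functional_bounded.
      by apply: cvgB => //; exact: (@cvg_subseq_ge R^o (fun k => s (x k)) Ls n sL nge).
    have E : Ls - mu - 0 - lam * th%:R = 0.
      have [thT|nth] := boolP th; first by rewrite mulr1 subr0 subrr.
      by rewrite mulr0 !subr0; exact: lam0.
    rewrite E in sy => eps eps1; have [m mP] := (cvg_seqP (V := R^o) _ _).1 sy _ eps1.
    by exists m => k /mP; rewrite subr0.
  have [l1 h1] := xf g bg; have [l2 h2'] := pf g bg; have [l3 h3] := ef g bg.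
  exists (l1 - l2 - 0 - l3).
  rewrite (_ : (fun k => g (y k)) = (fun k => g (x (n k)) - g (partial (M k)) - g (r k) -
    lam * g (e (M k)))); last by apply/funext => k; rewrite (yE g k bg.1).
  by apply: cvgB => //; apply: cvgB; [exact: cvgB|exact: rf].
move=> f bf; have [lf _] := bf; have [l fl] := xc f bf.
have uf : lam * (f (e (M k)) - f (sparse_average e M N k)) @[k --> \oo] --> (0 : R).
  have [thT|nth] := boolP th; last first.
    by rewrite lam0//; under eq_fun do rewrite mul0r; exact: cvg_cst.
  rewrite -(mulr0 lam); apply: cvgMr; apply/(cvg_seqP (V := R^o)) => eps eps1.
  have [m mP] := average_weak_limit thT Mge bf eps1.
  by exists m => k /mP; rewrite subr0 distrC.
have -> : (0 : R) = (l - l) + 0 + 0 + 0 by rewrite subrr !addr0.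
rewrite (_ : (fun k => f _) = (fun k => (f (x k) - f (x (n k))) + f (r k) + f (y k) +
  lam * (f (e (M k)) - f (sparse_average e M N k)))); last first.
  apply/funext => k; rewrite /y /r -/lam; move: (z k) (sparse_average e M N k) => zk u.
  by rewrite !(linear_funB _ _ lf) (linear_funD _ _ lf) !(linear_funZ _ _ lf); ring.
apply: cvgD => //; apply: cvgD; last exact: yf.
apply: cvgD; last exact: rf.
by apply: cvgB => //; exact: (@cvg_subseq_ge R^o (fun k => f (x k)) l n fl nge).
Qed.


(** * Convex block sequences of the block form *)

Section Shiftable.
Variables (M : nat -> nat) (mu eps0 lam delta : R).
Hypothesis MN : forall k, (M k + N k <= M k.+1)%N.
Hypothesis eps00 : 0 < eps0.
Hypothesis sM : forall k, `|s (partial (M k)) - mu| <= eps0 * (2^-1) ^+ k.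
Hypothesis delta0 : delta <= `|partial (M 0)|.
Hypothesis deltaS : forall k, delta <= `|partial (M k.+1) - partial (M k)|.
Hypothesis lam_th : lam != 0 -> th.
Hypothesis lam_large : lam != 0 -> 24 * B * S * (1 + C) * eps0 <= `|lam|.
Hypothesis lam_delta : lam = 0 -> 0 < delta.

Let u := sparse_average e M N.
Let w k := partial (M k) + lam *: u k.
Let W := Ks * (2 * A + 4 * eps0).

Lemma block_start_increasing k l : (k < l)%N -> (M k < M l)%N.
Proof.
elim: l => // l IH; rewrite ltnS leq_eqVlt => /predU1P[->|/IH kl].
  by apply: leq_trans (MN l); rewrite -[X in (X < _)%N]addn0 ltn_add2l.
by apply: leq_trans kl (leq_trans (leq_addr _ _) (MN l)).
Qed.
Local Notation M_inc := block_start_increasing.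

Lemma averages_successive : successive_blocks M u.
Proof.
move=> k; rewrite /u /sparse_average; split; rewrite projZ proj_sum; last first.
  by rewrite big1 ?scaler0// => i _; rewrite proj_basis ltnNge leq_addr.
congr (_ *: _); apply: eq_bigr => i _; rewrite proj_basis ifT//.
by apply: leq_trans (MN k); rewrite ltn_add2l.
Qed.

Lemma average_norm k : `|u k| <= B.
Proof.
have Nk : 0 < (N k)%:R :> R by rewrite ltr0n.
rewrite /u /sparse_average normrZ gtr0_norm ?invr_gt0// ler_pdivrMl//.
apply: le_trans (ler_norm_sum _ _ _) _.
by rewrite mulr_natl -[X in _ *+ X]card_ord -sumr_const; apply: ler_sum => i _.
Qed.

Lemma average_sum k : th -> s (u k) = 1.
Proof.
move=> thT; have Nk : (N k)%:R != 0 :> R by rewrite pnatr_eq0 -lt0n.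
rewrite /u /sparse_average linear_funZ// linear_fun_sum//.
rewrite (eq_bigr (fun=> 1)) => [|i _]; last by rewrite se thT.
by rewrite sumr_const card_ord mulVf.
Qed.

(** A tail is the value of [s] at a remainder of the combination of averages. *)
Lemma tail_le_averages (b : nat -> R) k n : th -> (k <= n)%N ->
  `|\sum_(k <= l < n) b l| <= S * (1 + C) * `|\sum_(l < n) b l *: u l|.
Proof.
move=> thT kn; set v := \sum_(l < n) _.
have E : v - proj (M k) v = \sum_(k <= l < n) b l *: u l.
  rewrite /v (successive_blocks_sumP b n k M_inc averages_successive).
  rewrite -(big_mkord (fun l => (l < k)%N) (fun l => b l *: u l)).
  rewrite -(big_mkord xpredT (fun l => b l *: u l)).
  rewrite (@big_cat_nat _ _ _ k)//= [X in _ - X](@big_cat_nat _ _ _ k)//=.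
  rewrite [X in _ - (_ + X)]big1_seq ?addr0; last first.
    by move=> l; rewrite mem_index_iota => /andP[lk /andP[kl _]]; move: lk; rewrite ltnNge kl.
  rewrite [X in _ - X]big_nat_cond [X in _ - X](_ : _ = \sum_(0 <= l < k) b l *: u l).
    by rewrite addrAC subrr add0r.
  by rewrite [RHS]big_nat; apply: eq_bigl => l; case: (l < k)%N; rewrite ?andbF.
have -> : \sum_(k <= l < n) b l = s (v - proj (M k) v).
  rewrite E linear_fun_sum//; apply: eq_bigr => l _.
  by rewrite linear_funZ// average_sum// mulr1.
apply: le_trans (sS _) _; rewrite -mulrA ler_wpM2l ?(ltW S0)//.
apply: le_trans (ler_normB _ _) _; rewrite mulrDl mul1r lerD2l; exact: cC.
Qed.

Lemma A_ge0 : 0 <= A.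
Proof. exact: le_trans (normr_ge0 _) (partial_bound 0). Qed.

Lemma W_ge0 : 0 <= W.
Proof.
by rewrite /W mulr_ge0 ?(ltW Ks0)// addr_ge0 ?mulr_ge0 ?A_ge0// ltW.
Qed.

(** Along a functional, the partial sums have bounded variation, so summation by
    parts bounds their combination by the tails of [b]; the averages [u (j k)]
    are estimated by [sparse_average_bound], each [b k *: u k] being a block. *)
Lemma subsequence_upper (b : nat -> R) (j : nat -> nat) n (D : R) :
  (forall k l, (k < l)%N -> (j k < j l)%N) ->
  (forall k, (k <= n)%N -> `|\sum_(k <= l < n) b l| <= D) ->
  `|\sum_(k < n) b k *: w (j k)| <=
  D * (A + 2 * W) + `|lam| * (Cu * `|\sum_(k < n) b k *: u k|).
Proof.
move=> j_inc bD.
have -> : \sum_(k < n) b k *: w (j k) = \sum_(k < n) b k *: partial (M (j k)) +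
    lam *: \sum_(k < n) b k *: u (j k).
  rewrite scaler_sumr -big_split; apply: eq_bigr => k _.
  by rewrite /w /= scalerDr !scalerA (mulrC lam).
apply: le_trans (ler_normD _ _) _; apply: lerD.
  set v := \sum_(k < n) _; have [f [lf f1 fv]] := norming_functional v.
  have D0 : 0 <= D by exact: le_trans (normr_ge0 _) (bD n (leqnn n)).
  rewrite -fv; apply: le_trans (ler_norm _) _; rewrite linear_fun_sum//.
  rewrite (eq_bigr (fun k : 'I_n => b k * f (partial (M (j k))))); last first.
    by move=> k _; rewrite linear_funZ.
  apply: le_trans (abel_bound (fun k => f (partial (M (j k)))) bD) _.
  rewrite ler_wpM2l//; apply: lerD; first exact: le_trans (f1 _) (partial_bound _).
  have f1' x : `|f x| <= 1 * `|x| by rewrite mul1r.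
  have := functional_variation (y := fun k => partial (M k.+1) - partial (M k))
    (increment_bound M_inc eps00 sM) lf f1' ler01 (j n).
  rewrite mulr1 -/W => /(le_trans _); apply.
  rewrite -(big_mkord xpredT (fun k => `|f (partial (M k.+1) - partial (M k))|)).
  elim: n {bD v fv} => [|m IH]; first by rewrite big_ord0 sumr_ge0.
  have jm : (j m <= j m.+1)%N by exact: ltnW (j_inc _ _ (ltnSn m)).
  rewrite big_ord_recr (@big_cat_nat _ _ _ (j m))//=; apply: lerD => //.
  rewrite -(linear_funB _ _ lf) -(telescope_sumr (fun k => partial (M k)) jm).
  by rewrite linear_fun_sum//; exact: ler_norm_sum.
rewrite normrZ; have [->|lamn0] := eqVneq lam 0; first by rewrite normr0 !mul0r.
have thT := lam_th lamn0; rewrite ler_wpM2l//.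
pose v := \sum_(k < n) b k *: u k.
have blk k : proj (M k) v = \sum_(l < n | (l < k)%N) b l *: u l.
  exact: (successive_blocks_sumP b n k M_inc averages_successive).
have := vector_average_bound M_inc v n thT MN j_inc.
have -> : proj (M n) v - proj (M 0) v = v.
  rewrite !blk [X in _ - X]big_pred0 ?subr0//.
  by apply: eq_bigl => k; rewrite ltn_ord.
rewrite (eq_bigr (fun k : 'I_n => b k *: u (j k)))// => k _.
rewrite /block_sum -linear_funB// !blk.
rewrite [X in X - _](bigD1 k)//= (eq_bigl (fun l : 'I_n => (l < k)%N)).
  by rewrite addrK linear_funZ// average_sum// mulr1.
by move=> l; rewrite ltnS [RHS]ltn_neqAle andbC.
Qed.

Section ConvexBlocks.
Variables (F : nat -> {fset nat}) (t : nat -> nat -> R) (v : nat -> X).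
Hypotheses (F0 : forall n, F n != fset0)
  (F_lt : forall n i j, i \in F n -> j \in F n.+1 -> (i < j)%N)
  (t01 : forall n i, i \in F n -> 0 <= t n i <= 1)
  (t1 : forall n, \sum_(i <- F n) t n i = 1)
  (vE : forall n, v n = \sum_(i <- F n) t n i *: w i).

Lemma convex_sets_lt k l i j : (k < l)%N -> i \in F k -> j \in F l -> (i < j)%N.
Proof.
elim: l j => // l IH j; rewrite ltnS leq_eqVlt => /predU1P[->|kl] iF jF.
  exact: F_lt iF jF.
have /fset0Pn[m mF] := F0 l.
exact: ltn_trans (IH m kl iF mF) (F_lt mF jF).
Qed.

Lemma convex_upper (b : nat -> R) n (D : R) :
  (forall k, (k <= n)%N -> `|\sum_(k <= l < n) b l| <= D) ->
  `|\sum_(k < n) b k *: v k| <=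
  D * (A + 2 * W) + `|lam| * (Cu * `|\sum_(k < n) b k *: u k|).
Proof.
move=> bD.
have -> : \sum_(k < n) b k *: v k =
    \sum_(k < n) \sum_(i <- F k) t k i *: (b k *: w i).
  apply: eq_bigr => k _; rewrite vE scaler_sumr; apply: eq_bigr => i _.
  by rewrite !scalerA mulrC.
apply: (convex_choice_bound (h := fun k i => b k *: w i)) => //.
  by move=> k i /t01/andP[].
move=> j jF; apply: subsequence_upper => // k l kl.
exact: convex_sets_lt kl (jF k) (jF l).
Qed.

Lemma convex_first_ex : exists g : nat -> nat, forall k, g k \in F k /\
  forall i, i \in F k -> (g k <= i)%N.
Proof.
have ex k : exists i, i \in F k /\ forall l, l \in F k -> (i <= l)%N.
  have /fset0Pn[m mF] := F0 k.
  have ex : exists i, i \in F k by exists m.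
  by case: (ex_minnP ex) => i iF imin; exists i.
by have [g gP] := choice ex; exists g.
Qed.

(** The terms of rank at least [l] only contribute, below the starting point of
    the [l]-th block, a multiple of a partial sum. *)
Lemma proj_convex_sum (b : nat -> R) n q l x :
  (forall k i, (k < l)%N -> i \in F k -> proj q (w i) = w i) ->
  (forall k i, (l <= k)%N -> i \in F k -> proj q (w i) = x) -> (l <= n)%N ->
  proj q (\sum_(k < n) b k *: v k) =
  \sum_(k < l) b k *: v k + (\sum_(l <= k < n) b k) *: x.
Proof.
move=> lt ge ln.
rewrite -(big_mkord xpredT (fun k => b k *: v k)) proj_sum (@big_cat_nat _ _ _ l)//=.
congr (_ + _).
  rewrite big_mkord; apply: eq_bigr => k _; rewrite projZ; congr (_ *: _).
  rewrite vE proj_sum big_seq [RHS]big_seq; apply: eq_bigr => i iF.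
  by rewrite projZ (lt k).
rewrite scaler_suml; apply: eq_big_nat => k /andP[lk _]; rewrite projZ; congr (_ *: _).
rewrite vE proj_sum big_seq -[RHS]scale1r -(t1 k) scaler_suml [RHS]big_seq.
by apply: eq_bigr => i iF; rewrite projZ (ge k).
Qed.

Lemma proj_w q i : (q <= M i)%N -> proj q (w i) = partial q.
Proof.
move=> qi; rewrite /w projD projZ proj_partial (minn_idPl qi).
have -> : proj q (u i) = 0.
  rewrite /u /sparse_average projZ proj_sum big1 ?scaler0// => l _.
  by rewrite proj_basis ltnNge (leq_trans qi)// leq_addr.
by rewrite scaler0 addr0.
Qed.

Lemma proj_w_id q i : (M i.+1 <= q)%N -> proj q (w i) = w i.
Proof.
move=> iq; rewrite /w projD projZ proj_partial (minn_idPr _); last first.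
  exact: leq_trans (ltnW (M_inc (ltnSn i))) iq.
have [ui _] := averages_successive i.
by rewrite -{1}ui proj_proj (minn_idPr iq) ui.
Qed.

Section FirstTerms.
Variables (g : nat -> nat).
Hypothesis gP : forall k, g k \in F k /\ forall i, i \in F k -> (g k <= i)%N.

Lemma first_term_increasing k l : (k < l)%N -> (g k < g l)%N.
Proof. by move=> kl; apply: convex_sets_lt kl (gP k).1 (gP l).1. Qed.

Lemma first_term_le k l i : (l <= k)%N -> i \in F k -> (g l <= i)%N.
Proof.
rewrite leq_eqVlt => /predU1P[->|lk] iF; first exact: (gP k).2.
exact: ltnW (convex_sets_lt lk (gP l).1 iF).
Qed.

Lemma proj_first_term (b : nat -> R) n l : (l <= n)%N ->
  proj (M (g l)) (\sum_(k < n) b k *: v k) =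
  \sum_(k < l) b k *: v k + (\sum_(l <= k < n) b k) *: partial (M (g l)).
Proof.
apply: proj_convex_sum => [k i kl iF|k i lk iF].
  apply: proj_w_id; apply: (increasing_leq M_inc).
  exact: convex_sets_lt kl iF (gP l).1.
by apply: proj_w; apply: (increasing_leq M_inc); exact: first_term_le iF.
Qed.

(** Cut the coordinates at the starting points of the first terms [g k] of the
    convex combinations. In the [l]-th block, [v l] contributes [lam * b l] through
    its averages; everything else comes from increments of [s] along partial sums,
    with a factor [b l] or a tail of [b], and these increments are summable. *)
Lemma convex_block_sum (b : nat -> R) n l (D : R) : th -> (l < n)%N ->
  (forall k, (k <= n)%N -> `|\sum_(k <= i < n) b i| <= D) ->
  `|block_sum (M \o g) l (\sum_(k < n) b k *: v k) - lam * b l| <=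
  6 * D * eps0 * (2^-1) ^+ l.
Proof.
move=> thT ln bD; rewrite /block_sum /= !proj_first_term//; last exact: ltnW.
rewrite big_ord_recr /= !(linear_funD _ _ slin) !(linear_funZ _ _ slin).
have tl := bD l.+1 ln; have t0 := bD l (ltnW ln); rewrite (big_ltn ln) in t0 *.
set tail := \sum_(l.+1 <= k < n) b k in tl t0 *.
have q0 : 0 <= (2^-1) ^+ l :> R by rewrite exprn_ge0.
have small i : (l <= i)%N -> `|s (partial (M i)) - mu| <= eps0 * (2^-1) ^+ l.
  move=> li; apply: le_trans (sM i) _; rewrite ler_wpM2l ?(ltW eps00)//.
  by apply: ler_wiXn2l => //; rewrite invf_le1// ler1n.
have gl : (l <= g l)%N by apply: increasing_ge_id => ? ?; exact: first_term_increasing.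
have close i : (l <= i)%N ->
    `|s (partial (M i)) - s (partial (M (g l)))| <= 2 * eps0 * (2^-1) ^+ l.
  move=> li; have := small i li; have := small _ gl.
  by have := ler_distD mu (s (partial (M i))) (s (partial (M (g l)))); rewrite (distrC mu); lra.
have sv : `|s (v l) - lam - s (partial (M (g l)))| <= 2 * eps0 * (2^-1) ^+ l.
  have -> : s (v l) - lam - s (partial (M (g l))) =
      \sum_(i <- F l) t l i * (s (partial (M i)) - s (partial (M (g l)))).
    rewrite vE linear_fun_sum//.
    rewrite [LHS](_ : _ = \sum_(i <- F l) t l i * s (w i) -
      \sum_(i <- F l) t l i * (lam + s (partial (M (g l))))).
      rewrite -sumrB; apply: eq_bigr => i _; rewrite -mulrBr; congr (_ * _).
      by rewrite /w (linear_funD _ _ slin) (linear_funZ _ _ slin) average_sum//; ring.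
    rewrite -mulr_suml t1 mul1r opprD addrA; congr (_ - _ - _).
    by apply: eq_bigr => i _; rewrite (linear_funZ _ _ slin).
  apply: le_trans (ler_norm_sum _ _ _) _.
  apply: (@le_trans _ _ ((\sum_(i <- F l) t l i) * (2 * eps0 * (2^-1) ^+ l))); last first.
    by rewrite t1 mul1r.
  rewrite mulr_suml big_seq [leRHS]big_seq.
  apply: ler_sum => i iF; have /andP[ti _] := t01 iF.
  rewrite normrM (ger0_norm ti) ler_wpM2l//; apply: close.
  exact: leq_trans gl ((gP l).2 i iF).
have sg := close _ (leq_trans (leqnSn l) (increasing_ge_id first_term_increasing l.+1)).
set r1 := s (v l) - lam - _ in sv; set r2 := s (partial (M (g l.+1))) - _ in sg.
rewrite [X in `|X| <= _](_ : _ = b l * r1 + tail * r2); last by rewrite /r1 /r2; ring.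
have bl : `|b l| <= 2 * D.
  by have := ler_normB (b l + tail) tail; rewrite addrK; lra.
apply: le_trans (ler_normD _ _) _; rewrite !normrM.
have h1 := ler_pM (normr_ge0 _) (normr_ge0 _) bl sv.
have h2 := ler_pM (normr_ge0 _) (normr_ge0 _) tl sg.
by lra.
Qed.

End FirstTerms.

(** The errors in [convex_block_sum] are bounded by the tails of [b], hence by the
    combination of averages itself; [lam_large] makes them absorb at most half of
    the left-hand side. *)
Lemma convex_lower_average (b : nat -> R) n : lam != 0 ->
  `|lam| * `|\sum_(k < n) b k *: u k| <= 4 * C * Cu * `|\sum_(k < n) b k *: v k|.
Proof.
move=> lamn0; have thT := lam_th lamn0; have [g gP] := convex_first_ex.
set x := \sum_(k < n) b k *: v k; set y := \sum_(k < n) b k *: u k.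
pose D := S * (1 + C) * `|y|.
have bD k : (k <= n)%N -> `|\sum_(k <= l < n) b l| <= D by exact: tail_le_averages.
have p_inc k l : (k < l)%N -> ((M \o g) k < (M \o g) l)%N.
  by move=> kl; apply: M_inc; exact: (first_term_increasing gP).
have := vector_average_bound p_inc x n thT MN (j := id) (fun k l => id).
set z := \sum_(k < n) _ => hz.
have C0 : 0 <= C := le_trans ler01 C1.
have {}hz : `|z| <= Cu * (2 * C * `|x|).
  apply: le_trans hz _; rewrite ler_wpM2l ?(ltW Cu0)//.
  apply: le_trans (ler_normB _ _) _; have := cC x ((M \o g) n); have := cC x ((M \o g) 0%N).
  by rewrite -!/(proj _ x); lra.
have D0 : 0 <= D by rewrite /D !mulr_ge0 ?(ltW S0)// addr_ge0.
have B0 := bound_gt0.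
have err : `|z - lam *: y| <= 12 * D * eps0 * B.
  rewrite /z /y scaler_sumr -sumrB; apply: le_trans (ler_norm_sum _ _ _) _.
  apply: (@le_trans _ _ (\sum_(l < n) 6 * D * eps0 * B * (2^-1) ^+ l)).
    apply: ler_sum => l _; rewrite scalerA -scalerBl normrZ.
    have h := convex_block_sum gP thT (ltn_ord l) bD.
    have := ler_pM (normr_ge0 _) (normr_ge0 _) h (average_norm l); rewrite /=; lra.
  rewrite -mulr_sumr; have h0 : 0 <= 6 * D * eps0 * B.
    by rewrite mulr_ge0 ?(ltW B0)// mulr_ge0 ?(ltW eps00)// mulr_ge0.
  have := ler_wpM2l h0 (sum_half_powers_le n); lra.
have h1 : `|lam| * `|y| <= `|z| + `|z - lam *: y|.
  by rewrite -normrZ; have := lerB_dist (lam *: y) z; rewrite distrC; lra.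
have h2 := ler_wpM2r (normr_ge0 y) (lam_large lamn0).
have E : 24 * (D * eps0 * B) = 24 * B * S * (1 + C) * eps0 * `|y| by rewrite /D; ring.
by lra.
Qed.

(** The projection onto the increment of the partial sums ending at the first
    term of the [l]-th combination multiplies this increment by the [l]-th tail. *)
Lemma convex_lower_tail (b : nat -> R) n l : lam = 0 -> (l <= n)%N ->
  `|\sum_(l <= k < n) b k| * delta <= 2 * C * `|\sum_(k < n) b k *: v k|.
Proof.
move=> lam0 ln; have [g gP] := convex_first_ex.
set x := \sum_(k < n) b k *: v k; set tail := \sum_(l <= k < n) b k.
(* The increment before [M (g l)]; it starts at [0] if [g l] is the first index. *)
pose q := if g l is g'.+1 then M g' else 0%N.
have wE i : w i = partial (M i) by rewrite /w lam0 scale0r addr0.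
have qg : (q <= M (g l))%N.
  by rewrite /q; case: (g l) => // g'; rewrite ltnW// M_inc.
have pq : proj q x = \sum_(k < l) b k *: v k + tail *: partial q.
  apply: proj_convex_sum => // k i kl iF.
    have := convex_sets_lt kl iF (gP l).1; rewrite wE proj_partial /q.
    by case: (g l) => // g'; rewrite ltnS => ig; rewrite (minn_idPr _)// (increasing_leq M_inc).
  apply: proj_w; apply: leq_trans qg _; apply: (increasing_leq M_inc).
  exact: first_term_le iF.
have pg := proj_first_term gP b ln.
have db : delta <= `|partial (M (g l)) - partial q|.
  by rewrite /q; case: (g l) => [|g'//]; rewrite /partial big_ord0 subr0.
have : `|tail| * `|partial (M (g l)) - partial q| <= 2 * C * `|x|.
  rewrite -normrZ scalerBr.
  have -> : tail *: partial (M (g l)) - tail *: partial q = proj (M (g l)) x - proj q x.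
    by rewrite pq pg opprD addrACA subrr add0r.
  apply: le_trans (ler_normB _ _) _; have := cC x (M (g l)); have := cC x q.
  by rewrite -!/(proj _ x); lra.
by apply: le_trans; rewrite ler_wpM2l.
Qed.

End ConvexBlocks.

Lemma convex_lower_bounds : exists2 L : R, 0 < L & forall v, convex_block_sequence w v ->
  forall n (b : nat -> R),
    (forall l, (l <= n)%N -> `|\sum_(l <= k < n) b k| <= L * `|\sum_(k < n) b k *: v k|) /\
    `|lam| * `|\sum_(k < n) b k *: u k| <= L * `|\sum_(k < n) b k *: v k|.
Proof.
have C0 : 0 < C := lt_le_trans ltr01 C1.
have [lam0|lamn0] := eqVneq lam 0.
  have d0 := lam_delta lam0; exists (2 * C / delta); first by rewrite divr_gt0// mulr_gt0.
  move=> v [F [t [F0 F_lt t01 t1 vE]]] n b; split=> [l ln|]; last first.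
    by rewrite lam0 normr0 mul0r mulr_ge0// divr_ge0 ?(ltW d0)// mulr_ge0// ltW.
  rewrite mulrAC ler_pdivlMr//; by apply: (convex_lower_tail (F := F) (t := t)).
have lamp : 0 < `|lam| by rewrite normr_gt0.
pose L1 := 4 * C * Cu.
have L10 : 0 < L1 by rewrite !mulr_gt0.
have Q0 : 0 < S * (1 + C) / `|lam| by rewrite divr_gt0// mulr_gt0// addr_gt0.
exists (L1 + S * (1 + C) / `|lam| * L1); first by rewrite addr_gt0// mulr_gt0.
move=> v [F [t [F0 F_lt t01 t1 vE]]] n b.
have := convex_lower_average F0 F_lt t01 t1 vE b n lamn0; rewrite -/L1.
set x := `|\sum_(k < n) b k *: v k|; set y := `|\sum_(k < n) b k *: u k| => h.
have x0 : 0 <= x by rewrite normr_ge0.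
have L1x : 0 <= L1 * x by rewrite mulr_ge0// ltW.
have QL1x : 0 <= S * (1 + C) / `|lam| * (L1 * x) by rewrite mulr_ge0// ltW.
split=> [l ln|]; last by lra.
apply: le_trans (tail_le_averages b (lam_th lamn0) ln) _; rewrite -/y.
have h' := ler_wpM2l (ltW Q0) h.
have E : S * (1 + C) / `|lam| * (`|lam| * y) = S * (1 + C) * y.
  by field; rewrite gt_eqF.
by lra.
Qed.

Lemma convex_block_refl : convex_block_sequence w w.
Proof.
exists (fun n => [fset n]%fset), (fun _ _ => 1); split=> [n|n i j|n i _|n|n].
- by apply/fset0Pn; exists n; rewrite inE.
- by rewrite !inE => /eqP-> /eqP->.
- by rewrite ler01 lexx.
- by rewrite big_seq_fset1.
- by rewrite big_seq_fset1 scale1r.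
Qed.

Lemma convex_block_shift v p : convex_block_sequence w v ->
  convex_block_sequence w (fun n => v (n + p)%N).
Proof.
move=> [F [t [F0 F_lt t01 t1 vE]]].
exists (fun n => F (n + p)%N), (fun n => t (n + p)%N).
by split=> [n|n i j|n i|n|n]; [exact: F0|exact: F_lt|exact: t01|exact: t1|exact: vE].
Qed.

(** All convex block sequences of [w] satisfy the same two-sided estimate, so any
    two of them are equivalent with a common constant; a sequence and its shifts
    are two of them. The projections do not increase the tails of [b] and the
    norms of combinations of averages by more than a constant factor. *)
Lemma block_form_shiftable : convex_block_shiftable w.
Proof.
have [L L0 LP] := convex_lower_bounds.
have AW : 0 <= A + 2 * W by rewrite addr_ge0 ?A_ge0// mulr_ge0// W_ge0.
have up v n (b : nat -> R) (D E : R) : convex_block_sequence w v ->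
    (forall l, (l <= n)%N -> `|\sum_(l <= k < n) b k| <= D) ->
    `|lam| * `|\sum_(k < n) b k *: u k| <= E ->
    `|\sum_(k < n) b k *: v k| <= D * (A + 2 * W) + Cu * E.
  move=> [F [t [F0 F_lt t01 t1 vE]]] bD uE.
  apply: le_trans (convex_upper F0 F_lt t01 t1 vE bD) _; rewrite lerD2l.
  by rewrite mulrCA ler_wpM2l// ltW.
pose L' := L * (A + 2 * W) + Cu * L + 1.
have L'0 : 0 < L'.
  by rewrite ltr_wpDl// addr_ge0// mulr_ge0// ltW.
have compare v v' n (b : nat -> R) : convex_block_sequence w v ->
    convex_block_sequence w v' ->
    `|\sum_(k < n) b k *: v k| <= L' * `|\sum_(k < n) b k *: v' k|.
  move=> wv wv'; have [h1 h2] := LP v' wv' n b.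
  apply: le_trans (up v n b _ _ wv h1 h2) _.
  by rewrite /L'; have := normr_ge0 (\sum_(k < n) b k *: v' k); lra.
split; last first.
  exists L', w; split=> //; first by exists id; split.
  move=> v wv p n b; have wvp := convex_block_shift p wv; split.
    by rewrite ler_pdivrMl//; exact: (compare (fun n => v (n + p)%N) v).
  exact: (compare v (fun n => v (n + p)%N)).
apply: (@basic_sequence_criterion _ _ _ (2 * L * (A + 2 * W) + Cu * (C * L))).
  move=> k; have [h _] := LP w convex_block_refl k.+1 (fun i => (i == k)%:R).
  have := h k (leqnSn k); rewrite big_nat1 eqxx normr1 big_ord_recr /= eqxx scale1r.
  rewrite big1 ?add0r => [|i _]; last by rewrite ltn_eqF ?scale0r.
  by move=> h1; apply/eqP => wk0; move: h1; rewrite wk0 normr0 mulr0 ler10.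
move=> b m n mn; have [h1 h2] := LP w convex_block_refl n b.
have C0 : 0 <= C := le_trans ler01 C1.
apply: le_trans (up w m b (2 * L * `|\sum_(i < n) b i *: w i|)
  (C * (L * `|\sum_(i < n) b i *: w i|)) convex_block_refl _ _) _; last by lra.
  move=> l lm; have := h1 l (leq_trans lm mn); rewrite (big_cat_nat lm mn) /=.
  have := h1 m mn; set r1 := \sum_(l <= k < m) b k; set r2 := \sum_(m <= k < n) b k.
  by have := ler_normB (r1 + r2) r2; rewrite addrK; lra.
apply: le_trans _ (ler_wpM2l C0 h2); rewrite mulrCA ler_wpM2l//.
have -> : \sum_(k < m) b k *: u k = proj (M m) (\sum_(k < n) b k *: u k).
  rewrite (successive_blocks_sumP b n m M_inc averages_successive).
  by rewrite (big_ord_widen _ (fun k => b k *: u k) mn).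
exact: cC.
Qed.

End Shiftable.
End BlockForm.

(** The limit [Ls] of the sums splits into the part [mu] carried by the expansion
    of the weak-star limit and the part [Ls - mu] escaping to infinity. If
    nothing escapes, the partial sums along which [x] is approximated can not
    converge in norm, for [x] would converge weakly. *)
Lemma property_su_of_suppression : property_su X.
Proof.
move=> x [xw nx]; have xc := (weak_cauchyP x).1 xw.
have [Bx Bx0 xB] := weak_cauchy_bounded xw.
have [a ca] := choice (fun i => xc _ (coordinate_bounded_functional i)).
have C0 : 0 < C := lt_le_trans ltr01 C1.
pose A := C * Bx.
have pA m : `|partial a m| <= A.
  have h : `|proj m (x n)| @[n --> \oo] --> `|partial a m|.
    by apply: cvg_norm; apply: cvg_sum_ord => i; apply: cvgZl; exact: ca.
  rewrite -(cvg_lim _ h)//; apply: limr_le; first by apply/cvg_ex; eexists; exact: h.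
  exists 0%N => // n _; apply: le_trans (cC _ _) _.
  by rewrite /A ler_wpM2l ?(ltW C0).
have [Ls sL] := xc _ sum_functional_bounded.
have [mu muP] : exists mu : R, forall eps : R, 0 < eps -> forall m,
    exists2 n, (m <= n)%N & `|s (partial a n) - mu| <= eps.
  apply: (@real_cluster_point _ (S * A)) => n; apply: le_trans (sS _) _.
  by rewrite ler_wpM2l ?(ltW S0).
have Hd0 v m0 (eps : R) : 0 < eps -> exists m, [/\ (m0 <= m)%N,
    `|s (partial a m) - mu| <= eps & 0 <= `|partial a m - v|].
  by move=> e0; have [m mm sm] := muP eps e0 m0; exists m.
have conclude (eps0 delta : R) : 0 < eps0 ->
    (forall v m0 (eps : R), 0 < eps -> exists m, [/\ (m0 <= m)%N,
      `|s (partial a m) - mu| <= eps & delta <= `|partial a m - v|]) ->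
    (Ls - mu != 0 -> th) ->
    (Ls - mu != 0 -> 24 * B * S * (1 + C) * eps0 <= `|Ls - mu|) ->
    (Ls - mu = 0 -> 0 < delta) ->
    exists w, convex_block_shiftable w /\ weakly_null (fun n => x n - w n).
  move=> eps00 Hd l1 l2 l3.
  have [M [MN sM d0 dS wn]] := weak_cauchy_block_form pA xc ca sL eps00 Hd.
  exists (fun k => partial a (M k) + (Ls - mu) *: sparse_average e M N k); split.
    exact: (block_form_shiftable pA MN eps00 sM d0 dS l1 l2 l3).
  apply/weakly_nullP => f bf eps e0.
  have [m mP] := (cvg_seqP (V := R^o) _ _).1 (wn f bf) _ e0.
  by exists m => k /mP; rewrite subr0.
have [lam0|lamn0] := eqVneq (Ls - mu) 0; last first.
  have Q0 : 0 < 24 * B * S * (1 + C).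
    by have := bound_gt0 => B0; rewrite !mulr_gt0// addr_gt0.
  have lamp : 0 < `|Ls - mu| by rewrite normr_gt0.
  apply: (conclude (`|Ls - mu| / (24 * B * S * (1 + C))) 0) => //.
  - by rewrite divr_gt0.
  - move=> _; apply: contraT => nth; case/eqP: lamn0.
    apply: (sum_limit_eq0 (a := a) nth sL) => eps e0.
    by have [m _ mP] := muP eps e0 0%N; exists m.
  - by move=> _; rewrite mulrC divfK// gt_eqF.
  - by move=> l0; rewrite l0 eqxx in lamn0.
have [[delta d0 Hd]|nHd] := pselect (exists2 delta : R, 0 < delta &
    forall v m0 (eps : R), 0 < eps -> exists m, [/\ (m0 <= m)%N,
      `|s (partial a m) - mu| <= eps & delta <= `|partial a m - v|]).
  by apply: (conclude 1 delta) => //; rewrite lam0 eqxx.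
exfalso; apply: nx.
have [M [MN sM _ _ wn]] := weak_cauchy_block_form pA xc ca sL ltr01 Hd0.
have Mge k : (k <= M k)%N.
  apply: increasing_ge_id; exact: (block_start_increasing MN).
have [v pv] : exists v : X, partial a (M k) @[k --> \oo] --> v.
  apply/cauchy_seqP => eps e0.
  have [v [m0 [eps1 [e1 H]]]] : exists v m0 (eps1 : R), 0 < eps1 /\
      forall m, (m0 <= m)%N -> `|s (partial a m) - mu| <= eps1 ->
        `|partial a m - v| <= eps / 2.
    apply: contrapT => nH; apply: nHd; exists (eps / 2); first by rewrite divr_gt0.
    move=> v m0 eps1 e1; apply: contrapT => nm; apply: nH; exists v, m0, eps1.
    split=> // m mm sm; rewrite leNgt; apply/negP => /ltW h; apply: nm.
    by exists m.
  have [n nP] := (cvg_seqP _ _).1 (@cvg_geometric_half R) _ e1.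
  have near k : (maxn m0 n <= k)%N -> `|partial a (M k) - v| <= eps / 2.
    rewrite geq_max => /andP[mk /nP]; rewrite subr0 ger0_norm ?exprn_ge0// => hk.
    apply: H; first exact: leq_trans mk (Mge k).
    by apply: le_trans (sM k) _; rewrite mul1r.
  exists (maxn m0 n) => i j /near hi /near hj.
  have := ler_distD v (partial a (M i)) (partial a (M j)).
  by rewrite (distrC v); lra.
exists v => g cg; have bg := continuous_bounded_functional cg.
have [lg [D D0 gD]] := bg.
have gp : g (partial a (M k)) @[k --> \oo] --> (g v : R).
  apply/(cvg_seqP (V := R^o)) => eps e0.
  have [n nP] := (cvg_seqP _ _).1 pv _ (divr_gt0 e0 D0).
  exists n => k /nP; rewrite ler_pdivlMr// mulrC => h.
  by rewrite -(linear_funB _ _ lg); exact: le_trans (gD _) h.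
have := wn g bg; rewrite lam0 => gx.
have -> : g v = (0 : R) + g v by rewrite add0r.
rewrite (_ : (fun n => g (x n)) = (fun k => g (x k - (partial a (M k) +
  0 *: sparse_average e M N k)) + g (partial a (M k)))); first exact: cvgD.
apply/funext => k; rewrite scale0r addr0 (linear_funB _ _ lg).
by rewrite subrK.
Qed.

End Conclusion.

(** * Spreading bases *)

Lemma coefficient_sum_functional (R : realType) (X : completeNormedModType R)
    (e : nat -> X) (c : nat -> X -> R) (C S : R) :
  (forall i, linear_fun (c i)) ->
  (forall v m, `|\sum_(i < m) c i v *: e i| <= C * `|v|) ->
  (forall v, (fun m => \sum_(i < m) c i v *: e i) @ \oo --> v) ->
  (forall i j, c i (e j) = (i == j)%:R) -> 0 < S ->
  (forall n (a : nat -> R), `|\sum_(i < n) a i| <= S * `|\sum_(i < n) a i *: e i|) ->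
  exists s : X -> R, [/\ linear_fun s, forall v, `|s v| <= S * C * `|v| &
    forall i, s (e i) = 1].
Proof.
move=> clin cC ccvg ce S0 eS.
have cut (V : zmodType) (F : nat -> V) p q : (p <= q)%N ->
    \sum_(i < q) (if (i < p)%N then 0 else F i) = \sum_(i < q) F i - \sum_(i < p) F i.
  move=> pq; rewrite (big_ord_widen q F pq) [in X in _ - X]big_mkcond -sumrB.
  by apply: eq_bigr => i _; case: ifP; rewrite ?subrr ?subr0.
have dif v p q : (p <= q)%N -> `|\sum_(i < q) c i v - \sum_(i < p) c i v| <=
    S * `|\sum_(i < q) c i v *: e i - \sum_(i < p) c i v *: e i|.
  move=> pq; rewrite -(cut R (fun i => c i v))// -(cut X (fun i => c i v *: e i))//.
  have := eS q (fun i => if (i < p)%N then 0 else c i v).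
  congr (_ <= S * `| _ |); apply: eq_bigr => i _.
  by case: ifP => //; rewrite scale0r.
have scvg v : exists l : R, (\sum_(i < m) c i v) @[m --> \oo] --> l.
  have cv : exists l : X, (\sum_(i < m) c i v *: e i) @[m --> \oo] --> l.
    by exists v; exact: ccvg.
  apply/cauchy_seqP => eps eps0.
  have [m0 mP] := (cauchy_seqP _).1 cv _ (divr_gt0 eps0 S0).
  have main p q : (m0 <= p)%N -> (p <= q)%N ->
      `|\sum_(i < q) c i v - \sum_(i < p) c i v| <= eps.
    move=> mp pq; apply: le_trans (dif v p q pq) _.
    by rewrite mulrC -ler_pdivlMr//; apply: mP => //; exact: leq_trans mp pq.
  exists m0 => p q mp mq; case/orP: (leq_total p q) => pq; last exact: main.
  by rewrite distrC; exact: main.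
have [s sP] := choice scvg; exists s; split=> [t u v|v|i].
- apply: (cvg_unique _ (sP (t *: u + v))) => //.
  rewrite (_ : (fun m => \sum_(i < m) c i (t *: u + v)) =
    (fun m => t * (\sum_(i < m) c i u) + \sum_(i < m) c i v)).
    by apply: cvgD => //; apply: cvgMr.
  apply/funext => m; rewrite mulr_sumr -big_split; apply: eq_bigr => i _.
  exact: clin.
- have h : `|\sum_(i < m) c i v| @[m --> \oo] --> `|s v| by apply: cvg_norm.
  rewrite -(cvg_lim _ h)//; apply: limr_le; first by apply/cvg_ex; eexists; exact: h.
  exists 0%N => // m _; apply: le_trans (eS m (fun i => c i v)) _.
  by rewrite -mulrA ler_wpM2l ?(ltW S0).
- apply: (cvg_unique _ (sP (e i))) => //; apply/(cvg_seqP (V := R^o)) => eps eps0.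
  exists i.+1 => m im; rewrite (bigD1 (Ordinal im))//= ce eqxx big1.
    by rewrite addr0 subrr normr0 ltW.
  by move=> k; rewrite -val_eqE /= ce => /negbTE->.
Qed.

Theorem theorem7p6 (R : realType) (X : completeNormedModType R)
    (e : nat -> X) (e_basis : schauder_basis e) (e_spreading : spreading e) :
  property_su X.
Proof.
have [c [C [C1 clin cC ccvg cuniq]]] := schauder_basis_projections e_basis.
have C0 : 0 <= C := le_trans ler01 C1.
have eC := schauder_projection_bound clin cuniq cC.
have e0 := schauder_basis_neq0 e_basis.
have [K K1 eK] := spreading_pattern_bound e0 C0 eC e_spreading.
have K0 : 0 < K := lt_le_trans ltr01 K1.
pose B := K * `|e 0%N|.
have eB i : `|e i| <= B.
  have := eK 'I_1 (fun=> i) (fun=> 0%N) (fun=> 1).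
  rewrite !big_ord1 !scale1r; apply => k l; rewrite !ord1 => /(_ erefl) //.
have [[K' K'0 unc]|[[S S0 eS] small]] := spreading_dichotomy K1 eK eB.
  apply: (@property_su_of_suppression R X e c C C1 clin cC ccvg cuniq B eB false
    (fun=> 0) 1 _ _ _ _ K' K'0 _ (fun=> 1%N) 1) => //.
  - by move=> t u v; rewrite mulr0 addr0.
  - by move=> v; rewrite normr0 mul1r.
  - move=> n m a kappa A _ _; apply: le_trans (unc n a (fun i => ~~ A (kappa i))) _.
    by rewrite ler_wpM2l ?(ltW K'0)// lerDl sumr_ge0.
have [s [slin sS se]] := coefficient_sum_functional clin cC ccvg (coordinate_basis cuniq) S0 eS.
have B0 : 0 <= B by rewrite mulr_ge0// ltW.
have half_gt0 j : 0 < (2^-1) ^+ j :> R by rewrite exprn_gt0.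
have exN j : exists M, (0 < M)%N /\
    `|\sum_(l < M) (e l.*2.+1 - e l.*2)| <= M%:R * (2^-1) ^+ j.
  by have [M M0 MP] := small _ (half_gt0 j); exists M.
have [N NP] := choice exN.
have N_gt0 j : (0 < N j)%N := (NP j).1.
have Cu0 : 0 < K * K * K + 4 * K * K * S * C.
  by rewrite ltr_wpDr ?mulr_gt0// !mulr_ge0// ltW.
apply: (@property_su_of_suppression R X e c C C1 clin cC ccvg cuniq B eB true s (S * C) _ slin sS se
  (K * (K + B)) _ _ N _ N_gt0 Cu0) => //.
- by rewrite mulr_gt0// (lt_le_trans ltr01).
- by rewrite mulr_gt0// ltr_wpDr.
- move=> n m a kappa A kmono klt.
  apply: le_trans (block_suppression K1 eK eB a kmono klt A) _.
  rewrite -mulrA ler_wpM2l ?(ltW K0)//.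
  rewrite [X in _ <= _ * (_ + X)](eq_bigr (fun k : 'I_m => `|\sum_(i < n | kappa i == k) a i|));
    last by move=> k _; rewrite mul1r.
  set x := `|_|; set y := \sum_(k < m | _) _.
  have x0 : 0 <= x by rewrite normr_ge0.
  have y0 : 0 <= y by rewrite sumr_ge0.
  have := mulr_ge0 B0 x0; have := mulr_ge0 (ltW K0) y0; lra.
- move=> _ pos gap n m a kappa j kmono klt jinc.
  exact: (sparse_average_bound K1 eK eB C0 eC (ltW S0) eS N_gt0 (fun j => (NP j).2) gap).
- move=> _ pos f posge bf eps eps0.
  exact: (sparse_average_weak_limit K1 eK small N_gt0 posge bf).
- by move=> _ f bf; exact: (spreading_weak_cauchy K1 eK small bf).
Qed.
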